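(* Let $n\ge2$, $1\le k\le n-1$, $\alpha_1,\alpha_2,\gamma_1,\gamma_2\in\mathbb{R}$, $p\ge\max\{1,1+\alpha_2\}$ with $p>1+\alpha_2$ when $\alpha_2>0$, and assume $\gamma_1>0$ if $p=\frac{\alpha_1+n}{k}$. Consider $$\|\sin^{\gamma_1}d(0,\cdot)\cos^{\gamma_2}d(0,\cdot)\,R_kf\|_{L^\infty(\Xi_k(\mathbb{S}^n))}\le C\|f\|_{L^p_{\alpha_1,\alpha_2}(\mathbb{S}^n)}\quad\text{for all even radial }f\in L^p_{\alpha_1,\alpha_2}(\mathbb{S}^n).\qquad( * )$$ (A) If $k\ge2$, $( * )$ holds if and only if $\gamma_1\ge\max\{0,\frac{\alpha_1+n}{p}-k\}$ and $\gamma_2\ge\frac{1+\alpha_2}{p}$. (B) If $k=1$, $( * )$ holds if and only if these conditions hold and $p>2$.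
   Context: $\mathbb{S}^n\subset\mathbb{R}^{n+1}$ unit sphere with origin $0:=e_{n+1}$, distance $d$, surface measure $dx$. $\Xi_k(\mathbb{S}^n)$: $k$-dimensional totally geodesic submanifolds (intersections with $(k+1)$-dimensional linear subspaces) at distance $d(0,\xi)<\pi/2$ from $e_{n+1}$, with its rotation-invariant measure ($L^\infty$ = essential supremum). $R_kf(\xi)=\int_\xi f\,d_\xi x$. $\|f\|^p_{L^p_{\alpha_1,\alpha_2}(\mathbb{S}^n)}=\int|f(x)|^p\sin^{\alpha_1}d(0,x)|\cos d(0,x)|^{\alpha_2}dx$. Even radial: $f(x)=F(|x_{n+1}|)$. $C$ independent of $f$. *)

(* Defs.v *)
From HB Require Import structures.
From mathcomp Require Import all_boot all_order all_algebra.
From mathcomp Require Import all_classical all_reals all_analysis.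
Set Implicit Arguments. Unset Strict Implicit. Unset Printing Implicit Defensive.
Import Order.TTheory GRing.Theory Num.Theory.
Local Open Scope classical_set_scope.
Local Open Scope ring_scope.

Section Defs.
Variable R : realType.

Definition dot (m : nat) (x y : m.-tuple R) : R := \sum_(i < m) tnth x i * tnth y i.
Definition tnorm (m : nat) (x : m.-tuple R) : R := Num.sqrt (dot x x).
Definition tscale (m : nat) (c : R) (x : m.-tuple R) : m.-tuple R :=
  [tuple c * tnth x i | i < m].

(** north pole e_{n+1} of S^n ⊂ R^{n+1} (the "origin" 0 of the paper) *)
Definition npole (n : nat) : (n.+1).-tuple R := [tuple (i == ord_max)%:R | i < n.+1].

Definition sdist (m : nat) (x y : m.-tuple R) : R := acos (dot x y).

(** ** Lebesgue integral on R^m (and on products of copies of R^m), defined as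
    the iterated Lebesgue integral (Tonelli/Fubini). *)
Definition leb_int (g : R -> \bar R) : \bar R := (\int[@lebesgue_measure R]_t g t)%E.

Fixpoint tint (T : Type) (I : (T -> \bar R) -> \bar R) (m : nat) :
    (m.-tuple T -> \bar R) -> \bar R :=
  match m return ((m.-tuple T -> \bar R) -> \bar R) with
  | 0 => fun g => g [tuple]
  | m'.+1 => fun g => I (fun t => @tint T I m' (fun x => g [tuple of t :: x]))
  end.

Definition rint (m : nat) : (m.-tuple R -> \bar R) -> \bar R := @tint R leb_int m.

(** ** Surface measure on the unit sphere S^{m-1} ⊂ R^m, via the cone formula
    σ(A) = m · λ_m({r x : 0 < r <= 1, x ∈ A}), i.e.
    ∫_{S^{m-1}} h dσ = m ∫_{0<|x|<=1} h(x/|x|) dx. *)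
Definition sphere_int (m : nat) (h : m.-tuple R -> \bar R) : \bar R :=
  ((m%:R)%:E * rint (fun x => if ((0 < tnorm x) && (tnorm x <= 1))%R
                              then h (tscale (tnorm x)^-1 x) else 0))%E.

Definition wLp_pow (n : nat) (a1 a2 p : R) (f : (n.+1).-tuple R -> R) : \bar R :=
  sphere_int (fun x => ((`|f x| `^ p) * (sin (sdist (npole n) x) `^ a1)
                          * (`|cos (sdist (npole n) x)| `^ a2))%:E).

Definition wLp_norm (n : nat) (a1 a2 p : R) (f : (n.+1).-tuple R -> R) : R :=
  fine (wLp_pow a1 a2 p f) `^ p^-1.

Definition even_radial (n : nat) (F : R -> R) : (n.+1).-tuple R -> R :=
  fun x => F `|tnth x ord_max|.

(** ** Great k-spheres.  A k-dimensional totally geodesic submanifold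
    ξ = S^n ∩ V, V a (k+1)-dimensional linear subspace, is parametrized by a
    matrix M ∈ R^{(n+1)×(k+1)} (given by its k+1 columns) of rank k+1 with
    V = column space of M. *)
Definition mxapp (n k : nat) (M : (k.+1).-tuple ((n.+1).-tuple R))
    (u : (k.+1).-tuple R) : (n.+1).-tuple R :=
  [tuple \sum_(j < k.+1) tnth (tnth M j) i * tnth u j | i < n.+1].

Definition gram_det (n k : nat) (M : (k.+1).-tuple ((n.+1).-tuple R)) : R :=
  \det (\matrix_(i < k.+1, j < k.+1) dot (tnth M i) (tnth M j)).

Definition gsphere (n k : nat) (M : (k.+1).-tuple ((n.+1).-tuple R))
    : set ((n.+1).-tuple R) :=
  [set x | (exists u, x = mxapp M u) /\ tnorm x = 1].

Definition dist_pole (n k : nat) (M : (k.+1).-tuple ((n.+1).-tuple R)) : R :=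
  inf (sdist (npole n) @` gsphere M).

Definition in_Xi (n k : nat) (M : (k.+1).-tuple ((n.+1).-tuple R)) : bool :=
  (gram_det M != 0) && (dist_pole M < pi / 2).

(** k-plane transform R_k f(ξ) = ∫_ξ f(x) d_ξ x, with d_ξ x the surface
    (k-dimensional) measure on ξ; by the cone formula on V and the change of
    variables y = M u (Jacobian sqrt(det(M^T M))):
    ∫_ξ f = (k+1) sqrt(det(M^T M)) ∫_{0<|Mu|<=1} f(Mu/|Mu|) du. *)
Definition Rk (n k : nat) (f : (n.+1).-tuple R -> R)
    (M : (k.+1).-tuple ((n.+1).-tuple R)) : \bar R :=
  (((k.+1)%:R * Num.sqrt (gram_det M))%:E *
   rint (fun u => let y := mxapp M u in
                  if ((0 < tnorm y) && (tnorm y <= 1))%R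
                  then (f (tscale (tnorm y)^-1 y))%:E else 0))%E.

Definition esssup (T : Type) (I : (T -> \bar R) -> \bar R) (h : T -> \bar R)
    : \bar R :=
  ereal_inf [set c : \bar R | I (fun x => (\1_[set y | (c < h y)%E] x)%:E) = 0%E].

(** ‖ sin^{g1} d(0,·) cos^{g2} d(0,·) R_k f ‖_{L^∞(Ξ_k(S^n))}; the
    (rotation-invariant) measure class on Ξ_k is the image of Lebesgue measure
    on the matrices M ∈ R^{(n+1)×(k+1)}. *)
Definition weighted_Rk_sup (n k : nat) (g1 g2 : R) (f : (n.+1).-tuple R -> R)
    : \bar R :=
  esssup (@tint _ (@rint n.+1) k.+1)
    (fun M => if in_Xi M
              then `| ((sin (dist_pole M) `^ g1 * cos (dist_pole M) `^ g2)%:E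
                       * Rk f M)%E |%E
              else 0%E).

Definition ineq_star (n k : nat) (a1 a2 g1 g2 p : R) : Prop :=
  exists C : R, forall F : R -> R,
    measurable_fun [set: R] F ->
    (wLp_pow a1 a2 p (@even_radial n F) < +oo)%E ->
    (weighted_Rk_sup k g1 g2 (@even_radial n F)
       <= (C * wLp_norm a1 a2 p (@even_radial n F))%:E)%E.

End Defs.

(* Main.v *)
Require Import Defs.
From HB Require Import structures.
From mathcomp Require Import all_boot all_order all_algebra.
From mathcomp Require Import all_classical all_reals all_analysis.
From mathcomp Require Import measurable_realfun ring lra.
Set Implicit Arguments.
Unset Strict Implicit.
Unset Printing Implicit Defensive.
Import Order.TTheory GRing.Theory Num.Theory.
Import numFieldNormedType.Exports.
Local Open Scope classical_set_scope.
Local Open Scope ring_scope.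

(* An even radial [f] only depends on [x_{n+1}], so both sides of the inequality reduce
   to one-dimensional integrals. With [y = x_{n+1}^-2], [phi y = F (y^(-1/2))] and
   [kap = cos(d(0, xi))^-2], polar coordinates and the completion of the square in the
   Gram matrix of [xi] give, up to constants,
     R_k f (xi) = kap^(1/2) int_kap^oo y^(-(k+1)/2) (y - kap)^(k/2-1) phi y dy,
     |f|_p^p = int_1^oo |phi y|^p y^(-(e+b+1)) (y - 1)^b dy,
   where [b = (a1+n)/2 - 1] and [e = (1+a2)/2].
   Sufficiency is then Hoelder's inequality (for [p = 1], a pointwise bound on the
   kernel). For necessity, [phi] is the indicator of [[1+3eps, 1+4eps]] with
   [kap] between [1+eps] and [1+2eps], where [eps] tends to [0] or to [oo]; the indicator
   of [[3, 4]] with [kap] tending to [1]; and, if [k = 1], a cut-off of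
   [(y-2)^(-1/2)]. *)

(** The variable [y = x_{n+1}^-2] turns everything into powers: [sin^2 d(0, xi) = (kap - 1)/kap],
    and the kernel is a power of [y] times a power of [y - kap]. The number [kap] is the minimum of
    the Gram form over vectors with last coordinate 1, and this is what survives when the other
    coordinates are eliminated by Schur complements. Each condition of the theorem is a property of
    the dual function in Hoelder's inequality, with [1/p + 1/q = 1]. Integrability at [y = kap] asks
    [q (k/2 - 1) > -1], which for [k = 1] means [q < 2], that is [p > 2]. Integrability at infinity
    asks [1 + a2 < p]. The size for large [kap] gives the condition on [g2], and the growth as [kap]
    tends to 1 the one on [g1]; at [p = (a1 + n)/k] this growth is logarithmic, so that [g1 = 0]
    would fail there. The essential supremum ignores null sets of planes. Upper bounds may therefore
    skip the matrices with zero bottom-right entry, while lower bounds have to hold on a whole box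
    of matrices. *)

(** * Iterated Lebesgue integrals: affine substitution, measurability, exchange of order *)

Section Integrals.
Context {R : realType}.
Local Notation mu := (@lebesgue_measure R).
Local Open Scope ereal_scope.

(** The right side is a measure in [A], a pushforward scaled by [|a|], so uniqueness of Lebesgue
    measure leaves only half-open intervals. For [a < 0] the preimage of []x, y]] has its closed end
    on the left. *)
Lemma lebesgue_affine (a b : R) (A : set R) : a != 0%R -> measurable A ->
  mu A = (`|a|%:E * mu ((fun t => a * t + b)%R @^-1` A)).
Proof.
move=> a0 mA.
have mphi : measurable_fun [set: measurableTypeR R]
    (fun t : measurableTypeR R => a * t + b : measurableTypeR R)%R.
  by apply: measurable_funD => //; exact: mulrl_measurable.
pose nu : {measure set (measurableTypeR R) -> \bar R} :=
  mscale (NngNum (normr_ge0 a))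
    (measure_function_pushforward__canonical__measure_function_Measure mu mphi).
rewrite -[RHS]/(nu A); apply: lebesgue_measure_unique => // _ [[x y] /= xy <-].
rewrite /nu /mscale/= /pushforward.
have a0' : (0 < `|a|)%R by rewrite normr_gt0.
have [ap|an|a0e] := ltgtP a 0%R; last by rewrite a0e eqxx in a0.
- rewrite [X in _ * mu X](_ : _ = `[((y - b) / a)%R, ((x - b) / a)%R[%classic); last first.
    apply/seteqP; split=> t /=; rewrite !in_itv/= ler_ndivrMr// ltr_ndivlMr// => /andP[h1 h2];
    apply/andP; split; lra.
  rewrite !lebesgue_measure_itv/= !lte_fin ltr_nM2r ?invr_lt0//.
  rewrite ltrD2r; case: ifP => _; last by rewrite mule0.
  by rewrite -!EFinD -EFinM ltr0_norm//; congr EFin; field.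
- rewrite [X in _ * mu X](_ : _ = `]((x - b) / a)%R, ((y - b) / a)%R]%classic); last first.
    apply/seteqP; split=> t /=; rewrite !in_itv/= ltr_pdivrMr// ler_pdivlMr// => /andP[h1 h2];
    apply/andP; split; lra.
  rewrite !lebesgue_measure_itv/= !lte_fin ltr_pM2r ?invr_gt0//.
  rewrite ltrD2r; case: ifP => _; last by rewrite mule0.
  by rewrite -!EFinD -EFinM gtr0_norm//; congr EFin; field.
Qed.

Lemma integral_affine (a b : R) (f : R -> \bar R) : a != 0%R ->
  measurable_fun [set: R] f -> (forall x, 0 <= f x) ->
  \int[mu]_t f t = `|a|%:E * \int[mu]_t f (a * t + b)%R.
Proof.
move=> a0 mf f0.
have mphi : measurable_fun [set: measurableTypeR R]
    (fun t : measurableTypeR R => a * t + b : measurableTypeR R)%R.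
  by apply: measurable_funD => //; exact: mulrl_measurable.
pose nu : {measure set (measurableTypeR R) -> \bar R} :=
  mscale (NngNum (normr_ge0 a))
    (measure_function_pushforward__canonical__measure_function_Measure mu mphi).
transitivity (\int[nu]_t f t).
  by apply: eq_measure_integral => A mA _; exact: lebesgue_affine.
rewrite ge0_integral_mscale//=; congr (_ * _).
by rewrite (ge0_integral_pushforward mphi)//=.
Qed.

(** The integral of a nonnegative function is a supremum over the simple functions below it, and
    this family grows with the function. The comparison thus covers arbitrary functions, such as the
    indicator inside [esssup]. *)
Lemma le_integral_ge0 d (T : measurableType d) (m : {measure set T -> \bar R}) (f g : T -> \bar R) :
  (forall x, 0 <= f x) -> (forall x, f x <= g x) ->
  \int[m]_x f x <= \int[m]_x g x.
Proof.
move=> f0 fg; have g0 x : 0 <= g x by exact: le_trans (f0 x) (fg x).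
rewrite !ge0_integralTE//; apply: le_ereal_sup => _ [h hf <-].
by exists h => // x; exact: le_trans (hf x) (fg x).
Qed.

(** Tonelli gives measurability for the positive and the negative part separately; the signed case
    serves [le_abse_rint]. *)
Lemma measurable_integral d (T : measurableType d) (f : T -> R -> \bar R) :
  measurable_fun [set: T * R] (fun z => f z.1 z.2) ->
  measurable_fun [set: T] (fun x => \int[mu]_t f x t).
Proof.
move=> mf.
rewrite [X in measurable_fun _ X](_ : _ = (fun x => (\int[mu]_t (f x)^\+ t)
   - (\int[mu]_t (f x)^\- t)))//; last by apply/funext => x; rewrite integralE.
apply: emeasurable_funB.
- have := @measurable_fun_fubini_tonelli_F _ _ T (measurableTypeR R) R mu
    (fun z => (f z.1)^\+ z.2); rewrite /fubini_F/=; apply.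
    rewrite [X in measurable_fun _ X](_ : _ = (fun z => f z.1 z.2)^\+); last first.
      by apply/funext => -[? ?]; rewrite !funeposE.
    exact: measurable_funepos.
  by move=> z; exact: funepos_ge0.
- have := @measurable_fun_fubini_tonelli_F _ _ T (measurableTypeR R) R mu
    (fun z => (f z.1)^\- z.2); rewrite /fubini_F/=; apply.
    rewrite [X in measurable_fun _ X](_ : _ = (fun z => f z.1 z.2)^\-); last first.
      by apply/funext => -[? ?]; rewrite !funenegE.
    exact: measurable_funeneg.
  by move=> z; exact: funeneg_ge0.
Qed.

Lemma integral_swap (f : R -> R -> \bar R) :
  measurable_fun [set: R * R] (fun z => f z.1 z.2) ->
  (forall x y, 0 <= f x y) ->
  \int[mu]_x \int[mu]_y f x y = \int[mu]_y \int[mu]_x f x y.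
Proof.
move=> mf f0.
exact: (fubini_tonelli (fun z : measurableTypeR R * measurableTypeR R => f z.1 z.2)).
Qed.


Lemma measurable_comp2 d d1 d2 d' (T : measurableType d) (T1 : measurableType d1)
    (T2 : measurableType d2) (V : measurableType d')
    (f : T1 -> T2 -> V) (g1 : T -> T1) (g2 : T -> T2) :
  measurable_fun [set: T1 * T2] (fun z => f z.1 z.2) ->
  measurable_fun [set: T] g1 -> measurable_fun [set: T] g2 ->
  measurable_fun [set: T] (fun x => f (g1 x) (g2 x)).
Proof.
move=> mf m1 m2.
apply: (@measurableT_comp _ _ _ _ _ _ (fun z : T1 * T2 => f z.1 z.2) setT (fun x => (g1 x, g2 x)) mf).
exact/measurable_fun_pairP.
Qed.

Lemma rintS m (f : m.+1.-tuple R -> \bar R) :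
  rint f = \int[mu]_t rint (fun x => f [tuple of t :: x]).
Proof. by []. Qed.

Lemma measurable_cons_tuple d (T : measurableType d) m (f : T -> R) (g : T -> m.-tuple R) :
  measurable_fun [set: T] f -> measurable_fun [set: T] g ->
  measurable_fun [set: T] (fun x => [tuple of f x :: g x]).
Proof. exact: measurable_cons. Qed.

Lemma measurable_rint d (T : measurableType d) m (f : T -> m.-tuple R -> \bar R) :
  measurable_fun [set: T * m.-tuple R] (fun z => f z.1 z.2) ->
  measurable_fun [set: T] (fun x => rint (f x)).
Proof.
elim: m d T f => [|m IH] d T f mf.
  exact: (@measurable_comp2 _ _ _ _ _ _ _ _ f id (fun=> [tuple])).
apply: (@measurable_integral _ T (fun x t => rint (fun y => f x [tuple of t :: y]))).
(* The coordinate [t] joins the parameter: the induction runs over all parameter spaces, here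
   [T * R]. *)
apply: (IH _ (T * R)%type (fun z y => f z.1 [tuple of z.2 :: y])).
apply: (@measurable_comp2 _ _ _ _ (T * R * m.-tuple R)%type T (m.+1.-tuple R) _ f
  (fun z => z.1.1) (fun z => [tuple of z.1.2 :: z.2])) => //.
  exact: (@measurableT_comp _ _ _ _ _ _ fst).
apply: measurable_cons_tuple => //.
exact: (@measurableT_comp _ _ _ _ _ _ snd).
Qed.

Lemma rint_ge0 m (f : m.-tuple R -> \bar R) : (forall x, 0 <= f x) -> 0 <= rint f.
Proof.
elim: m f => [|m IH] f f0 /=; first exact: f0.
by apply: integral_ge0 => t _; exact: IH.
Qed.

Lemma le_rint m (f g : m.-tuple R -> \bar R) :
  (forall x, 0 <= f x) -> (forall x, f x <= g x) -> rint f <= rint g.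
Proof.
elim: m f g => [|m IH] f g f0 fg /=; first exact: fg.
apply: le_integral_ge0 => t; first by apply: rint_ge0.
exact: IH.
Qed.

Lemma eq_rint m (f g : m.-tuple R -> \bar R) : f =1 g -> rint f = rint g.
Proof. by move=> /funext->. Qed.

Lemma measurable_rint_cons m (f : m.+1.-tuple R -> \bar R) :
  measurable_fun [set: m.+1.-tuple R] f ->
  measurable_fun [set: R] (fun t => rint (fun y => f [tuple of t :: y])).
Proof.
move=> mf; apply: (@measurable_rint _ R m (fun t y => f [tuple of t :: y])).
by apply: (@measurableT_comp _ _ _ _ _ _ f) => //; exact: measurable_cons_tuple.
Qed.

Lemma measurable_cons_section m (f : m.+1.-tuple R -> \bar R) t :
  measurable_fun [set: m.+1.-tuple R] f ->
  measurable_fun [set: m.-tuple R] (fun y => f [tuple of t :: y]).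
Proof.
move=> mf.
by apply: (@measurableT_comp _ _ _ _ _ _ f) => //; exact: measurable_cons_tuple.
Qed.

Lemma rintZl m (c : R) (f : m.-tuple R -> \bar R) : (0 <= c)%R ->
  measurable_fun [set: m.-tuple R] f -> (forall x, 0 <= f x) ->
  rint (fun x => c%:E * f x) = c%:E * rint f.
Proof.
move=> c0; elim: m f => [//|m IH] f mf f0 /=.
rewrite /rint/= /leb_int -ge0_integralZl//.
- by apply: eq_integral => t _; apply: IH => //; exact: measurable_cons_section.
- exact: measurable_rint_cons.
- by move=> t _; exact: rint_ge0.
Qed.

Lemma rint_swap m (f : R -> m.-tuple R -> \bar R) :
  measurable_fun [set: R * m.-tuple R] (fun z => f z.1 z.2) ->
  (forall t x, 0 <= f t x) ->
  \int[mu]_t rint (f t) = rint (fun x => \int[mu]_t f t x).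
Proof.
elim: m f => [//|m IH] f mf f0.
transitivity (\int[mu]_t \int[mu]_s rint (fun y => f t [tuple of s :: y])) => //.
rewrite (@integral_swap (fun t s => rint (fun y => f t [tuple of s :: y]))).
- rewrite rintS; apply: eq_integral => s _; apply: (IH (fun t y => f t [tuple of s :: y])) => //.
  apply: (@measurable_comp2 _ _ _ _ (R * m.-tuple R)%type R (m.+1.-tuple R) _ f
    (fun z => z.1) (fun z => [tuple of s :: z.2])) => //.
    exact: measurable_fst.
  exact: measurable_cons_tuple.
- apply: (@measurable_rint _ (R * R)%type m (fun z y => f z.1 [tuple of z.2 :: y])).
  apply: (@measurable_comp2 _ _ _ _ (R * R * m.-tuple R)%type R (m.+1.-tuple R) _ f
    (fun z => z.1.1) (fun z => [tuple of z.1.2 :: z.2])) => //.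
    exact: (@measurableT_comp _ _ _ _ _ _ fst).
  apply: measurable_cons_tuple => //.
  exact: (@measurableT_comp _ _ _ _ _ _ snd).
- by move=> *; exact: rint_ge0.
Qed.

Lemma le_abse_rint m (f : m.-tuple R -> \bar R) :
  measurable_fun [set: m.-tuple R] f -> `|rint f| <= rint (fun x => `|f x|).
Proof.
elim: m f => [//|m IH] f mf; rewrite !rintS.
apply: le_trans (le_abse_integral _ _ _) _ => //; first exact: measurable_rint_cons.
apply: le_integral_ge0 => // t; apply: IH; exact: measurable_cons_section.
Qed.

End Integrals.

(** * Quadratic forms: Schur complements and elimination of all coordinates but the last *)

Section Quadratic.
Context {R : realType}.
Local Notation mu := (@lebesgue_measure R).

Definition qform m (S : 'M[R]_m) (u : m.-tuple R) : R :=
  \sum_i \sum_j S i j * (tnth u i * tnth u j).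
Definition lform m (l : 'I_m -> R) (u : m.-tuple R) : R := \sum_i l i * tnth u i.
Definition sqn m (u : m.-tuple R) : R := \sum_i tnth u i ^+ 2.
Definition posdef m (S : 'M[R]_m) :=
  forall u : m.-tuple R, (exists i, tnth u i != 0) -> 0 < qform S u.
Definition lastc m (u : m.+1.-tuple R) : R := tnth u ord_max.

Lemma tnth_cons0 m (t : R) (x : m.-tuple R) : tnth [tuple of t :: x] ord0 = t.
Proof. exact: tnth0. Qed.

Lemma tnth_consS m (t : R) (x : m.-tuple R) i :
  tnth [tuple of t :: x] (lift ord0 i) = tnth x i.
Proof. exact: tnthS. Qed.

Lemma ord_maxS m : ord_max = lift ord0 ord_max :> 'I_m.+2.
Proof. exact: val_inj. Qed.

Lemma lastc_cons m t (x : m.+1.-tuple R) : lastc [tuple of t :: x] = lastc x.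
Proof. by rewrite /lastc ord_maxS tnth_consS. Qed.

Lemma sqn_cons m t (x : m.-tuple R) : sqn [tuple of t :: x] = t ^+ 2 + sqn x.
Proof.
rewrite /sqn big_ord_recl tnth_cons0; congr (_ + _).
by apply: eq_bigr => i _; rewrite tnth_consS.
Qed.

Lemma sqn_ge0 m (x : m.-tuple R) : 0 <= sqn x.
Proof. by apply: sumr_ge0 => i _; rewrite sqr_ge0. Qed.

Lemma measurable_qform m (S : 'M[R]_m) : measurable_fun [set: m.-tuple R] (qform S).
Proof.
apply: measurable_sum => i; apply: measurable_sum => j.
apply: measurable_funM => //; apply: measurable_funM; exact: measurable_tnth.
Qed.

Lemma measurable_lform m (l : 'I_m -> R) : measurable_fun [set: m.-tuple R] (lform l).
Proof.
by apply: measurable_sum => i; apply: measurable_funM => //; exact: measurable_tnth.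
Qed.

Lemma measurable_sqn m : measurable_fun [set: m.-tuple R] (@sqn m).
Proof.
by apply: measurable_sum => i; apply: measurable_funX; exact: measurable_tnth.
Qed.

(** Schur complement of the corner entry: the form left in the remaining variables once the square
    in the first variable is completed. The shift in that square is [schur_shift]. *)
Definition schur m (S : 'M[R]_m.+1) : 'M[R]_m :=
  \matrix_(i, j) (S (lift ord0 i) (lift ord0 j)
    - S ord0 (lift ord0 i) * S ord0 (lift ord0 j) / S ord0 ord0).

Definition schur_shift m (S : 'M[R]_m.+1) : 'I_m -> R :=
  fun j => S ord0 (lift ord0 j) / S ord0 ord0.

Lemma qform_schur m (S : 'M[R]_m.+1) (t : R) (x : m.-tuple R) : S^T = S -> S ord0 ord0 != 0 ->
  qform S [tuple of t :: x] =
  S ord0 ord0 * (t + lform (schur_shift S) x) ^+ 2 + qform (schur S) x.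
Proof.
move=> symS S0.
have sym i j : S i j = S j i by rewrite -[in LHS]symS mxE.
pose b := \sum_j S ord0 (lift ord0 j) * tnth x j.
have -> : lform (schur_shift S) x = b / S ord0 ord0.
  by rewrite /lform /b mulr_suml; apply: eq_bigr => j _; rewrite /schur_shift mulrAC.
rewrite /qform big_ord_recl big_ord_recl tnth_cons0.
rewrite (eq_bigr (fun j => t * (S ord0 (lift ord0 j) * tnth x j))); last first.
  by move=> j _; rewrite tnth_consS; ring.
rewrite -mulr_sumr -/b.
rewrite [X in _ + X = _](eq_bigr (fun i => t * (S ord0 (lift ord0 i) * tnth x i) +
   \sum_j S (lift ord0 i) (lift ord0 j) * (tnth x i * tnth x j))); last first.
  move=> i _; rewrite big_ord_recl tnth_cons0 tnth_consS sym; congr (_ + _); first by ring.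
  by apply: eq_bigr => j _; rewrite tnth_consS.
rewrite big_split/= -mulr_sumr -/b.
rewrite [X in _ = _ + X](_ : _ = \sum_i \sum_j S (lift ord0 i) (lift ord0 j) * (tnth x i * tnth x j)
   - b ^+ 2 / S ord0 ord0); last first.
  transitivity (\sum_i (\sum_j S (lift ord0 i) (lift ord0 j) * (tnth x i * tnth x j) -
     \sum_j (S ord0 (lift ord0 i) * tnth x i) * (S ord0 (lift ord0 j) * tnth x j) / S ord0 ord0)).
    apply: eq_bigr => i _; rewrite -sumrB; apply: eq_bigr => j _; rewrite mxE; ring.
  rewrite sumrB; congr (_ - _).
  rewrite expr2 {1}/b mulr_suml mulr_suml; apply: eq_bigr => i _.
  by rewrite -mulr_suml -mulr_sumr.
by field.
Qed.

(** Clearing the first column with the unit lower triangular [L] leaves a block triangular matrix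
    with diagonal blocks [S ord0 ord0] and [schur S]. *)
Lemma det_schur m (S : 'M[R]_m.+1) : S^T = S -> S ord0 ord0 != 0 ->
  \det S = S ord0 ord0 * \det (schur S).
Proof.
move=> symS S0.
have sym i j : S i j = S j i by rewrite -[in LHS]symS mxE.
pose S' := S : 'M[R]_(1 + m).
pose L : 'M[R]_(1 + m) := block_mx 1%:M 0 (- (S ord0 ord0)^-1 *: dlsubmx S') 1%:M.
have dL : \det L = 1 by rewrite /L det_lblock !det1 mulr1.
have -> : \det S = \det (L *m S') by rewrite det_mulmx dL mul1r.
have -> : L *m S' = block_mx (ulsubmx S') (ursubmx S') 0 (schur S).
  rewrite -[S' in LHS]submxK /L mulmx_block !mul1mx !mul0mx !addr0; congr block_mx.
  - apply/matrixP => i j; rewrite !mxE big_ord1 !mxE !lshift0 (ord1 j) !lshift0; by field.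
  - apply/matrixP => i j; rewrite !mxE big_ord1 !mxE !lshift0 !rshift1 /S' (sym (lift _ _) ord0).
    by field.
by rewrite det_ublock [ulsubmx _]mx11_scalar det_scalar1 !mxE !lshift0.
Qed.

Lemma schur_sym m (S : 'M[R]_m.+1) : S^T = S -> (schur S)^T = schur S.
Proof.
move=> symS; have sym i j : S i j = S j i by rewrite -[in LHS]symS mxE.
by apply/matrixP => i j; rewrite !mxE sym [X in _ - X / _]mulrC.
Qed.

Lemma posdef00 m (S : 'M[R]_m.+1) : posdef S -> 0 < S ord0 ord0.
Proof.
move=> pS; pose u := [tuple (i == ord0)%:R | i < m.+1] : m.+1.-tuple R.
have := pS u; have -> : qform S u = S ord0 ord0.
  rewrite /qform (bigD1 ord0)//= (bigD1 ord0)//= !tnth_mktuple eqxx !mulr1.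
  rewrite !big1 ?addr0// => i i0; rewrite ?tnth_mktuple.
    by rewrite big1// => j _; rewrite (negbTE i0) mul0r mulr0.
  by rewrite (negbTE i0) !mulr0.
by apply; exists ord0; rewrite tnth_mktuple eqxx oner_eq0.
Qed.

Lemma schur_posdef m (S : 'M[R]_m.+1) : S^T = S -> posdef S -> posdef (schur S).
Proof.
move=> symS pS x [i xi].
have S0 := posdef00 pS.
(* This first coordinate makes the completed square vanish, so [S] takes on the long vector the
   value of [schur S] on [x]. *)
have := pS [tuple of - lform (schur_shift S) x :: x].
rewrite qform_schur ?gt_eqF// addNr expr0n mulr0 add0r; apply.
by exists (lift ord0 i); rewrite tnth_consS.
Qed.

Local Open Scope ereal_scope.

Lemma measurable_quad (Phi : R -> R -> \bar R) d (T : measurableType d) (f g : T -> R) :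
  measurable_fun [set: R * R] (fun z => Phi z.1 z.2) ->
  measurable_fun [set: T] f -> measurable_fun [set: T] g ->
  measurable_fun [set: T] (fun x => Phi (f x) (g x)).
Proof. exact: measurable_comp2. Qed.

(** Coordinates are eliminated from the front, since the integrand still depends on the last one.
    [D] is the product of the square roots of the pivots met on the way, and [kap] is the last
    pivot, hence the minimum of the form on [lastc u = 1]. *)
Lemma rint_schur_reduce m (S : 'M[R]_m.+1) : S^T = S -> posdef S ->
  exists kap D : R, [/\ (0 < kap)%R, (0 < D)%R, (D ^+ 2 * kap = \det S)%R,
    (forall u, kap * lastc u ^+ 2 <= qform S u)%R /\
    (exists u, lastc u = 1%R /\ qform S u = kap) &
    forall Phi : R -> R -> \bar R,
      measurable_fun [set: R * R] (fun z => Phi z.1 z.2) -> (forall s w, 0 <= Phi s w) ->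
      rint (fun u => Phi (qform S u) (lastc u)) =
      (D^-1)%:E * rint (fun x : m.-tuple R => \int[mu]_w Phi (sqn x + kap * w ^+ 2)%R w)].
Proof.
elim: m S => [|m IH] S symS pS.
  have S0 := posdef00 pS.
  have qE (u : 1.-tuple R) : qform S u = (S ord0 ord0 * lastc u ^+ 2)%R.
    by rewrite /qform !big_ord1 expr2 /lastc (_ : ord_max = ord0)//; exact: val_inj.
  exists (S ord0 ord0), 1%R; split=> //.
  - by rewrite expr1n mul1r det_mx11.
  - split; first by move=> u; rewrite qE.
    exists [tuple of [:: 1%R]]; rewrite qE.
    have -> : lastc [tuple of [:: 1%R]] = 1%R by [].
    by rewrite expr1n mulr1.
  - move=> Phi mPhi Phi0; rewrite invr1 mul1e rintS.
    rewrite {2}/rint/= /sqn; apply: eq_integral => w _.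
    by rewrite /rint/= qE big_ord0 add0r.
have S0 := posdef00 pS.
have S0' : S ord0 ord0 != 0%R by rewrite gt_eqF.
have [kap [D [kap0 D0 Dk [lb [u0 [u01 u0k]]] H]]] := IH _ (schur_sym symS) (schur_posdef symS pS).
(* Substituting [a t] for the first coordinate turns its square into [t ^+ 2]; the Jacobian [a^-1]
   goes into [D]. *)
pose a := Num.sqrt (S ord0 ord0).
have a0 : (0 < a)%R by rewrite sqrtr_gt0.
have a2 : (a ^+ 2 = S ord0 ord0)%R by rewrite sqr_sqrtr// ltW.
exists kap, (a * D)%R; split=> //.
- exact: mulr_gt0.
- by rewrite exprMn -mulrA Dk a2 -det_schur.
- split.
    move=> u; case/tupleP: u => t x; rewrite -/([tuple of t :: x]) lastc_cons qform_schur//.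
    by rewrite (le_trans (lb x))// lerDr mulr_ge0 ?sqr_ge0// ltW.
  exists [tuple of (- lform (schur_shift S) u0)%R :: u0].
  by rewrite lastc_cons qform_schur// addNr expr0n mulr0 add0r.
move=> Phi mPhi Phi0.
(* Integrating out the first coordinate gives a new test function of the same two arguments, to
   which the induction hypothesis for [schur S] applies. *)
pose Phi2 s w := \int[mu]_t Phi (t ^+ 2 + s)%R w.
have mPhi2 : measurable_fun [set: R * R] (fun z => Phi2 z.1 z.2).
  apply: (@measurable_integral _ _ (R * R)%type (fun z t => Phi (t ^+ 2 + z.1)%R z.2)).
  apply: measurable_quad => //=.
    apply: measurable_funD; first exact: measurable_funX.
    exact: (@measurableT_comp _ _ _ _ _ _ fst).
  exact: (@measurableT_comp _ _ _ _ _ _ snd).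
have Phi20 s w : 0 <= Phi2 s w by apply: integral_ge0.
have mlast : measurable_fun [set: m.+1.-tuple R] (@lastc m) by exact: measurable_tnth.
transitivity (rint (fun x : m.+1.-tuple R => (a^-1)%:E * Phi2 (qform (schur S) x) (lastc x))).
  rewrite rintS (@rint_swap _ _ (fun t x => Phi (qform S [tuple of t :: x]) (lastc [tuple of t :: x])))//.
    apply: eq_rint => x.
    pose f t := Phi (t ^+ 2 + qform (schur S) x)%R (lastc x).
    rewrite /Phi2 -/(f _) [X in _ * X](@integral_affine _ a (a * lform (schur_shift S) x)%R f) ?gt_eqF//.
      rewrite muleA gtr0_norm// -EFinM mulVf ?gt_eqF// mul1e.
      apply: eq_integral => t _; rewrite qform_schur// lastc_cons /f.
      by rewrite -mulrDr exprMn a2.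
      apply: measurable_quad => //.
      by apply: measurable_funD => //; exact: measurable_funX.
    by move=> t; exact: Phi0.
  apply: measurable_quad => //.
    apply: (@measurableT_comp _ _ _ _ _ _ (qform S)) => //; first exact: measurable_qform.
    exact: measurable_cons_tuple.
  apply: (@measurableT_comp _ _ _ _ _ _ (@lastc m.+1)) => //; first exact: measurable_tnth.
  exact: measurable_cons_tuple.
rewrite (@rintZl _ _ _ (fun x : m.+1.-tuple R => Phi2 (qform (schur S) x) (lastc x))); last 3 first.
  - by rewrite invr_ge0 ltW.
  - by apply: measurable_quad => //; exact: measurable_qform.
  - by [].
rewrite H// muleA -EFinM -invfM; congr (_ * _).
rewrite rintS (@rint_swap _ _ (fun t x => \int[mu]_w Phi (sqn [tuple of t :: x] + kap * w ^+ 2)%R w)).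
- apply: eq_rint => x; rewrite /Phi2.
  rewrite (@integral_swap _ (fun w t => Phi (t ^+ 2 + (sqn x + kap * w ^+ 2))%R w)); last 2 first.
  + apply: measurable_quad => //.
    apply: measurable_funD; first by apply: measurable_funX.
    apply: measurable_funD => //; apply: measurable_funM => //; exact: measurable_funX.
  + by [].
  by apply: eq_integral => t _; apply: eq_integral => w _; rewrite sqn_cons addrA.
- apply: (@measurable_integral _ _ (R * m.-tuple R)%type (fun z w => Phi (sqn [tuple of z.1 :: z.2] + kap * w ^+ 2)%R w)).
  apply: measurable_quad => //.
  apply: measurable_funD.
    apply: (@measurableT_comp _ _ _ _ _ _ (@sqn m.+1)) => //; first exact: measurable_sqn.
    apply: measurable_cons_tuple.
      exact: (@measurableT_comp _ _ _ _ _ _ fst).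
    exact: (@measurableT_comp _ _ _ _ _ _ snd).
  by apply: measurable_funM => //; exact: measurable_funX.
- by move=> t x; apply: integral_ge0.
Qed.

End Quadratic.

Lemma powRD_gt0 {R : realType} (x r s : R) : 0 < x -> x `^ (r + s) = x `^ r * x `^ s.
Proof. by move=> x0; apply: powRD; rewrite (gt_eqF x0) implybT. Qed.

(** * Measurability: composition rules and the tactic [mfun] *)

Section MeasurableTools.
Context {R : realType}.
Context d (T : measurableType d).
Implicit Types f g : T -> R.

Lemma measurable_powR_comp f p :
  measurable_fun [set: T] f -> measurable_fun [set: T] (fun x => f x `^ p).
Proof. by move=> mf; apply: (@measurableT_comp _ _ _ _ _ _ (@powR R ^~ p)) => //; exact: measurable_powR. Qed.

Lemma measurable_norm_comp f :
  measurable_fun [set: T] f -> measurable_fun [set: T] (fun x => `|f x|).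
Proof. by move=> mf; apply: (@measurableT_comp _ _ _ _ _ _ (@Num.norm R R)) => //; exact: normr_measurable. Qed.

Lemma measurable_sqrt_comp f :
  measurable_fun [set: T] f -> measurable_fun [set: T] (fun x => Num.sqrt (f x)).
Proof.
move=> mf.
rewrite (_ : (fun x => _) = (fun x => if 0 <= f x then f x `^ 2^-1 else 0)).
  apply: measurable_fun_ifT => //; first exact: measurable_fun_ler.
  exact: measurable_powR_comp.
apply/funext => x; case: ifPn => h; first by rewrite powR12_sqrt.
by rewrite ler0_sqrtr// ltW// ltNge.
Qed.

Lemma measurable_inv_comp f :
  measurable_fun [set: T] f -> measurable_fun [set: T] (fun x => (f x)^-1).
Proof.
move=> mf.
rewrite (_ : (fun x => _) = (fun x => if 0 <= f x then f x `^ (-1) else - ((- f x) `^ (-1)))).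
  apply: measurable_fun_ifT => //; first exact: measurable_fun_ler.
    exact: measurable_powR_comp.
  by apply: measurable_funN; apply: measurable_powR_comp; exact: measurable_funN.
apply/funext => x; case: ifPn => h; first by rewrite powR_inv1.
by rewrite powR_inv1 ?invrN ?opprK// oppr_ge0 ltW// ltNge.
Qed.

Lemma measurable_fst_comp d1 d2 (T1 : measurableType d1) (T2 : measurableType d2)
    (f : T -> T1 * T2) :
  measurable_fun [set: T] f -> measurable_fun [set: T] (fun x => (f x).1).
Proof. by move=> mf; apply: (@measurableT_comp _ _ _ _ _ _ fst). Qed.

Lemma measurable_snd_comp d1 d2 (T1 : measurableType d1) (T2 : measurableType d2)
    (f : T -> T1 * T2) :
  measurable_fun [set: T] f -> measurable_fun [set: T] (fun x => (f x).2).
Proof. by move=> mf; apply: (@measurableT_comp _ _ _ _ _ _ snd). Qed.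

Lemma measurable_EFin_comp f :
  measurable_fun [set: T] f -> measurable_fun [set: T] (fun x => (f x)%:E).
Proof. by move=> mf; exact/measurable_EFinP. Qed.

Lemma measurable_mule_comp (f g : T -> \bar R) :
  measurable_fun [set: T] f -> measurable_fun [set: T] g ->
  measurable_fun [set: T] (fun x => f x * g x)%E.
Proof. exact: emeasurable_funM. Qed.

Lemma measurable_add_comp f g :
  measurable_fun [set: T] f -> measurable_fun [set: T] g ->
  measurable_fun [set: T] (fun x => f x + g x).
Proof. exact: measurable_funD. Qed.

Lemma measurable_opp_comp f :
  measurable_fun [set: T] f -> measurable_fun [set: T] (fun x => - f x).
Proof. exact: measurable_funN. Qed.

Lemma measurable_mul_comp f g :
  measurable_fun [set: T] f -> measurable_fun [set: T] g ->
  measurable_fun [set: T] (fun x => f x * g x).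
Proof. exact: measurable_funM. Qed.

Lemma measurable_exp_comp f n :
  measurable_fun [set: T] f -> measurable_fun [set: T] (fun x => f x ^+ n).
Proof. exact: measurable_funX. Qed.

End MeasurableTools.

Section MeasurableEta.
Context {R : realType}.

(** Peeling off an operation may leave an eta-contracted goal such as [measurable_fun _ GRing.inv],
    which the composition rules do not match; these lemmas are the closing cases of [mfun]. *)
Lemma measurable_inv_eta : measurable_fun [set: R] (@GRing.inv R).
Proof. exact: (@measurable_inv_comp R _ R id). Qed.

Lemma measurable_lt_eta (a : R) : measurable_fun [set: R] (fun x => a < x).
Proof. exact: measurable_fun_ltr. Qed.

Lemma measurable_le_eta (a : R) : measurable_fun [set: R] (fun x => a <= x).
Proof. exact: measurable_fun_ler. Qed.

Lemma measurable_add_eta (a : R) : measurable_fun [set: R] (fun x => a + x).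
Proof. exact: measurable_add_comp. Qed.

Lemma measurable_norm_eta : measurable_fun [set: R] (fun x : R => `|x|).
Proof. exact: measurable_norm_comp. Qed.

Lemma measurable_sqrt_eta : measurable_fun [set: R] (fun x : R => Num.sqrt x).
Proof. exact: measurable_sqrt_comp. Qed.

End MeasurableEta.

Ltac mfun := repeat first
  [ assumption
  | lazymatch goal with
    | |- measurable_fun _ (@GRing.inv _) => exact: measurable_inv_eta
    | |- measurable_fun _ (@GRing.mul _ _) => exact: mulrl_measurable
    | |- measurable_fun _ (@GRing.add _ _) => exact: measurable_add_eta
    | |- measurable_fun _ (@Order.lt _ _ _) => exact: measurable_lt_eta
    | |- measurable_fun _ (@Order.le _ _ _) => exact: measurable_le_eta
    | |- measurable_fun _ (@Num.norm _ _) => exact: measurable_norm_eta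
    | |- measurable_fun _ (@Num.sqrt _) => exact: measurable_sqrt_eta
    | |- measurable_fun _ (@sqn _ _) => exact: measurable_sqn
    | |- measurable_fun _ fst => exact: measurable_fst
    | |- measurable_fun _ snd => exact: measurable_snd
    | |- measurable_fun _ (fun x => x) => exact: measurable_id
    | |- measurable_fun _ (fun _ => ?c) => exact: measurable_cst
    | |- measurable_fun _ (fun _ => if _ then _ else _) => apply: measurable_fun_ifT
    | |- measurable_fun _ (fun _ => _ && _) => apply: measurable_and
    | |- measurable_fun _ (fun _ => ~~ _) => apply: measurable_neg
    | |- measurable_fun _ (fun _ => (_ < _)%R) => apply: measurable_fun_ltr
    | |- measurable_fun _ (fun _ => (_ <= _)%R) => apply: measurable_fun_ler
    | |- measurable_fun _ (fun _ => (_ == _)%R) => apply: measurable_fun_eqr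
    | |- measurable_fun _ (fun _ => (_)%:E) => apply: measurable_EFin_comp
    | |- measurable_fun _ (fun _ => (_ * _)%E) => apply: measurable_mule_comp
    | |- measurable_fun _ (fun _ => (_ + _)%R) => apply: measurable_add_comp
    | |- measurable_fun _ (fun _ => (- _)%R) => apply: measurable_opp_comp
    | |- measurable_fun _ (fun _ => (_ * _)%R) => apply: measurable_mul_comp
    | |- measurable_fun _ (fun _ => (_ ^+ _)%R) => apply: measurable_exp_comp
    | |- measurable_fun _ (fun _ => (_ ^-1)%R) => apply: measurable_inv_comp
    | |- measurable_fun _ (fun _ => `|_|%R) => apply: measurable_norm_comp
    | |- measurable_fun _ (fun _ => (_ `^ _)%R) => apply: measurable_powR_comp
    | |- measurable_fun _ (fun _ => Num.sqrt _) => apply: measurable_sqrt_comp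
    | |- measurable_fun _ (fun _ => fst _) => apply: measurable_fst_comp
    | |- measurable_fun _ (fun _ => snd _) => apply: measurable_snd_comp
    | |- measurable_fun _ (fun _ => sqn _) => apply: (measurableT_comp (@measurable_sqn _ _))
    | |- measurable_fun _ (fun _ => tnth _ _) => apply: (measurableT_comp (measurable_tnth _))
    | |- measurable_fun _ (fun _ => ?H _) => apply: (measurableT_comp (f := H))
    | |- measurable_fun _ (fun _ => ?H _ _) => apply: (@measurable_comp2 _ _ _ _ _ _ _ _ H)
    end ].

(** * Dilations, boxes, and the substitution that turns a linear form into a coordinate *)

Section Tools.
Context {R : realType}.
Local Notation mu := (@lebesgue_measure R).
Local Open Scope ereal_scope.

Lemma eq_integral_off (a : R) (f g : R -> \bar R) :
  measurable_fun [set: R] f -> measurable_fun [set: R] g ->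
  (forall t, t != a -> f t = g t) -> \int[mu]_t f t = \int[mu]_t g t.
Proof.
move=> mf mg fg.
have mD : measurable ([set: R] `\ a) by exact: measurableD.
rewrite -(@integral_setD1 _ f a setT)//; last exact: measurable_funS mf.
rewrite -(@integral_setD1 _ g a setT)//; last exact: measurable_funS mg.
by apply: eq_integral => t; rewrite inE/= => -[_ /eqP]; exact: fg.
Qed.

Lemma integral_supp1 (a : R) (f : R -> \bar R) :
  (forall t, t != a -> f t = 0) -> \int[mu]_t f t = 0.
Proof.
move=> f0.
have -> : \int[mu]_t f t = \int[mu]_(t in [set a]) f t.
  rewrite [RHS]integral_mkcond; apply: eq_integral => t _; rewrite patchE.
  by case: ifPn => //; rewrite notin_setE => /eqP; exact: f0.
exact: integral_set1.
Qed.

(** In [rint_radial] the constant pulled out is itself an integral, possibly infinite. *)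
Lemma rintZle m (c : \bar R) (f : m.-tuple R -> \bar R) : 0 <= c ->
  measurable_fun [set: m.-tuple R] f -> (forall x, 0 <= f x) ->
  rint (fun x => c * f x) = c * rint f.
Proof.
move=> c0; elim: m f => [//|m IH] f mf f0.
rewrite !rintS -ge0_integralZl//.
- by apply: eq_integral => t _; apply: IH => //; exact: measurable_cons_section.
- exact: measurable_rint_cons.
- by move=> t _; exact: rint_ge0.
Qed.

Lemma tscale_cons m (a t : R) (x : m.-tuple R) :
  tscale a [tuple of t :: x] = [tuple of (a * t)%R :: tscale a x].
Proof.
apply: eq_from_tnth => i; rewrite tnth_mktuple.
by case: (unliftP ord0 i) => [j|] ->; rewrite ?tnth_consS ?tnth_cons0 ?tnth_mktuple.
Qed.

Lemma sqn_tscale m (a : R) (x : m.-tuple R) : (sqn (tscale a x) = a ^+ 2 * sqn x)%R.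
Proof. by rewrite /sqn mulr_sumr; apply: eq_bigr => i _; rewrite tnth_mktuple exprMn. Qed.

Lemma measurable_tscale m (a : R) : measurable_fun [set: m.-tuple R] (@tscale R m a).
Proof.
apply/measurable_fun_tnthP => i.
rewrite (_ : _ \o _ = (fun x : m.-tuple R => (a * tnth x i)%R)); last first.
  by apply/funext => x /=; rewrite tnth_mktuple.
by apply: measurable_mul_comp => //; exact: measurable_tnth.
Qed.

Lemma rint_scale m (a : R) (f : m.-tuple R -> \bar R) : (0 < a)%R ->
  measurable_fun [set: m.-tuple R] f -> (forall x, 0 <= f x) ->
  rint f = (a ^+ m)%:E * rint (fun x => f (tscale a x)).
Proof.
move=> a0; elim: m f => [|m IH] f mf f0.
  rewrite expr0 mul1e /rint/=; by congr f; apply: eq_from_tnth => -[].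
have mg t : measurable_fun [set: m.-tuple R] (fun x => f [tuple of t :: tscale a x]).
  apply: (@measurableT_comp _ _ _ _ _ _ f) => //; apply: measurable_cons_tuple => //.
  exact: measurable_tscale.
have mh : measurable_fun [set: R] (fun t => rint (fun x => f [tuple of t :: tscale a x])).
  apply: (@measurable_rint _ _ _ _ (fun t x => f [tuple of t :: tscale a x])).
  apply: (@measurableT_comp _ _ _ _ _ _ f) => //; apply: measurable_cons_tuple => //.
  by apply: (@measurableT_comp _ _ _ _ _ _ (@tscale R m a)) => //; exact: measurable_tscale.
rewrite rintS.
transitivity (\int[mu]_t ((a ^+ m)%:E * rint (fun x => f [tuple of t :: tscale a x]))).
  apply: eq_integral => t _; apply: IH => //; exact: measurable_cons_section.
rewrite ge0_integralZl//; last 2 first.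
- by move=> t _; exact: rint_ge0.
- by rewrite lee_fin exprn_ge0// ltW.
rewrite (@integral_affine _ a 0%R) ?gt_eqF//; last by move=> t; exact: rint_ge0.
rewrite muleA gtr0_norm// -EFinM -exprSr; congr (_ * _).
rewrite rintS; apply: eq_integral => t _; apply: eq_rint => x.
by rewrite tscale_cons addr0.
Qed.

(** Abstract in the base integral because it is used at two levels: for the coordinates of a vector,
    with [r = 2 * e], and for the columns of a matrix, where [r] is the volume of a cube. *)
Lemma tint_box (T : Type) (I : (T -> \bar R) -> \bar R) (B : T -> T -> bool) (r : R) m
    (c : m.-tuple T) (a : R) : (0 <= r)%R -> (0 <= a)%R ->
  (forall (c : T) (a : R), (0 <= a)%R -> I (fun t => (if B c t then a else 0%R)%:E) = (r * a)%:E) ->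
  tint I (fun x => (if [forall i, B (tnth c i) (tnth x i)] then a else 0%R)%:E) = (r ^+ m * a)%:E.
Proof.
move=> r0 a0 HI; elim: m c => [|m IH] c.
  by rewrite /= expr0 mul1r; case: ifPn => // /forallPn[[]].
case/tupleP: c => t c /=.
transitivity (I (fun s => (if B t s then (r ^+ m * a)%R else 0%R)%:E)).
  congr I; apply/funext => s.
  have E (x : m.-tuple T) : [forall i, B (tnth [tuple of t :: c] i) (tnth [tuple of s :: x] i)] =
      B t s && [forall i, B (tnth c i) (tnth x i)].
    apply/forallP/andP => [h|[h1 /forallP h2] i].
      split; first by have := h ord0; rewrite !tnth0.
      by apply/forallP => i; have := h (lift ord0 i); rewrite !tnthS.
    by case: (unliftP ord0 i) => [j|] ->; rewrite ?tnthS ?tnth0.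
  case: (boolP (B t s)) => Bts.
    rewrite -(IH c); congr tint; apply/funext => x.
    by rewrite E Bts.
  transitivity (tint I (fun x : m.-tuple T => 0%:E)).
    by congr tint; apply/funext => x; rewrite E (negbTE Bts).
  elim: m {IH c E} => [//|k IHk] /=; rewrite IHk.
  (* For the abstract [I], that the zero function integrates to 0 is the case [a = 0] of [HI]. *)
  have := HI t 0%R (lexx _); rewrite mulr0 => h; rewrite -[RHS]h.
  by congr I; apply/funext => ?; case: ifP.
by rewrite HI ?mulr_ge0 ?exprn_ge0// mulrA -exprS.
Qed.

Lemma leb_int_ball (e c a : R) : (0 < e)%R -> (0 <= a)%R ->
  leb_int (fun t : R => (if `|t - c| <= e then a else 0)%R%:E) = (2 * e * a)%:E.
Proof.
move=> e0 a0; rewrite /leb_int.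
transitivity (\int[mu]_t (a%:E * (\1_(`[(c - e)%R, (c + e)%R]) t)%:E)).
  apply: eq_integral => t _; rewrite indicE -EFinM; congr EFin.
  have -> : (t \in [set` `[(c - e)%R, (c + e)%R]]) = (`|t - c| <= e)%R.
    by rewrite ler_distl; apply/idP/idP; rewrite inE/= in_itv.
  by case: ifP; rewrite ?mulr1 ?mulr0.
rewrite ge0_integralZl//; last by apply/measurable_EFinP; exact: measurable_indic.
have -> : \int[mu]_t (\1_(`[(c - e)%R, (c + e)%R]) t)%:E = mu `[(c - e)%R, (c + e)%R]%classic.
  by rewrite integral_indic// setIT.
rewrite lebesgue_measure_itv/= lte_fin ifT; last by lra.
by rewrite -EFinD -EFinM; congr EFin; ring.
Qed.

Lemma rint_ball m (e : R) (c : m.-tuple R) (a : R) : (0 < e)%R -> (0 <= a)%R ->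
  rint (fun x => (if [forall i, `|tnth x i - tnth c i| <= e]%R then a else 0%R)%:E) =
  ((2 * e) ^+ m * a)%:E.
Proof.
move=> e0 a0.
apply: (@tint_box _ _ (fun c t => `|t - c| <= e)%R) => //.
  by rewrite mulr_ge0// ltW.
by move=> *; exact: leb_int_ball.
Qed.

(** The vector [v] that agrees with [u] off the last coordinate and solves
    [lform l v + e = lastc u]. The offset [e] collects the coordinates peeled off during an
    induction. *)
Definition lastsub m (l : 'I_m.+1 -> R) (e : R) (u : m.+1.-tuple R) : m.+1.-tuple R :=
  [tuple (if i == ord_max then
    (tnth u i - \sum_(j < m.+1 | j != ord_max) l j * tnth u j - e) / l ord_max
    else tnth u i)%R | i < m.+1].

Lemma lastsub_cons m (l : 'I_m.+2 -> R) e t (x : m.+1.-tuple R) :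
  lastsub l e [tuple of t :: x] =
  [tuple of t :: lastsub (fun i => l (lift ord0 i)) (e + l ord0 * t)%R x].
Proof.
apply: eq_from_tnth => i; rewrite tnth_mktuple.
case: (unliftP ord0 i) => [j|] ->; last by rewrite !tnth_cons0.
rewrite !tnth_consS tnth_mktuple ord_maxS (inj_eq (@lift_inj _ ord0)).
case: ifP => // _; congr (_ / _)%R.
rewrite big_mkcond big_ord_recl/= tnth_cons0.
rewrite [X in (_ - (_ + X) - _)%R](_ : _ = \sum_(j < m.+1 | j != ord_max) l (lift ord0 j) * tnth x j)%R.
  ring.
rewrite [RHS]big_mkcond; apply: eq_bigr => k _.
by rewrite (inj_eq (@lift_inj _ ord0)) tnth_consS.
Qed.

(** With the other coordinates fixed, the last one undergoes an affine map of slope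
    [(l ord_max)^-1], so the one-variable substitution applies in the innermost integral. *)
Lemma rint_lastsub m (l : 'I_m.+1 -> R) (e : R) (g : m.+1.-tuple R -> \bar R) :
  l ord_max != 0%R -> measurable_fun [set: m.+1.-tuple R] g -> (forall u, 0 <= g u) ->
  rint (fun u => g (lastsub l e u)) = `|l ord_max|%:E * rint g.
Proof.
elim: m l e g => [|m IH] l e g l0 mg g0.
  rewrite !rintS.
  rewrite [in RHS](@integral_affine _ (l ord_max)^-1 (- e / l ord_max)%R) ?invr_eq0//; last 2 first.
    exact: measurable_rint_cons.
    by move=> t; exact: rint_ge0.
  rewrite muleA -EFinM -normrM divff// normr1 mul1e; apply: eq_integral => t _.
  rewrite /rint/=; congr g; apply: eq_from_tnth => i; rewrite tnth_mktuple (ord1 i).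
  have -> : (0%R == ord_max :> 'I_1) = true by apply/eqP/val_inj.
  rewrite (tnth0 _ [tuple]) [RHS]tnth0 big_pred0; last by move=> j; rewrite (ord1 j); apply/negbTE/negPn/eqP/val_inj.
  by rewrite subr0 mulrBl mulrC mulNr.
have l0' : l (lift ord0 ord_max) != 0%R by rewrite -ord_maxS.
rewrite !rintS -ge0_integralZl//; last 2 first.
  exact: measurable_rint_cons.
  by move=> t _; exact: rint_ge0.
apply: eq_integral => t _.
rewrite [in RHS]ord_maxS -(IH (fun i => l (lift ord0 i)) (e + l ord0 * t)%R)//.
  by apply: eq_rint => x; rewrite lastsub_cons.
exact: measurable_cons_section.
Qed.

End Tools.

Ltac nneg := intros; repeat (first [ exact: lexx | exact: powR_ge0 | assumption | exact: normr_ge0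
  | (apply: ltW; assumption) | (case: ifPn => _) | rewrite lee_fin | apply: mule_ge0
  | apply: mulr_ge0 | exact: ler01 | done ]).
Ltac sides := try solve [mfun | nneg].

(** * Polar coordinates for functions of the squared norm *)

Section Polar.
Context {R : realType}.
Local Notation mu := (@lebesgue_measure R).
Local Open Scope ereal_scope.

Definition annul (r : R) : bool := (1 <= r <= 2)%R.

(** Invariance of [ds / s] under the dilation [s -> r s]. *)
Lemma annul_int (r : R) : (0 < r)%R ->
  \int[mu]_s (if (0 < s) && annul (r / s) then s^-1 else 0)%R%:E =
  \int[mu]_s (if (0 < s) && annul (s^-1) then s^-1 else 0)%R%:E.
Proof.
move=> r0.
rewrite (@integral_affine _ r 0%R) ?gt_eqF//; last 2 first.
- rewrite /annul; mfun.
- by move=> s; rewrite lee_fin; case: ifP => // /andP[s0 _]; rewrite invr_ge0 ltW.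
rewrite gtr0_norm// -ge0_integralZl//; last 3 first.
- rewrite /annul; mfun.
- by move=> s _; rewrite lee_fin; case: ifP => // /andP[s0 _]; rewrite invr_ge0 ltW.
- by rewrite lee_fin ltW.
apply: eq_integral => s _; rewrite addr0 -EFinM pmulr_rgt0//; congr EFin.
have [s0|s0] := ltP 0%R s; last by rewrite /= mulr0.
rewrite invfM mulrA divff ?gt_eqF// mul1r /=; case: ifP => _; last by rewrite mulr0.
by rewrite mulrA divff ?gt_eqF// mul1r.
Qed.

Lemma annul_int_bounds : exists2 C : R, (0 < C)%R &
  \int[mu]_s (if (0 < s) && annul (s^-1) then s^-1 else 0)%R%:E = C%:E.
Proof.
(* The condition [1 <= s^-1 <= 2] describes [[1/2, 1]], the ball of radius 1/4 about 3/4, on which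
   [s^-1] lies between 1 and 2. *)
have E (s : R) : (0 < s)%R && annul s^-1 = (`|s - 3 / 4| <= 1 / 4)%R.
  rewrite ler_distl /annul; apply/idP/idP => [/and3P[s0]|/andP[h1 h2]].
    rewrite -[X in (X <= _)%R]invr1 lef_pV2 ?posrE// => h1.
    rewrite -[X in (_ <= X)%R]invrK lef_pV2 ?posrE ?invr_gt0// => h2.
    by apply/andP; split; lra.
  have s0 : (0 < s)%R by lra.
  rewrite s0 /=; apply/andP; split.
    rewrite -[X in (X <= _)%R]invr1 lef_pV2 ?posrE//; lra.
  rewrite -[X in (_ <= X)%R]invrK lef_pV2 ?posrE ?invr_gt0//; lra.
under eq_integral do rewrite E.
set J := integral _ _ _.
have J1 : J <= (2 * (1 / 4) * 2)%:E.
  rewrite -(@leb_int_ball _ (1/4) (3/4) 2)//; apply: le_integral_ge0 => s.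
    rewrite lee_fin; case: ifP => //; rewrite ler_distl => /andP[h1 h2].
    by rewrite invr_ge0; lra.
  rewrite lee_fin; case: ifP => //; rewrite ler_distl => /andP[h1 h2].
  have s0 : (0 < s)%R by lra.
  by rewrite -[X in (_ <= X)%R]invrK lef_pV2 ?posrE ?invr_gt0//; lra.
have J0 : (2 * (1 / 4) * 1)%:E <= J.
  rewrite -(@leb_int_ball _ (1/4) (3/4) 1)//; apply: le_integral_ge0 => s.
    by rewrite lee_fin; case: ifP.
  rewrite lee_fin; case: ifP => //; rewrite ler_distl => /andP[h1 h2].
  have s0 : (0 < s)%R by lra.
  by rewrite -[X in (X <= _)%R]invr1 lef_pV2 ?posrE//; lra.
have Jf : J \is a fin_num by rewrite ge0_fin_numE ?(le_lt_trans J1) ?ltry// (le_trans _ J0)// lee_fin; lra.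
exists (fine J); last by rewrite fineK.
by rewrite -lte_fin fineK// (lt_le_trans _ J0)// lte_fin; lra.
Qed.

Lemma sqr_le_sqn m (x : m.-tuple R) i : (tnth x i ^+ 2 <= sqn x)%R.
Proof.
rewrite /sqn (bigD1 i)//= lerDl; apply: sumr_ge0 => j _; exact: sqr_ge0.
Qed.

(** The origin is negligible: already a nonzero first coordinate, which holds for almost every [t],
    makes [sqn] positive. *)
Lemma rint_sqn_pos m (H : R -> \bar R) : (0 < m)%N ->
  measurable_fun [set: R] H ->
  rint (fun x : m.-tuple R => H (sqn x)) =
  rint (fun x : m.-tuple R => if (0 < sqn x)%R then H (sqn x) else 0).
Proof.
case: m => // m _ mH; rewrite !rintS.
apply: (@eq_integral_off _ 0%R).
- apply: (@measurable_rint_cons _ _ (fun x => H (sqn x))); mfun.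
- apply: (@measurable_rint_cons _ _ (fun x => if (0 < sqn x)%R then H (sqn x) else 0)); mfun.
move=> t t0; apply: eq_rint => x; rewrite ifT//.
by rewrite sqn_cons ltr_pwDl ?sqn_ge0// exprn_even_gt0.
Qed.

(* Insert [1 = C^-1 * int annul (|x|^2 / s) ds / s] and rescale [x] by [sqrt s]. *)
Lemma rint_radial m : (0 < m)%N -> exists2 A : R, (0 < A)%R &
  forall H : R -> \bar R, measurable_fun [set: R] H -> (forall s, 0 <= H s) ->
  rint (fun x : m.-tuple R => H (sqn x)) =
  A%:E * \int[mu]_s (if (0 < s)%R then (s `^ (m%:R / 2 - 1))%:E * H s else 0).
Proof.
move=> m0; have [C C0 HC] := annul_int_bounds.
(* What remains of the [x]-integral after the rescaling. It lives on the shell [1 <= sqn x <= 2], so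
   its integral [K] is finite; the constant of the lemma is [K / C]. *)
pose kf (x : m.-tuple R) : \bar R := (if annul (sqn x) then sqn x `^ (- (m%:R / 2)) else 0)%R%:E.
have mkf : measurable_fun [set: m.-tuple R] kf by rewrite /kf /annul; mfun.
have kf0 x : 0 <= kf x by rewrite lee_fin; case: ifP => // _; exact: powR_ge0.
pose K := rint kf.
have key (H : R -> \bar R) : measurable_fun [set: R] H -> (forall s, 0 <= H s) ->
  C%:E * rint (fun x : m.-tuple R => H (sqn x)) =
  K * \int[mu]_s (if (0 < s)%R then (s `^ (m%:R / 2 - 1))%:E * H s else 0).
  move=> mH H0; set J := integral _ _ _.
  have J0 : 0 <= J.
    by apply: integral_ge0 => s _; case: ifP => // _; rewrite mule_ge0// lee_fin powR_ge0.
  rewrite rint_sqn_pos// -rintZle//; last 3 first.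
  - by rewrite lee_fin ltW.
  - mfun.
  - by move=> x; case: ifP.
  transitivity (rint (fun x : m.-tuple R => \int[mu]_s
      ((if ((0 < s) && annul (sqn x / s)) && (0 < sqn x) then s^-1 else 0)%R%:E * H (sqn x)))).
    apply: eq_rint => x; case: ifPn => x0; last first.
      rewrite mule0; apply/esym/integral0_eq => s _; rewrite andbF mul0e//.
    rewrite -HC -(annul_int x0) -ge0_integralZr//.
    - by apply: eq_integral => s _; rewrite andbT.
    - rewrite /annul; mfun.
    - by move=> s _; rewrite lee_fin; case: ifP => // /andP[s0 _]; rewrite invr_ge0 ltW.
  rewrite -(@rint_swap _ _ (fun s x => (if ((0 < s) && annul (sqn x / s)) && (0 < sqn x) then s^-1 else 0)%R%:E * H (sqn x))); last 2 first.
  - rewrite /annul; mfun.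
  - move=> s x; apply: mule_ge0 => //; rewrite lee_fin; case: ifP => // /andP[/andP[s0 _] _].
    by rewrite invr_ge0 ltW.
  transitivity (\int[mu]_s rint (fun x : m.-tuple R =>
     (if (0 < s)%R && annul (sqn x) then (s `^ (m%:R / 2 - 1))%:E * H (s * sqn x)%R else 0))).
    apply: eq_integral => s _; have [s0|s0] := ltP 0%R s; last first.
      by apply: eq_rint => x /=; rewrite mul0e.
    (* Scaling by [sqrt s] frees the shell condition from [s]; the factor [s^(m/2)] it produces
       combines with [s^-1]. *)
    rewrite /= (@rint_scale _ m (Num.sqrt s)) ?sqrtr_gt0//; last 2 first.
    - rewrite /annul; mfun.
    - move=> x; apply: mule_ge0 => //; rewrite lee_fin; case: ifP => // _.
      by rewrite invr_ge0 ltW.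
    rewrite -rintZle; last 3 first.
    - by rewrite lee_fin exprn_ge0.
    - rewrite /annul.
      apply: (@measurableT_comp _ _ _ _ _ _ (fun y : m.-tuple R => (if (1 <= sqn y / s <= 2) && (0 < sqn y) then s^-1 else 0)%R%:E * H (sqn y))); last exact: measurable_tscale.
      mfun.
    - move=> x; apply: mule_ge0 => //; rewrite lee_fin; case: ifP => // _.
      by rewrite invr_ge0 ltW.
    apply: eq_rint => x; rewrite sqn_tscale sqr_sqrtr ?(ltW s0)//.
    rewrite [(s * sqn x / s)%R]mulrC mulrA mulVf ?gt_eqF// mul1r.
    case: (boolP (annul (sqn x))) => ax /=; last by rewrite mul0e mule0.
    have x0 : (0 < sqn x)%R by move: ax => /andP[h _]; lra.
    rewrite pmulr_rgt0// x0 muleA -EFinM; congr (_%:E * _).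
    rewrite -powR12_sqrt ?(ltW s0)// -powR_mulrn ?powR_ge0// -powRrM.
    rewrite -[(s^-1)%R]powR_inv1 ?(ltW s0)// -powRD_gt0//.
    by rewrite [(2^-1 * _)%R]mulrC.
  rewrite (@rint_swap _ _ (fun s x => if (0 < s)%R && annul (sqn x) then (s `^ (m%:R / 2 - 1))%:E * H (s * sqn x)%R else 0)); last 2 first.
  - rewrite /annul; mfun.
  - by move=> s x; case: ifP => // _; rewrite mule_ge0// lee_fin powR_ge0.
  rewrite muleC /K -rintZle//.
  apply: eq_rint => x; rewrite /kf.
  case: (boolP (annul (sqn x))) => ax; last first.
    by rewrite mule0; apply: integral0_eq => s _; rewrite andbF.
  have x0 : (0 < sqn x)%R by move: ax => /andP[h _]; lra.
  under eq_integral do rewrite andbT.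
  (* Rescaling [s] by [sqn x] shows that the inner integral depends on [x] only through the power
     recorded in [kf]. *)
  rewrite /J [in RHS](@integral_affine _ (sqn x) 0%R) ?gt_eqF//; last 2 first.
  - mfun.
  - by move=> s; case: ifP => // _; rewrite mule_ge0// lee_fin powR_ge0.
  rewrite gtr0_norm// muleC muleA -EFinM.
  rewrite -ge0_integralZl//; last 3 first.
  - mfun.
  - by move=> s _; case: ifP => // _; rewrite mule_ge0// lee_fin powR_ge0.
  - by rewrite lee_fin mulr_ge0 ?powR_ge0// ltW.
  apply: eq_integral => s _; rewrite addr0 pmulr_rgt0//.
  case: ifP => s0; last by rewrite mule0.
  rewrite [(sqn x * s)%R]mulrC muleA -EFinM; congr (_%:E * _).
  have E : (sqn x `^ (- (m%:R / 2)) * sqn x * sqn x `^ (m%:R / 2 - 1) = 1)%R.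
    rewrite -[X in (_ * X * _)%R]powRr1 ?(ltW x0)// -!powRD_gt0//.
    by rewrite (_ : _ + _ = 0)%R ?powRr0//; ring.
  by rewrite powRM ?(ltW s0) ?(ltW x0)// mulrCA E mulr1.
(* On the shell the power in [kf] is at most 1, and the shell lies in the cube [[-2, 2]^m]. *)
have Kf : K <= ((2 * 2) ^+ m * 1)%:E.
  rewrite -(@rint_ball _ m 2 [tuple 0%R | i < m])//; apply: le_rint => // x.
  rewrite lee_fin; case: ifP => ax; last by case: ifP.
  have /andP[x1 x2] := ax.
  rewrite ifT.
    by rewrite -[X in (_ <= X)%R](powRr0 (sqn x)) ler_powR// oppr_le0 mulr_ge0.
  apply/forallP => i; rewrite tnth_mktuple subr0.
  rewrite -(@ler_pXn2r _ 2)// ?nnegrE// -normrX ger0_norm ?sqr_ge0//.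
  by rewrite (le_trans (sqr_le_sqn x i))//; lra.
have K0 : 0 <= K by exact: rint_ge0.
have Kfin : K \is a fin_num by rewrite ge0_fin_numE// (le_lt_trans Kf)// ltry.
have Kpos : 0 < K.
  rewrite lt0e K0 andbT; apply/eqP => Kz.
  (* If [K] were 0, the identity for the constant function 1 would make the whole space null,
     against the volume of a cube. *)
  have := key (cst 1) (measurable_cst _) (fun=> lee01).
  rewrite Kz mul0e => /eqP; rewrite mule_eq0 eqe gt_eqF//= => /eqP h.
  have := @rint_ball _ m 1 [tuple 0%R | i < m] 1 ltr01 ler01.
  move=> h2.
  have : ((2 * 1) ^+ m * 1)%:E <= (0 : \bar R).
    rewrite -h2 -h; apply: le_rint => x; first by rewrite lee_fin; case: ifP.
    by rewrite lee_fin; case: ifP.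
  by rewrite lee_fin leNgt mulr1 mulr1 exprn_gt0.
exists (fine K / C)%R; first by rewrite divr_gt0// fine_gt0// Kpos ltey_eq Kfin.
move=> H mH H0.
have := key H mH H0; rewrite -{1}(fineK Kfin) => h.
have : (C^-1)%:E * (C%:E * rint (fun x : m.-tuple R => H (sqn x))) = rint (fun x : m.-tuple R => H (sqn x)).
  by rewrite muleA -EFinM mulVf ?gt_eqF// mul1e.
by move=> <-; rewrite h muleA -EFinM mulrC.
Qed.

End Polar.

(** * From the cone formula to a one-dimensional integral *)

Section Core.
Context {R : realType}.
Local Notation mu := (@lebesgue_measure R).
Local Open Scope ereal_scope.

(** Integrand of the cone formula at a point with squared norm [s] and last coordinate [w]; the
    argument of [psi] is the absolute last coordinate of the normalized point. *)
Definition coneF (psi : R -> \bar R) (s w : R) : \bar R :=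
  if (0 < s <= 1)%R then psi (`|w| / Num.sqrt s)%R else 0.

Lemma measurable_coneF psi : measurable_fun [set: R] psi ->
  measurable_fun [set: R * R] (fun z => coneF psi z.1 z.2).
Proof. by move=> mpsi; rewrite /coneF; mfun. Qed.

Lemma coneF_ge0 psi s w : (forall t, 0 <= psi t) -> 0 <= coneF psi s w.
Proof. by move=> h; rewrite /coneF; case: ifP. Qed.

(** Apart from the cut-off, [coneF] is homogeneous of degree 0. After [s = w^2 Y] the variable [w]
    survives only in the cut-off and can be integrated out. *)
Lemma coneF_homog psi (w Y : R) : w != 0%R -> (0 < Y)%R ->
  coneF psi (w ^+ 2 * Y) w = if (w ^+ 2 * Y <= 1)%R then psi (Num.sqrt Y)^-1%R else 0.
Proof.
move=> w0 Y0; have w2 : (0 < w ^+ 2)%R by rewrite exprn_even_gt0.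
rewrite /coneF pmulr_rgt0// Y0 /=; case: ifP => // _; congr psi.
by rewrite sqrtrM ?(ltW w2)// sqrtr_sqr invfM mulrA divff ?normr_eq0// mul1r.
Qed.

(** [E] is the value at [Y = 1], and scaling [w] by [Y^(-1/2)] produces the power of [Y]. The ball
    of radius 1/4 about 3/4 shows that [E] is positive. *)
Lemma radius_int (h : R) : (0 <= h)%R -> exists2 E : R, (0 < E)%R & forall Y, (0 < Y)%R ->
  \int[mu]_w (if w ^+ 2 * Y <= 1 then (w ^+ 2) `^ h else 0)%R%:E = (E * Y `^ (- (h + 2^-1)))%:E.
Proof.
move=> h0.
pose J := \int[mu]_w (if w ^+ 2 <= 1 then (w ^+ 2) `^ h else 0)%R%:E.
have J1 : J <= (2 * 1 * 1)%:E.
  rewrite -(@leb_int_ball _ 1 0 1)//; apply: le_integral_ge0 => s.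
    by rewrite lee_fin; case: ifP => // _; exact: powR_ge0.
  rewrite lee_fin subr0 -[(s ^+ 2)%R]real_normK ?num_real// expr_le1//.
  case: ifP => // s1.
  have h1 : (1 `^ h = 1 :> R)%R by rewrite powR1.
  rewrite -[X in (_ <= X)%R]h1.
  by rewrite ge0_ler_powR// ?nnegrE ?exprn_ge0// exprn_ile1.
have J0 : (2 * (1 / 4) * (1 / 4) `^ h)%:E <= J.
  have q0 : (0 < 1 / 4 :> R)%R by lra.
  rewrite -(@leb_int_ball _ (1/4) (3/4) ((1/4) `^ h) q0 (powR_ge0 _ _)).
  apply: le_integral_ge0 => s.
    by rewrite lee_fin; case: ifP => // _; exact: powR_ge0.
  rewrite lee_fin; case: ifP => [|_]; last by case: ifP => // _; exact: powR_ge0.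
  rewrite ler_distl => /andP[h1 h2].
  rewrite ifT; last by nra.
  by rewrite ge0_ler_powR// ?nnegrE; nra.
have Jpos : 0 < J.
  by rewrite (lt_le_trans _ J0)// lte_fin mulr_gt0 ?powR_gt0//; lra.
have Jf : J \is a fin_num by rewrite ge0_fin_numE ?(le_lt_trans J1) ?ltry// ltW.
exists (fine J); first by rewrite fine_gt0// Jpos ltey_eq Jf.
move=> Y Y0.
have sY : (0 < (Num.sqrt Y)^-1)%R by rewrite invr_gt0 sqrtr_gt0.
rewrite (@integral_affine _ (Num.sqrt Y)^-1 0%R) ?gt_eqF//; last 2 first.
- by mfun.
- by move=> s; rewrite lee_fin; case: ifP => // _; exact: powR_ge0.
rewrite EFinM fineK// gtr0_norm// -ge0_integralZl//; last 2 first.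
- by mfun.
- by move=> s _; rewrite lee_fin; case: ifP => // _; exact: powR_ge0.
rewrite /J -ge0_integralZr//; sides.
apply: eq_integral => s _; rewrite addr0 exprMn exprVn sqr_sqrtr ?(ltW Y0)//.
have -> : (Y^-1 * s ^+ 2 * Y = s ^+ 2)%R by field; rewrite gt_eqF.
rewrite -!EFinM; congr EFin; case: ifP => _; last by rewrite mul0r mulr0.
rewrite powRM ?sqr_ge0 ?invr_ge0 ?(ltW Y0)// mulrA mulrC; congr (_ * _)%R.
rewrite -powR12_sqrt ?(ltW Y0)// -powRN -[Y^-1%R]powR_inv1 ?(ltW Y0)// -powRrM -powRD_gt0//.
by congr powR; ring.
Qed.

(** Polar coordinates in [x], then [s = w^2 s'], then integration over [w], and finally
    [y = s' + kap]. The power of [y] comes from the [w]-integral, that of [y - kap] from the polar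
    density. *)
Lemma cone_reduce m : (0 < m)%N -> exists2 A : R, (0 < A)%R &
  forall (kap : R) psi, (0 < kap)%R -> measurable_fun [set: R] psi -> (forall t, 0 <= psi t) ->
  rint (fun x : m.-tuple R => \int[mu]_w coneF psi (sqn x + kap * w ^+ 2)%R w) =
  A%:E * \int[mu]_y (if (kap < y)%R then
     (y `^ (- (m%:R / 2 + 2^-1)) * (y - kap) `^ (m%:R / 2 - 1))%:E * psi (Num.sqrt y)^-1%R else 0).
Proof.
move=> m0; have [A1 A10 HA1] := @rint_radial R m m0.
set h : R := (m%:R / 2)%R.
have h0 : (0 <= h)%R by rewrite mulr_ge0.
have [E E0 HE] := radius_int h0.
exists (A1 * E)%R; first exact: mulr_gt0.
move=> kap psi k0 mpsi psi0.
have mcone := measurable_coneF mpsi.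
rewrite (HA1 (fun s => \int[mu]_w coneF psi (s + kap * w ^+ 2)%R w)); last 2 first.
- apply: (@measurable_integral _ _ R (fun s w => coneF psi (s + kap * w ^+ 2)%R w)).
  by apply: (@measurable_comp2 _ _ _ _ _ _ _ _ (coneF psi)) => //; mfun.
- by move=> s; apply: integral_ge0 => w _; exact: coneF_ge0.
rewrite EFinM -muleA; congr (_ * _).
transitivity (\int[mu]_s \int[mu]_w
   (if (0 < s)%R then (s `^ (h - 1))%:E * coneF psi (s + kap * w ^+ 2)%R w else 0)).
  apply: eq_integral => s _; case: ifP => s0; last by rewrite integral0_eq.
  rewrite ge0_integralZl//.
  - by apply: (@measurable_comp2 _ _ _ _ _ _ _ _ (coneF psi)) => //; mfun.
  - by move=> w _; exact: coneF_ge0.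
  - by rewrite lee_fin powR_ge0.
rewrite (@integral_swap _ (fun s w => if (0 < s)%R then (s `^ (h - 1))%:E * coneF psi (s + kap * w ^+ 2)%R w else 0)); last 2 first.
- apply: measurable_fun_ifT; [by mfun| |by mfun].
  apply: measurable_mule_comp; first by mfun.
  by apply: (@measurable_comp2 _ _ _ _ _ _ _ _ (coneF psi)) => //; mfun.
- by move=> s w; case: ifP => // _; rewrite mule_ge0 ?lee_fin ?powR_ge0// coneF_ge0.
(* The integrand after [s -> w^2 s]: the Jacobian [w^2] and the density [s^(h - 1)] together leave
   [(w^2)^h]. *)
pose G (w s : R) := if (0 < s)%R then (s `^ (h - 1))%:E * psi (Num.sqrt (s + kap))^-1%R *
   (if w ^+ 2 * (s + kap) <= 1 then (w ^+ 2) `^ h else 0)%R%:E else 0.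
have G0 w s : 0 <= G w s.
  rewrite /G; case: ifP => // _; apply: mule_ge0; first by rewrite mule_ge0// lee_fin powR_ge0.
  by rewrite lee_fin; case: ifP => // _; exact: powR_ge0.
have mG : measurable_fun [set: R * R] (fun z => G z.1 z.2) by rewrite /G; mfun.
transitivity (\int[mu]_w \int[mu]_s G w s).
  (* The substitution degenerates at [w = 0], a single point. *)
  apply: (@eq_integral_off _ 0%R).
  - apply: (@measurable_integral _ _ R (fun w s => if (0 < s)%R then (s `^ (h - 1))%:E * coneF psi (s + kap * w ^+ 2)%R w else 0)).
    apply: measurable_fun_ifT; [by mfun| |by mfun].
    apply: measurable_mule_comp; first by mfun.
    by apply: (@measurable_comp2 _ _ _ _ _ _ _ _ (coneF psi)) => //; mfun.
  - exact: measurable_integral.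
  move=> w w0; have w2 : (0 < w ^+ 2)%R by rewrite exprn_even_gt0.
  have mc : measurable_fun [set: R] (fun s => if (0 < s)%R then (s `^ (h - 1))%:E * coneF psi (s + kap * w ^+ 2)%R w else 0).
    apply: measurable_fun_ifT; [by mfun| |by mfun].
    apply: measurable_mule_comp; first by mfun.
    by apply: (@measurable_comp2 _ _ _ _ _ _ _ _ (coneF psi)) => //; mfun.
  have c0 s : 0 <= if (0 < s)%R then (s `^ (h - 1))%:E * coneF psi (s + kap * w ^+ 2)%R w else 0.
    by case: ifP => // _; rewrite mule_ge0 ?lee_fin ?powR_ge0// coneF_ge0.
  rewrite (@integral_affine _ (w ^+ 2)%R 0%R) ?gt_eqF// gtr0_norm// -ge0_integralZl//.
  - apply: eq_integral => s _; rewrite addr0 /G pmulr_rgt0//.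
    case: ifP => s0; last by rewrite mule0.
    rewrite [(kap * _)%R]mulrC -mulrDr coneF_homog ?addr_gt0//.
    case: ifP => _; last by rewrite !mule0.
    rewrite muleA -EFinM muleAC -EFinM; congr (_%:E * _).
    rewrite powRM ?(ltW w2) ?(ltW s0)// mulrA -{1}[(w ^+ 2)%R]powRr1 ?(ltW w2)// -powRD_gt0//.
    by rewrite mulrC; congr (_ * powR _ _)%R; ring.
  - by mfun.
  - by rewrite lee_fin ltW.
rewrite (integral_swap mG)// [in RHS](@integral_affine _ 1%R kap) ?oner_eq0//; last 2 first.
- by mfun.
- by move=> y; case: ifP => // _; rewrite mule_ge0// lee_fin mulr_ge0 ?powR_ge0.
rewrite normr1 mul1e -ge0_integralZl//; last 3 first.
- by mfun.
- by move=> y _; case: ifP => // _; rewrite mule_ge0// lee_fin mulr_ge0 ?powR_ge0.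
- by rewrite lee_fin ltW.
apply: eq_integral => s _; rewrite mul1r ltrDr /G addrK.
case: ifP => s0; last by rewrite mule0 integral0_eq.
rewrite ge0_integralZl//; last 3 first.
- by mfun.
- by move=> w _; rewrite lee_fin; case: ifP => // _; exact: powR_ge0.
- by rewrite mule_ge0// lee_fin powR_ge0.
rewrite HE ?addr_gt0// muleAC -!EFinM muleA -EFinM; congr (_%:E * _); ring.
Qed.

Definition colt m (u : m.-tuple R) : 'cV[R]_m := (\col_i tnth u i)%R.

Lemma qformE m (S : 'M[R]_m) u : qform S u = ((colt u)^T *m S *m colt u)%R ord0 ord0.
Proof.
rewrite mxE /qform exchange_big; apply: eq_bigr => j _.
rewrite !mxE mulr_suml; apply: eq_bigr => i _; rewrite !mxE; ring.
Qed.

Definition lastmx m (l : 'I_m.+1 -> R) : 'M[R]_m.+1 :=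
  (\matrix_(i, j) if i == ord_max then (if j == ord_max then (l ord_max)^-1 else - (l j / l ord_max))
    else (i == j)%:R)%R.

Lemma colt_lastsub m (l : 'I_m.+1 -> R) u : colt (lastsub l 0 u) = (lastmx l *m colt u)%R.
Proof.
apply/matrixP => i j; rewrite !mxE tnth_mktuple.
under [RHS]eq_bigr do rewrite /lastmx /colt !mxE.
case: (eqVneq i ord_max) => [->|i0].
  rewrite [RHS](bigD1 ord_max)//= eqxx subr0 mulrBl mulrC; congr (_ + _)%R.
  rewrite mulr_suml -sumrN; apply: eq_bigr => k k0; rewrite (negbTE k0); ring.
rewrite (bigD1 i)//= eqxx mul1r big1 ?addr0// => k k0.
by rewrite eq_sym (negbTE k0) mul0r.
Qed.

Lemma det_lastmx m (l : 'I_m.+1 -> R) : (\det (lastmx l) = (l ord_max)^-1)%R.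
Proof.
rewrite det_trig.
  rewrite (bigD1 ord_max)//= mxE !eqxx big1 ?mulr1// => i i0.
  by rewrite mxE (negbTE i0) eqxx.
apply/is_trig_mxP => i j ij; rewrite mxE.
have -> : (i == ord_max) = false.
  by apply/negbTE; rewrite neq_ltn; apply/orP; left; rewrite (leq_trans ij)// -ltnS ltn_ord.
by case: eqP ij => // ->; rewrite ltnn.
Qed.

Lemma lform_lastsub m (l : 'I_m.+1 -> R) u : l ord_max != 0%R ->
  lform l (lastsub l 0 u) = lastc u.
Proof.
move=> l0; rewrite /lform (bigD1 ord_max)//= tnth_mktuple eqxx subr0 mulrC divfK//.
rewrite [X in (_ + X)%R](eq_bigr (fun j => l j * tnth u j)%R); first by rewrite subrK.
by move=> j j0; rewrite tnth_mktuple (negbTE j0).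
Qed.

Lemma lastsub_surj m (l : 'I_m.+1 -> R) u : l ord_max != 0%R ->
  exists v, lastsub l 0 v = u /\ lastc v = lform l u.
Proof.
move=> l0; exists [tuple (if i == ord_max then lform l u else tnth u i) | i < m.+1].
split; last by rewrite /lastc tnth_mktuple eqxx.
apply: eq_from_tnth => i; rewrite !tnth_mktuple.
case: (eqVneq i ord_max) => [->|//].
rewrite (eq_bigr (fun j => l j * tnth u j)%R); last first.
  by move=> j j0; rewrite tnth_mktuple (negbTE j0).
by rewrite /lform (bigD1 ord_max)//= addrK subr0 mulrC mulKf.
Qed.

(** The substitution [lastsub] makes [l] the last coordinate, and Schur reduction diagonalizes the
    form. In [sqrt (det S) = |l ord_max| D sqrt kap] the first two factors cancel the Jacobians of
    these two changes, which is why exactly [sqrt kap] is left. *)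
Lemma rint_cone_quadratic m : (0 < m)%N -> exists2 A : R, (0 < A)%R &
  forall (S : 'M[R]_m.+1) (l : 'I_m.+1 -> R), S^T%R = S -> posdef S -> l ord_max != 0%R ->
  exists kap : R, [/\ (0 < kap)%R, (forall u, kap * lform l u ^+ 2 <= qform S u)%R,
    (exists u, lform l u = 1%R /\ qform S u = kap) &
    forall psi, measurable_fun [set: R] psi -> (forall t, 0 <= psi t) ->
    (Num.sqrt (\det S))%:E * rint (fun u => coneF psi (qform S u) (lform l u)) =
    (A * Num.sqrt kap)%:E * \int[mu]_y (if (kap < y)%R then
     (y `^ (- (m%:R / 2 + 2^-1)) * (y - kap) `^ (m%:R / 2 - 1))%:E * psi (Num.sqrt y)^-1%R else 0)].
Proof.
move=> m0; have [A A0 HA] := cone_reduce m0; exists A => // S l symS pS l0.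
pose S' := ((lastmx l)^T *m S *m lastmx l)%R.
have qS' u : qform S' u = qform S (lastsub l 0 u).
  by rewrite !qformE colt_lastsub trmx_mul /S' !mulmxA.
have symS' : S'^T%R = S' by rewrite /S' !trmx_mul trmxK symS mulmxA.
have pS' : posdef S'.
  move=> u [i ui]; rewrite qS'; apply: pS.
  (* Injectivity of [lastsub l 0]: either a coordinate other than the last is nonzero and is kept,
     or only the last one is nonzero and it is divided by [l ord_max]. *)
  have [[j]|/forallNP h] := pselect (exists j, (j != ord_max) && (tnth u j != 0%R)).
    move=> /andP[j0 uj]; exists j; by rewrite tnth_mktuple (negbTE j0).
  have hj j : j != ord_max -> tnth u j = 0%R.
    by move=> j0; apply/eqP; apply: contrapT => /negP uj; apply: (h j); rewrite j0.
  exists ord_max; rewrite tnth_mktuple eqxx subr0 big1 ?subr0; last first.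
    by move=> j j0; rewrite hj// mulr0.
  rewrite mulf_neq0 ?invr_eq0//; case: (eqVneq i ord_max) => [<-//|i0].
  by rewrite hj ?eqxx in ui.
have [kap [D [k0 D0 Dk [lb [u0 [u01 u0k]]] H]]] := rint_schur_reduce symS' pS'.
have detS : (\det S = (`|l ord_max| * D) ^+ 2 * kap)%R.
  rewrite exprMn real_normK ?num_real// -mulrA Dk /S' !det_mulmx det_tr det_lastmx.
  by field.
exists kap; split=> //.
- move=> u; have [v [<- <-]] := lastsub_surj u l0; rewrite -qS'; exact: lb.
- by exists (lastsub l 0 u0); rewrite lform_lastsub// -qS'.
move=> psi mpsi psi0.
have mc := measurable_coneF mpsi.
have := @rint_lastsub _ m l 0 (fun u => coneF psi (qform S u) (lform l u)) l0.
rewrite (_ : (fun u => coneF psi (qform S (lastsub l 0 u)) (lform l (lastsub l 0 u))) =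
  (fun u => coneF psi (qform S' u) (lastc u))); last first.
  by apply/funext => u; rewrite lform_lastsub// qS'.
move=> /(_ _ (fun u => coneF_ge0 _ _ psi0)).
rewrite H//; last by move=> *; exact: coneF_ge0.
rewrite HA// => h.
have {}h := h (measurable_comp2 mc (measurable_qform S) (measurable_lform l)).
have ln0 : (0 < `|l ord_max|)%R by rewrite normr_gt0.
rewrite detS sqrtrM ?sqr_ge0// sqrtr_sqr gtr0_norm ?mulr_gt0//.
set X := rint _ in h *; set J := integral _ _ _ in h *.
have -> : (`|l ord_max| * D * Num.sqrt kap)%:E * X = (Num.sqrt kap * D)%:E * (`|l ord_max|%:E * X).
  by rewrite [RHS]muleA -EFinM; congr (_%:E * _); ring.
by rewrite -h !muleA -!EFinM; congr (_%:E * _); field; rewrite gt_eqF.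
Qed.

End Core.

(** * Integrals of powers and comparison of powers *)

Section PowerIntegrals.
Context {R : realType}.
Local Notation mu := (@lebesgue_measure R).

(** Monotonicity of the power for [0 <= a], the same for the inverses when [a < 0]. The sign-free
    loss [r^|a|] lets the later estimates avoid case distinctions on exponents. *)
Lemma powR_comparable (r X Y a : R) : 1 <= r -> 0 < X -> X <= r * Y -> Y <= r * X ->
  Y `^ a <= r `^ `|a| * X `^ a.
Proof.
move=> r1 X0 XY YX.
have r0 : 0 < r by lra.
have Y0 : 0 < Y by rewrite -(pmulr_rgt0 _ r0); lra.
have [a0|a0] := leP 0 a.
  by rewrite ger0_norm// -powRM ?(ltW r0) ?(ltW X0)// ge0_ler_powR ?nnegrE ?mulr_ge0 ?(ltW r0) ?(ltW X0) ?(ltW Y0).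
have E Z : 0 < Z -> Z `^ a = Z^-1 `^ (- a).
  by move=> Z0; rewrite -powR_inv1 ?(ltW Z0)// -powRrM mulN1r opprK.
rewrite ltr0_norm// (E Y)// (E X)// -powRM ?invr_ge0 ?(ltW r0) ?(ltW X0)//.
rewrite ge0_ler_powR ?nnegrE ?oppr_ge0 ?(ltW a0) ?mulr_ge0 ?invr_ge0 ?(ltW r0) ?(ltW X0) ?(ltW Y0)//.
by rewrite -[leLHS]div1r ler_pdivrMr// mulrAC ler_pdivlMr// mul1r.
Qed.

Lemma powR_comparable_ge (r X Y a : R) : 1 <= r -> 0 < X -> X <= r * Y -> Y <= r * X ->
  r `^ (- `|a|) * X `^ a <= Y `^ a.
Proof.
move=> r1 X0 XY YX; have r0 : 0 < r by lra.
have Y0 : 0 < Y by rewrite -(pmulr_rgt0 _ r0); lra.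
by rewrite powRN mulrC ler_pdivrMr ?powR_gt0// mulrC powR_comparable.
Qed.

Lemma continuous_powR_gt0 (a x : R) : 0 < x -> {for x, continuous (@powR R ^~ a)}.
Proof.
move=> x0; apply: differentiable_continuous; apply/derivable1_diffP.
exact: (@ex_derive _ _ _ _ _ _ _ (is_derive1_powR a x0)).
Qed.

Local Open Scope ereal_scope.

Lemma FTC_pos (f F : R -> R) (a b : R) : (0 < a)%R -> (a < b)%R ->
  (forall x : R, (0 < x)%R -> is_derive x 1%R F (f x)) ->
  (forall x : R, (0 < x)%R -> {for x, continuous f}) ->
  \int[mu]_(x in `[a, b]) (f x)%:E = (F b - F a)%:E.
Proof.
move=> a0 ab dF cf.
have cF x : (0 < x)%R -> {for x, continuous F}.
  move=> x0; apply: differentiable_continuous; apply/derivable1_diffP.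
  exact: (@ex_derive _ _ _ _ _ _ _ (dF x x0)).
rewrite (@continuous_FTC2 _ f F)//.
- apply: continuous_in_subspaceT => x; rewrite inE/= in_itv/= => /andP[ax _].
  by apply: cf; lra.
- split.
  + move=> x; rewrite in_itv/= => /andP[ax _].
    by apply: (@ex_derive _ _ _ _ _ _ _ (dF x _)); lra.
  + by apply: cvg_at_right_filter; exact: cF.
  + by apply: cvg_at_left_filter; apply: cF; lra.
- move=> x; rewrite in_itv/= => /andP[ax _].
  by rewrite derive1E; apply: (@derive_val _ _ _ _ _ _ _ (dF x _)); lra.
Qed.

Lemma integral_itv_if (f : R -> R) (a b : R) :
  \int[mu]_(x in `[a, b]) (f x)%:E = \int[mu]_x (if (a <= x <= b)%R then f x else 0%R)%:E.
Proof.
rewrite integral_mkcond; apply: eq_integral => x _; rewrite patchE.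
have -> : (x \in `[a, b]%classic) = (a <= x <= b)%R.
  by apply/idP/idP; rewrite inE/= in_itv.
by case: ifP.
Qed.

Lemma powR_int (a b B : R) : (0 < a)%R -> (a < b)%R -> B != (-1)%R ->
  \int[mu]_s (if (a <= s <= b)%R then s `^ B else 0%R)%:E =
  ((b `^ (B + 1) - a `^ (B + 1)) / (B + 1))%:E.
Proof.
move=> a0 ab B1.
have B1' : (B + 1 != 0)%R by rewrite addr_eq0.
rewrite -integral_itv_if.
have dF (x : R) : (0 < x)%R -> is_derive x 1%R (fun x => (B + 1)^-1 * x `^ (B + 1))%R (x `^ B)%R.
  move=> x0; apply: (@is_derive_eq _ _ _ _ _ _ _ ((B + 1)^-1 *: ((B + 1) * x `^ (B + 1 - 1)))%R).
    by apply: is_deriveZ; exact: is_derive1_powR.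
  by rewrite addrK /GRing.scale/= mulrA mulVf// mul1r.
rewrite (FTC_pos a0 ab dF (fun x => @continuous_powR_gt0 B x)).
by congr EFin; field.
Qed.

Lemma inv_int (a b : R) : (0 < a)%R -> (a < b)%R ->
  \int[mu]_s (if (a <= s <= b)%R then s^-1 else 0%R)%:E = (ln b - ln a)%:E.
Proof.
move=> a0 ab; rewrite -integral_itv_if (@FTC_pos _ (@ln R))//.
by move=> x x0; apply: inv_continuous; rewrite gt_eqF.
Qed.

(** Monotone convergence along [[1/N, N]]; it carries the fundamental theorem of calculus over to
    improper integrals. *)
Lemma integral_exhaust (f : R -> \bar R) (K : \bar R) :
  measurable_fun [set: R] f -> (forall x, 0 <= f x) -> (forall x, (x <= 0)%R -> f x = 0) ->
  (forall N : nat, (2 <= N)%N ->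
     \int[mu]_x (if (N%:R^-1 <= x <= N%:R)%R then f x else 0) <= K) ->
  \int[mu]_x f x <= K.
Proof.
move=> mf f0 fn0 H.
pose g (N : nat) x := if ((N.+2)%:R^-1 <= x <= (N.+2)%:R)%R then f x else 0.
have mg N : measurable_fun [set: R] (g N) by rewrite /g; mfun.
have g0 N x : 0 <= g N x by rewrite /g; case: ifP.
have ndg x : {homo g^~ x : n m / (n <= m)%N >-> n <= m}.
  move=> n m nm; rewrite /g; case: ifPn => [/andP[h1 h2]|_]; last by case: ifP.
  rewrite ifT//; apply/andP; split.
    by rewrite (le_trans _ h1)// lef_pV2 ?posrE// ler_nat.
  by rewrite (le_trans h2)// ler_nat.
have gf x : limn (g^~ x) = f x.
  apply/cvg_lim => //; have [x0|x0] := leP x 0%R.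
    rewrite (_ : g^~ x = cst (f x)); first exact: cvg_cst.
    by apply/funext => n; rewrite /g fn0//; case: ifP.
  apply: cvg_near_cst; near=> n; rewrite /g ifT//; apply/andP; split.
    rewrite -[X in (_ <= X)%R]invrK lef_pV2 ?posrE ?invr_gt0//.
    apply: (@le_trans _ _ n%:R); last by rewrite ler_nat; apply: ltnW; exact: leqnSn.
    by near: n; exact: nbhs_infty_ger.
  apply: (@le_trans _ _ n%:R); last by rewrite ler_nat; apply: ltnW; exact: leqnSn.
  by near: n; exact: nbhs_infty_ger.
under eq_integral do rewrite -gf.
rewrite monotone_convergence//.
apply: lime_le; last by near=> n; exact: H.
apply: ereal_nondecreasing_is_cvgn => n m nm; apply: le_integral_ge0 => // x.
exact: ndg.
Unshelve. all: by end_near. Qed.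

Lemma powR_int0 (c B : R) : (0 < c)%R -> (-1 < B)%R ->
  \int[mu]_s (if (0 < s <= c)%R then s `^ B else 0%R)%:E <= (c `^ (B + 1) / (B + 1))%:E.
Proof.
move=> c0 B1.
have B10 : (0 < B + 1)%R by lra.
apply: integral_exhaust.
- by mfun.
- by move=> x; rewrite lee_fin; case: ifP => // _; exact: powR_ge0.
- by move=> x x0; rewrite ltNge x0.
move=> N N2.
have N0 : (0 < (N%:R : R)^-1)%R by rewrite invr_gt0 ltr0n (leq_trans _ N2).
have [Nc|Nc] := ltP N%:R^-1%R c.
  apply: (@le_trans _ _ (\int[mu]_s (if (N%:R^-1 <= s <= c)%R then s `^ B else 0%R)%:E)).
    apply: le_integral_ge0 => s.
      by case: ifP => // _; rewrite lee_fin; case: ifP => // _; exact: powR_ge0.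
    case: ifPn => [/andP[h1 h2]|_].
      by rewrite h1 (lt_le_trans N0 h1).
    by rewrite lee_fin; case: ifP => // _; exact: powR_ge0.
  rewrite powR_int//; last by rewrite gt_eqF.
  by rewrite lee_fin ler_pM2r ?invr_gt0// gerBl powR_ge0.
rewrite (@le_trans _ _ 0)//; last by rewrite lee_fin divr_ge0 ?powR_ge0// ltW.
(* Here [c <= 1/N], so the two ranges of integration meet at most in the point [c]. *)
rewrite le_eqVlt (@integral_supp1 _ c) ?eqxx// => s sc.
case: ifPn => // /andP[h1 h2]; case: ifP => // /andP[h3 h4].
by case/eqP: sc; apply/eqP; rewrite eq_le h4 (le_trans Nc h1).
Qed.

Lemma powR_inty (c E : R) : (0 < c)%R -> (E < -1)%R ->
  \int[mu]_s (if (c < s)%R then s `^ E else 0%R)%:E <= (c `^ (E + 1) / (- (E + 1)))%:E.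
Proof.
move=> c0 E1.
have E10 : (E + 1 < 0)%R by lra.
apply: integral_exhaust.
- by mfun.
- by move=> x; rewrite lee_fin; case: ifP => // _; exact: powR_ge0.
- by move=> x x0; rewrite ltNge (le_trans x0 (ltW c0)).
move=> N N2.
have [Nc|Nc] := ltP c N%:R.
  apply: (@le_trans _ _ (\int[mu]_s (if (c <= s <= N%:R)%R then s `^ E else 0%R)%:E)).
    apply: le_integral_ge0 => s.
      by case: ifP => // _; rewrite lee_fin; case: ifP => // _; exact: powR_ge0.
    case: ifPn => [/andP[h1 h2]|_]; rewrite lee_fin; last first.
      by case: ifP => // _; exact: powR_ge0.
    by case: ifPn => h3; [rewrite (ltW h3) h2|case: ifP => // _; exact: powR_ge0].
  rewrite powR_int//; last by rewrite lt_eqF.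
  rewrite lee_fin invrN mulrN -mulNr ler_nM2r ?invr_lt0//.
  by rewrite lerDr powR_ge0.
rewrite (@le_trans _ _ 0)//; last by rewrite lee_fin divr_ge0 ?powR_ge0// oppr_ge0 ltW.
rewrite le_eqVlt (@integral_supp1 _ c) ?eqxx// => s sc.
case: ifPn => // /andP[h1 h2]; case: ifP => // h3.
by move: h3; rewrite ltNge (le_trans h2 Nc).
Qed.

(** Split at [s = c]: below, [s + c] is comparable to [c] and [B > -1] gives convergence at 0;
    above, it is comparable to [s] and [B + E < -1] gives convergence at infinity. Both parts scale
    like [c^(B + E + 1)]. *)
Lemma beta_tail (B E : R) : (-1 < B)%R -> (B + E < -1)%R -> exists2 K : R, (0 <= K)%R &
  forall c, (0 < c)%R ->
  \int[mu]_s (if (0 < s)%R then s `^ B * (s + c) `^ E else 0%R)%:E <= (K * c `^ (B + E + 1))%:E.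
Proof.
move=> B1 BE; pose q : R := (2 `^ `|E|)%R.
have q0 : (0 <= q)%R by exact: powR_ge0.
have B10 : (0 < B + 1)%R by lra.
have BE0 : (0 < - (B + E + 1))%R by lra.
exists (q * ((B + 1)^-1 + (- (B + E + 1))^-1))%R.
  by rewrite mulr_ge0// addr_ge0// invr_ge0 ltW.
move=> c c0.
apply: (@le_trans _ _ (\int[mu]_s ((q * c `^ E)%:E * (if (0 < s <= c)%R then s `^ B else 0%R)%:E +
   q%:E * (if (c < s)%R then s `^ (B + E) else 0%R)%:E))).
  apply: le_integral_ge0 => s.
    by rewrite lee_fin; case: ifP => // _; rewrite mulr_ge0 ?powR_ge0.
  rewrite -!EFinM -EFinD lee_fin; case: ifPn => s0; last first.
    by rewrite addr_ge0// mulr_ge0 ?mulr_ge0 ?powR_ge0//; case: ifP => // _; exact: powR_ge0.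
  have [sc|sc] /= := leP s c.
    rewrite mulr0 addr0 mulrC ler_wpM2r ?powR_ge0//.
    by apply: powR_comparable => //; lra.
  rewrite mulr0 add0r powRD_gt0// mulrCA ler_wpM2l ?powR_ge0//.
  by apply: powR_comparable => //; lra.
rewrite ge0_integralD//; sides.
rewrite !ge0_integralZl//; sides.
apply: le_trans (leeD (lee_wpmul2l _ (powR_int0 c0 B1)) (lee_wpmul2l _ (powR_inty c0 BE))) _.
- by rewrite lee_fin mulr_ge0 ?powR_ge0.
- by rewrite lee_fin.
rewrite -!EFinM -EFinD lee_fin le_eqVlt; apply/orP; left; apply/eqP.
have -> : (c `^ (B + E + 1) = c `^ E * c `^ (B + 1))%R.
  by rewrite -powRD_gt0//; congr powR; ring.
by ring.
Qed.

End PowerIntegrals.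

(** * The one-dimensional inequalities behind sufficiency *)

Section Sufficiency1D.
Context {R : realType}.
Local Notation mu := (@lebesgue_measure R).

Lemma powR_antitone (x y a : R) : 0 < x -> x <= y -> a <= 0 -> y `^ a <= x `^ a.
Proof.
move=> x0 xy a0; rewrite -[a]opprK ![_ `^ (- - a)]powRN.
rewrite lef_pV2 ?posrE ?powR_gt0 ?(lt_le_trans x0 xy)//.
by rewrite ge0_ler_powR ?nnegrE ?oppr_ge0// ltW// (lt_le_trans x0).
Qed.

Lemma powR_ge1 (x a : R) : 0 < x -> x <= 1 -> a <= 0 -> 1 <= x `^ a.
Proof. by move=> x0 x1 a0; have := powR_antitone x0 x1 a0; rewrite powR1. Qed.

Lemma powR_le1_antitone (z a c : R) : 0 < z -> z <= 1 -> c <= a -> z `^ a <= z `^ c.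
Proof.
move=> z0 z1 ca; rewrite (_ : a = c + (a - c)); last by ring.
rewrite powRD_gt0// ler_piMr ?powR_ge0//.
have : 0 <= a - c by rewrite subr_ge0.
by move=> /(@ge0_ler_powR R)/(_ z 1); rewrite powR1; apply; rewrite ?nnegrE// ltW.
Qed.

Local Open Scope ereal_scope.

Lemma near_bound (B D eta : R) : (-1 < B)%R -> (0 <= eta)%R -> (0 <= B + D + 1 + eta)%R ->
  ((B + D + 1 + eta = 0)%R -> (0 < eta)%R) ->
  exists2 K : R, (0 <= K)%R & forall del, (0 <= del <= 1)%R -> (del = 0%R -> eta = 0%R) ->
  \int[mu]_s (if (0 < s <= 1)%R then s `^ B * (s + del) `^ D else 0%R)%:E <=
  (K * del `^ (- eta))%:E.
Proof.
move=> B1 eta0 H0 H1.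
have [c0|c0] := ltP 0%R (B + D + 1 + eta)%R.
  (* A power of [s] alone that dominates [(s + del)^(D + eta)]: exponent 0 if [D + eta >= 0], and
     [D + eta] itself otherwise. *)
  have [m0 m01 Hm0] : exists2 m0 : R, (-1 < B + m0)%R & forall s del : R, (0 < s <= 1)%R -> (0 <= del <= 1)%R ->
      ((s + del) `^ (D + eta) <= 2 `^ `|D + eta| * s `^ m0)%R.
    have [De|De] := leP 0%R (D + eta)%R.
      exists 0%R; first by rewrite addr0.
      move=> s del /andP[s0 s1] /andP[d0 d1]; rewrite powRr0 mulr1 ger0_norm//.
      by rewrite ge0_ler_powR ?nnegrE//; lra.
    exists (D + eta)%R; first by lra.
    move=> s del /andP[s0 s1] /andP[d0 d1].
    apply: (@le_trans _ _ (s `^ (D + eta))%R); first by apply: powR_antitone => //; lra.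
    rewrite ler_peMl ?powR_ge0//.
    by rewrite -[X in (X <= _)%R](powRr0 2%R) ler_powR//; lra.
  exists (2 `^ `|D + eta| * (B + m0 + 1)^-1)%R.
    by rewrite mulr_ge0 ?powR_ge0// invr_ge0; lra.
  move=> del dd del0; have /andP[d0 d1] := dd.
  apply: (@le_trans _ _ (\int[mu]_s ((2 `^ `|D + eta| * del `^ (- eta))%:E *
     (if (0 < s <= 1)%R then s `^ (B + m0) else 0%R)%:E))).
    apply: le_integral_ge0 => s; first by nneg.
    rewrite -EFinM lee_fin; case: ifPn => ss; last by rewrite mulr0.
    have /andP[s0 s1] := ss.
    have sd : (0 < s + del)%R by lra.
    rewrite (_ : D = (D + eta) + (- eta))%R; last by ring.
    rewrite powRD_gt0// addrNK.
    rewrite [X in (_ <= X)%R](_ : _ = s `^ B * ((2 `^ `|D + eta| * s `^ m0) * del `^ (- eta)))%R; last first.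
      by rewrite [(s `^ (B + m0))%R]powRD_gt0//; ring.
    rewrite ler_wpM2l ?powR_ge0// ler_pM ?powR_ge0 ?Hm0//.
    have [dz|dz] := eqVneq del 0%R; first by rewrite (del0 dz) oppr0 !powRr0.
    by apply: powR_antitone; [rewrite lt_neqAle eq_sym dz|lra|lra].
  rewrite ge0_integralZl//; sides.
  apply: le_trans (lee_wpmul2l _ (powR_int0 ltr01 m01)) _; first by nneg.
  by rewrite -EFinM powR1 lee_fin le_eqVlt; apply/orP; left; apply/eqP; rewrite div1r mulrAC.
have ceq : (B + D + 1 + eta = 0)%R by apply/eqP; rewrite eq_le c0 H0.
have e0 := H1 ceq.
have BD : (B + D < -1)%R by lra.
have [K K0 HK] := beta_tail B1 BD; exists K => // del /andP[d0 d1] del0.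
have dp : (0 < del)%R.
  by rewrite lt_neqAle d0 andbT; apply/eqP => /esym/del0 h; rewrite h ltxx in e0.
rewrite (_ : (- eta = B + D + 1)%R); last by lra.
apply: le_trans (HK _ dp); apply: le_integral_ge0 => s; first by nneg.
rewrite lee_fin; case: ifPn => [/andP[-> _]//|_]; case: ifP => // _.
by rewrite mulr_ge0 ?powR_ge0.
Qed.

Lemma integral_comb (a b : R) (f g : R -> R) : (0 <= a)%R -> (0 <= b)%R ->
  measurable_fun [set: R] f -> (forall s, 0 <= f s)%R ->
  measurable_fun [set: R] g -> (forall s, 0 <= g s)%R ->
  \int[mu]_s (a%:E * (f s)%:E + b%:E * (g s)%:E) =
  a%:E * \int[mu]_s (f s)%:E + b%:E * \int[mu]_s (g s)%:E.
Proof.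
move=> a0 b0 mf f0 mg g0; rewrite ge0_integralD//; sides.
by rewrite !ge0_integralZl//; sides.
Qed.

(** With [s = y - kap], this is the integral of the [q]-th power of the dual function in Hoelder's
    inequality. The factors in the bound are the inverse weight: [eta] controls [kap] near 1,
    [theta] controls large [kap]. *)
Lemma kernel_bound (A B D eta theta : R) : (-1 < B)%R -> (A + B + D < -1)%R ->
  (0 <= eta)%R -> (0 <= B + D + 1 + eta)%R -> ((B + D + 1 + eta = 0)%R -> (0 < eta)%R) ->
  (A + B + D + 1 <= theta)%R ->
  exists2 C : R, (0 <= C)%R & forall kap, (1 <= kap)%R -> (kap = 1%R -> eta = 0%R) ->
  \int[mu]_s (if (0 < s)%R then s `^ B * ((s + kap) `^ A * (s + (kap - 1)) `^ D) else 0%R)%:E <=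
  (C * (((kap - 1) / kap) `^ (- eta) * kap `^ theta))%:E.
Proof.
move=> B1 ABD eta0 H0 H1 th.
have [K1 K10 HK1] : exists2 K : R, (0 <= K)%R &  forall c, (0 < c)%R ->
    \int[mu]_s (if (0 < s)%R then s `^ B * (s + c) `^ (A + D) else 0%R)%:E <= (K * c `^ (B + (A + D) + 1))%:E.
  by apply: beta_tail => //; lra.
have [K3 K30 HK3] := near_bound B1 eta0 H0 H1.
pose K2 := (- (A + B + D + 1))^-1%R.
have K20 : (0 <= K2)%R by rewrite invr_ge0; lra.
pose C1 := (2 `^ `|D| * K1)%R.
pose C2 := (4 `^ `|A| * K3 + 4 `^ `|A| * 4 `^ `|D| * K2)%R.
have C10 : (0 <= C1)%R by rewrite mulr_ge0 ?powR_ge0.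
have C20 : (0 <= C2)%R by rewrite addr_ge0 ?mulr_ge0 ?powR_ge0.
exists (C1 + C2 * 4 `^ `|theta|)%R; first by rewrite addr_ge0 ?mulr_ge0 ?powR_ge0.
move=> kap k1 keta; have k0 : (0 < kap)%R by lra.
pose X := (((kap - 1) / kap) `^ (- eta))%R.
have X1 : (1 <= X)%R.
  rewrite /X; have [kz|kz] := eqVneq kap 1%R; first by rewrite keta// oppr0 powRr0.
  have kz' : (1 < kap)%R by rewrite lt_neqAle eq_sym kz.
  by apply: powR_ge1; rewrite ?divr_gt0 ?subr_gt0 ?ler_pdivrMr ?mul1r ?gerBl ?oppr_le0.
have X0 : (0 <= X)%R by lra.
rewrite -/X.
(* For [kap >= 2], [s + (kap - 1)] and [s + kap] agree up to a factor 2, so one application of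
   [beta_tail] suffices. *)
have [k2|k2] := leP 2%R kap.
  apply: (@le_trans _ _ (\int[mu]_s ((2 `^ `|D|)%:E * (if (0 < s)%R then s `^ B * (s + kap) `^ (A + D) else 0%R)%:E))).
    apply: le_integral_ge0 => s.
      by rewrite lee_fin; case: ifP => // _; rewrite !mulr_ge0 ?powR_ge0.
    rewrite -EFinM lee_fin; case: ifPn => s0; last by rewrite mulr0.
    rewrite [((s + kap) `^ (A + D))%R]powRD_gt0; last by lra.
    rewrite [X in (_ <= X)%R](_ : _ = s `^ B * ((s + kap) `^ A * (2 `^ `|D| * (s + kap) `^ D)))%R; last by ring.
    rewrite ler_wpM2l ?powR_ge0// ler_wpM2l ?powR_ge0//.
    by clear -k2 s0; apply: powR_comparable; lra.
  rewrite ge0_integralZl//; sides.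
  apply: le_trans (lee_wpmul2l _ (HK1 _ k0)) _; first by nneg.
  rewrite -EFinM lee_fin.
  apply: (@le_trans _ _ (C1 * (X * kap `^ theta))%R); last first.
    by rewrite ler_wpM2r ?mulr_ge0 ?powR_ge0// lerDl mulr_ge0 ?powR_ge0.
  rewrite [X in (X <= _)%R]mulrA -/C1 ler_wpM2l// -[X in (X <= _)%R]mul1r ler_pM ?powR_ge0//.
  by rewrite ler_powR//; lra.
(* For [kap < 2] the integral is split at [s = 1]. Up to factors 4, [s + kap] is 1 on the left part;
   on the right part both shifted variables are [s]. *)
apply: (@le_trans _ _ (\int[mu]_s ((4 `^ `|A|)%:E * (if (0 < s <= 1)%R then s `^ B * (s + (kap - 1)) `^ D else 0%R)%:E +
   (4 `^ `|A| * 4 `^ `|D|)%:E * (if (1 < s)%R then s `^ (A + B + D) else 0%R)%:E))).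
  apply: le_integral_ge0 => s.
    by rewrite lee_fin; case: ifP => // _; rewrite !mulr_ge0 ?powR_ge0.
  rewrite -!EFinM -EFinD lee_fin; case: ifPn => s0; last first.
    by rewrite addr_ge0// mulr_ge0 ?mulr_ge0 ?powR_ge0//; case: ifP => // _; rewrite ?mulr_ge0 ?powR_ge0.
  have [s1|s1] /= := leP s 1%R.
    rewrite mulr0 addr0 mulrCA ler_wpM2r ?mulr_ge0 ?powR_ge0//.
    by have := @powR_comparable R 4 1 (s + kap)%R A; rewrite powR1 !mulr1; clear -s0 s1 k1 k2; apply; lra.
  rewrite mulr0 add0r.
  have -> : (s `^ (A + B + D) = s `^ B * (s `^ A * s `^ D))%R.
    by rewrite !powRD_gt0; [ring|lra|lra].
  rewrite [X in (_ <= X)%R](_ : _ = s `^ B * ((4 `^ `|A| * s `^ A) * (4 `^ `|D| * s `^ D)))%R; last by ring.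
  by rewrite ler_wpM2l ?powR_ge0// ler_pM ?powR_ge0//; clear -s1 k1 k2; apply: powR_comparable; lra.
rewrite integral_comb ?mulr_ge0 ?powR_ge0//; [|mfun|nneg|mfun|nneg].
have dd : (0 <= kap - 1 <= 1)%R by clear -k1 k2; lra.
have del0 : (kap - 1 = 0 -> eta = 0)%R by move=> h; apply: keta; lra.
apply: le_trans (leeD (lee_wpmul2l _ (HK3 _ dd del0)) (lee_wpmul2l _ (powR_inty ltr01 ABD))) _.
- by nneg.
- by nneg.
rewrite -!EFinM -EFinD lee_fin powR1 div1r -/K2.
have dX : ((kap - 1) `^ (- eta) <= X)%R.
  rewrite /X; have [kz|kz] := eqVneq kap 1%R; first by rewrite keta// oppr0 !powRr0.
  have kz' : (1 < kap)%R by rewrite lt_neqAle eq_sym kz.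
  apply: powR_antitone; rewrite ?divr_gt0 ?subr_gt0 ?oppr_le0//.
  by rewrite ler_pdivrMr// ler_peMr// subr_ge0.
apply: (@le_trans _ _ (C2 * X)%R).
  rewrite /C2 mulrDl lerD//.
    by rewrite -mulrA ler_wpM2l ?powR_ge0// ler_wpM2l.
  by rewrite ler_peMr ?mulr_ge0 ?powR_ge0.
apply: (@le_trans _ _ (C2 * 4 `^ `|theta| * (X * kap `^ theta))%R); last first.
  by rewrite ler_wpM2r ?mulr_ge0 ?powR_ge0// lerDr.
rewrite [X in (_ <= X)%R](_ : _ = (C2 * X) * (4 `^ `|theta| * kap `^ theta))%R; last by ring.
rewrite ler_peMr ?mulr_ge0//.
by have := @powR_comparable R 4 kap 1 theta; rewrite powR1; clear -k1 k2; apply; lra.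
Qed.

Definition wt (b e y : R) : R := (y `^ (- (e + b + 1)) * (y - 1) `^ b)%R.

Lemma wt_ge0 b e y : (0 <= wt b e y)%R. Proof. by rewrite /wt mulr_ge0 ?powR_ge0. Qed.

(** The dual exponent is infinite, so the weighted kernel is compared with [wt] pointwise. Since
    [h >= 1], [(y - kap)^(h - 1)] is at most [(y - 1)^(h - 1)]. The quotient of [wt] by the enlarged
    kernel is a power of [(y - 1)/y] times a power of [y]; both bases increase, so they dominate
    their values at [kap < y]. *)
Lemma transform_le_L1 (h b e G1 G2 : R) : (1 <= h)%R -> (e <= 2^-1)%R -> (0 <= G1)%R ->
  (b + 1 - h <= G1)%R -> (e <= G2)%R ->
  forall kap (phi : R -> R), (1 <= kap)%R -> measurable_fun [set: R] phi ->
  (((kap - 1) / kap) `^ G1 * kap `^ (2^-1 - G2))%:E *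
    \int[mu]_y (if (kap < y)%R then y `^ (- (h + 2^-1)) * (y - kap) `^ (h - 1) * `|phi y| else 0%R)%:E
  <= \int[mu]_y (if (1 < y)%R then `|phi y| * wt b e y else 0%R)%:E.
Proof.
move=> h1 e2 G10 G1b G2e kap phi k1 mphi; have k0 : (0 < kap)%R by lra.
rewrite -ge0_integralZl//; sides.
apply: le_integral_ge0 => y; first by nneg.
rewrite -EFinM lee_fin; case: ifPn => ky; last first.
  by rewrite mulr0; case: ifP => // _; rewrite mulr_ge0 ?wt_ge0.
have y1 : (1 < y)%R by lra.
have y0 : (0 < y)%R by lra.
have y10 : (0 < y - 1)%R by lra.
rewrite y1 mulrA [X in (_ <= X)%R]mulrC ler_wpM2r//.
set w := (_ `^ G1 * _)%R.
apply: (@le_trans _ _ (w * (y `^ (- (h + 2^-1)) * (y - 1) `^ (h - 1)))%R).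
  rewrite ler_wpM2l ?mulr_ge0 ?powR_ge0// ler_wpM2l ?powR_ge0//.
  by rewrite ge0_ler_powR ?nnegrE; lra.
pose z := ((y - 1) / y)%R.
have z0 : (0 < z)%R by rewrite divr_gt0.
have -> : wt b e y = (z `^ (b + 1 - h) * y `^ (2^-1 - e) * (y `^ (- (h + 2^-1)) * (y - 1) `^ (h - 1)))%R.
  rewrite /wt /z powRM ?invr_ge0 ?(ltW y0) ?(ltW y10)//.
  rewrite -[y^-1%R]powR_inv1 ?(ltW y0)// -powRrM.
  transitivity (((y - 1) `^ (b + 1 - h) * (y - 1) `^ (h - 1)) *
     (y `^ (- 1 * (b + 1 - h)) * y `^ (2^-1 - e) * y `^ (- (h + 2^-1))))%R; last by ring.
  rewrite -!powRD_gt0// mulrC; congr (_ `^ _ * _ `^ _)%R; by field.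
rewrite ler_wpM2r ?mulr_ge0 ?powR_ge0//.
have z1 : (z <= 1)%R by rewrite ler_pdivrMr//; lra.
apply: ler_pM; rewrite ?powR_ge0//.
  apply: (@le_trans _ _ (z `^ G1)%R).
    rewrite ge0_ler_powR ?nnegrE ?(ltW z0) ?divr_ge0 ?(ltW k0)//; first by lra.
    by rewrite ler_pdivrMr// mulrAC ler_pdivlMr//; nra.
  exact: powR_le1_antitone.
apply: (@le_trans _ _ (kap `^ (2^-1 - e))%R); first by rewrite ler_powR//; lra.
by rewrite ge0_ler_powR ?nnegrE; lra.
Qed.

Lemma Lnorm_le_powR (f : R -> R) (p N : R) : (0 < p)%R -> (forall y, (0 <= f y)%R) ->
  \int[mu]_y (f y `^ p)%:E <= N%:E -> 'N[mu]_p%:E[EFin \o f] <= (N `^ p^-1)%:E.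
Proof.
move=> p0 f0 HN; rewrite unlock /= -poweR_EFin.
have -> : \int[mu]_x `|(f x)%:E| `^ p = \int[mu]_y (f y `^ p)%:E.
  by apply: eq_integral => y _; rewrite gee0_abs ?lee_fin// poweR_EFin.
have I0 : 0 <= \int[mu]_y (f y `^ p)%:E by apply: integral_ge0 => y _; rewrite lee_fin powR_ge0.
apply: gt0_ler_poweR; rewrite ?invr_ge0 ?(ltW p0)//.
  by rewrite in_itv/= I0 leey.
by rewrite in_itv/= (le_trans I0 HN) leey.
Qed.

(** Hoelder for [|phi| wt^(1/p)] and the kernel times [wt^(-1/p)]; [kernel_bound] shows that the
    [q]-norm of the second factor is at most a constant divided by the weight. *)
Lemma transform_le_Lp (h b e G1 G2 p : R) : (1 < p)%R -> (0 < h)%R -> (h < 1 -> h = 2^-1 /\ 2 < p)%R ->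
  (e / p < 2^-1)%R -> (0 <= G1)%R -> ((b + 1) / p - h <= G1)%R -> (p = (b + 1) / h -> 0 < G1)%R ->
  (e / p <= G2)%R ->
  exists2 C : R, (0 <= C)%R & forall kap (phi : R -> R) (N : R), (1 <= kap)%R -> measurable_fun [set: R] phi ->
  \int[mu]_y (if (1 < y)%R then `|phi y| `^ p * wt b e y else 0%R)%:E = N%:E ->
  (((kap - 1) / kap) `^ G1 * kap `^ (2^-1 - G2))%:E *
    \int[mu]_y (if (kap < y)%R then y `^ (- (h + 2^-1)) * (y - kap) `^ (h - 1) * `|phi y| else 0%R)%:E
  <= (C * N `^ p^-1)%:E.
Proof.
move=> p1 h0 hh ep G10 Gb Gp eG.
have p0 : (0 < p)%R by lra.
have p00 : (p != 0)%R by rewrite gt_eqF.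
pose q := (p / (p - 1))%R.
have q0 : (0 < q)%R by rewrite divr_gt0; lra.
have q00 : (q != 0)%R by rewrite gt_eqF.
have pm1 : (p - 1 != 0)%R by rewrite gt_eqF//; lra.
have pq : (p^-1 + q^-1 = 1)%R by rewrite /q; field; rewrite p00 pm1.
have qV : (q^-1 = 1 - p^-1)%R by rewrite -pq; ring.
have qp : (q * p^-1 = q - 1)%R.
  by apply: (mulfI (invr_neq0 q00)); rewrite mulrA mulVf// mul1r mulrBr mulVf// mulr1 qV; ring.
(* Exponents in the [q]-th power of the dual function: [A] of [y], [B] of [y - kap], [D] of [y - 1].
   For [h = 1/2], [B > -1] amounts to [q < 2], that is [p > 2]. *)
pose A := (q * (- (h + 2^-1) + (e + b + 1) / p))%R.
pose B := (q * (h - 1))%R.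
pose D := (q * (- (b / p)))%R.
have B1 : (-1 < B)%R.
  rewrite /B; have [h1|h1] := ltP h 1%R; last by rewrite (@lt_le_trans _ _ 0%R)//; nra.
  have [-> p2] := hh h1.
  have : (q < 2)%R by rewrite ltr_pdivrMr; lra.
  by lra.
(* This identity and [BDE] translate the hypotheses: [A + B + D < -1] is [e/p < 1/2], and
   [0 <= B + D + 1 + q G1] is the lower bound on [G1]. *)
have ABDE : (A + B + D = - 1 - q * (2^-1 - e / p))%R.
  transitivity (- q * (3 / 2) + q * (e / p) + (q * p^-1))%R; last by rewrite qp; field.
  by rewrite /A /B /D; field.
have qe : (0 < q * (2^-1 - e / p))%R by rewrite mulr_gt0//; lra.
have BDE : (B + D + 1 + q * G1 = q * (G1 - ((b + 1) / p - h)))%R.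
  transitivity (q * (G1 - ((b + 1) / p - h)) + (q * p^-1 - (q - 1)))%R; last by rewrite qp; ring.
  by rewrite /B /D; field.
have [C0 C00 HC0] : exists2 C : R, (0 <= C)%R & forall kap, (1 <= kap)%R -> (kap = 1%R -> q * G1 = 0)%R ->
   \int[mu]_s (if (0 < s)%R then s `^ B * ((s + kap) `^ A * (s + (kap - 1)) `^ D) else 0%R)%:E <=
   (C * (((kap - 1) / kap) `^ (- (q * G1)) * kap `^ (q * (G2 - 2^-1))))%:E.
  apply: kernel_bound => //.
  - by rewrite ABDE; lra.
  - by rewrite mulr_ge0// ltW.
  - by rewrite BDE mulr_ge0 ?(ltW q0)// subr_ge0.
  - rewrite BDE => /eqP; rewrite mulf_eq0 (negbTE q00)/= subr_eq0 => /eqP GE.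
    rewrite mulr_gt0//.
    (* Equality together with [G1 = 0] means [p = (b + 1)/h], the critical exponent, where [Gp] asks
       for [0 < G1]. *)
    have [Gz|//] := leP G1 0%R.
    have G1z : G1 = 0%R by apply/eqP; rewrite eq_le Gz G10.
    suff : (0 < G1)%R by rewrite G1z ltxx.
    apply: Gp; move: GE; rewrite G1z => /esym/eqP; rewrite subr_eq0 => /eqP bh.
    by rewrite -bh invf_div mulrCA divff ?mulr1//; apply: contraTneq h0 => b1; rewrite -bh b1 mul0r ltxx.
  - rewrite ABDE (_ : (-1 - _ + 1 = q * (e / p - 2^-1)))%R; last by ring.
    by rewrite ler_pM2l//; lra.
exists (C0 `^ q^-1)%R; first exact: powR_ge0.
move=> kap phi N k1 mphi HN.
have k0 : (0 < kap)%R by exact: lt_le_trans k1.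
have N0 : (0 <= N)%R.
  by rewrite -lee_fin -HN; apply: integral_ge0 => y _; rewrite lee_fin; case: ifP => // _; rewrite mulr_ge0 ?powR_ge0 ?wt_ge0.
have RHS0 : (0 <= C0 `^ q^-1 * N `^ p^-1)%R by rewrite mulr_ge0 ?powR_ge0.
set w := (_ `^ G1 * _)%R.
(* At [kap = 1] with [G1 != 0] the weight is [powR 0 G1 = 0], and the product with the possibly
   infinite integral is 0. *)
have [[kz Gz]|kG] := pselect (kap = 1%R /\ G1 != 0%R).
  by rewrite /w kz subrr mul0r powR0// mul0r mul0e lee_fin.
have kG' : kap = 1%R -> G1 = 0%R.
  by move=> kz; apply/eqP; apply: contrapT => /negP ?; apply: kG.
have w0 : (0 < w)%R.
  rewrite /w; have [kz|kz] := eqVneq kap 1%R; first by rewrite kG'// powRr0 mul1r powR_gt0.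
  have kz' : (1 < kap)%R by rewrite lt_neqAle eq_sym kz.
  by rewrite mulr_gt0 ?powR_gt0// divr_gt0// subr_gt0.
pose f y := (if kap < y then `|phi y| * wt b e y `^ p^-1 else 0)%R.
pose g y := (if kap < y then y `^ (- (h + 2^-1)) * (y - kap) `^ (h - 1) * wt b e y `^ (- p^-1) else 0)%R.
have mf : measurable_fun [set: R] f by rewrite /f /wt; mfun.
have mg : measurable_fun [set: R] g by rewrite /g /wt; mfun.
have f0 y : (0 <= f y)%R by rewrite /f; case: ifP => // _; rewrite mulr_ge0 ?powR_ge0.
have g0 y : (0 <= g y)%R by rewrite /g; case: ifP => // _; rewrite !mulr_ge0 ?powR_ge0.
have wtp y : (kap < y)%R -> (0 < wt b e y)%R.
  by move=> ky; rewrite /wt mulr_gt0 ?powR_gt0 ?subr_gt0 ?(lt_trans k0 ky) ?(le_lt_trans k1 ky).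
have Hf : \int[mu]_y (f y `^ p)%:E <= N%:E.
  rewrite -HN; apply: le_integral_ge0 => y; first by nneg.
  rewrite lee_fin /f; case: ifPn => ky; last first.
    by rewrite powR0//; case: ifP => // _; rewrite mulr_ge0 ?powR_ge0 ?wt_ge0.
  rewrite (le_lt_trans k1 ky).
  by rewrite powRM ?powR_ge0// -powRrM mulVf// powRr1 ?wt_ge0.
have Hg : \int[mu]_y (g y `^ q)%:E <= (C0 * w `^ (- q))%:E.
  have -> : (w `^ (- q) = ((kap - 1) / kap) `^ (- (q * G1)) * kap `^ (q * (G2 - 2^-1)))%R.
    rewrite /w powRM ?powR_ge0// -!powRrM; congr (_ `^ _ * _ `^ _)%R; ring.
  apply: le_trans (HC0 kap k1 _); last by move=> /kG' ->; rewrite mulr0.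
  have mgq : measurable_fun [set: R] (fun y => (g y `^ q)%:E) by mfun.
  have gq0 y : 0 <= (g y `^ q)%:E by nneg.
  rewrite (integral_affine kap (oner_neq0 R) mgq gq0).
  rewrite normr1 mul1e; apply: le_integral_ge0 => s; first by nneg.
  rewrite lee_fin mul1r /g ltrDr addrK; case: ifPn => s0; last by rewrite powR0.
  have sk : (0 < s + kap)%R by exact: addr_gt0.
  have sk1 : (0 < s + kap - 1)%R by clear -s0 k1; lra.
  rewrite powRM ?mulr_ge0 ?powR_ge0// powRM ?powR_ge0// -!powRrM.
  rewrite /wt powRM ?powR_ge0// -!powRrM addrA.
  rewrite le_eqVlt; apply/orP; left; apply/eqP.
  transitivity (s `^ ((h - 1) * q) * (((s + kap) `^ (- (h + 2^-1) * q) *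
     (s + kap) `^ (- (e + b + 1) * (- p^-1 * q))) * (s + kap - 1) `^ (b * (- p^-1 * q))))%R; first by ring.
  rewrite -powRD_gt0//; congr (_ `^ _ * (_ `^ _ * _ `^ _))%R; rewrite /A /B /D; field => //.
have -> : \int[mu]_y (if kap < y then y `^ (- (h + 2^-1)) * (y - kap) `^ (h - 1) * `|phi y| else 0)%R%:E
   = 'N[mu]_1[EFin \o (f \* g)%R].
  rewrite Lnorm1; apply: eq_integral => y _ /=.
  rewrite [`|f y * g y|%R]ger0_norm ?mulr_ge0//; congr EFin.
  rewrite /f /g; case: ifPn => ky; last by rewrite mulr0.
  by rewrite mulrACA -powRD_gt0 ?wtp// subrr powRr0 mulr1 mulrC.
apply: (@le_trans _ _ (w%:E * ((N `^ p^-1)%:E * ((C0 * w `^ (- q)) `^ q^-1)%:E))).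
  apply: lee_wpmul2l; first by rewrite lee_fin ltW.
  apply: le_trans (hoelder mu mf mg p0 q0 pq) _.
  apply: lee_pmul; [exact: Lnorm_ge0|exact: Lnorm_ge0| |].
    exact: Lnorm_le_powR.
  exact: Lnorm_le_powR.
rewrite -!EFinM lee_fin powRM ?powR_ge0// -powRrM mulNr divff// powR_inv1 ?(ltW w0)//.
rewrite le_eqVlt; apply/orP; left; apply/eqP; field; by rewrite gt_eqF.
Qed.

End Sufficiency1D.

(** * Great spheres in terms of the Gram matrix and of the last row *)

Section Geometry.
Context {R : realType}.
Local Notation mu := (@lebesgue_measure R).

Definition gram n k (M : k.+1.-tuple (n.+1.-tuple R)) : 'M[R]_k.+1 :=
  \matrix_(i < k.+1, j < k.+1) dot (tnth M i) (tnth M j).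
Definition lastrow n k (M : k.+1.-tuple (n.+1.-tuple R)) : 'I_k.+1 -> R :=
  fun j => tnth (tnth M j) ord_max.

Lemma dot_sqn m (x : m.-tuple R) : dot x x = sqn x.
Proof. by rewrite /dot /sqn; apply: eq_bigr => i _; rewrite expr2. Qed.

Lemma qform_gram n k (M : k.+1.-tuple (n.+1.-tuple R)) u :
  qform (gram M) u = sqn (mxapp M u).
Proof.
rewrite /qform /sqn.
under eq_bigr do under eq_bigr do rewrite mxE /dot mulr_suml.
under eq_bigr do rewrite exchange_big.
rewrite exchange_big; apply: eq_bigr => a _ /=.
rewrite tnth_mktuple expr2 mulr_suml; apply: eq_bigr => i _.
by rewrite mulr_sumr; apply: eq_bigr => j _; ring.
Qed.

Lemma lform_lastrow n k (M : k.+1.-tuple (n.+1.-tuple R)) u :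
  lform (lastrow M) u = tnth (mxapp M u) ord_max.
Proof. by rewrite tnth_mktuple. Qed.

Lemma gram_sym n k (M : k.+1.-tuple (n.+1.-tuple R)) : (gram M)^T = gram M.
Proof.
by apply/matrixP => i j; rewrite !mxE /dot; apply: eq_bigr => a _; rewrite mulrC.
Qed.

Lemma sqn_eq0 m (x : m.-tuple R) : sqn x = 0 -> forall i, tnth x i = 0.
Proof.
move=> x0 i; apply/eqP; rewrite -sqrf_eq0; apply/eqP/le_anti.
by rewrite sqr_ge0 andbT -x0 sqr_le_sqn.
Qed.

(** A vector with [M u = 0] is killed by the Gram matrix, which is invertible. *)
Lemma gram_posdef n k (M : k.+1.-tuple (n.+1.-tuple R)) :
  gram_det M != 0 -> posdef (gram M).
Proof.
move=> dM u [i ui]; rewrite qform_gram lt_neqAle sqn_ge0 andbT.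
apply: contra_neq ui => /esym/sqn_eq0 Mu0.
have Gu : gram M *m colt u = 0.
  apply/matrixP => a b; rewrite !mxE.
  under eq_bigr do rewrite !mxE /dot mulr_suml.
  rewrite exchange_big big1// => c _ /=.
  transitivity (tnth (tnth M a) c * tnth (mxapp M u) c); last by rewrite Mu0 mulr0.
  by rewrite tnth_mktuple mulr_sumr; apply: eq_bigr => j _; ring.
have uM : gram M \in unitmx by rewrite unitmxE unitfE.
have : colt u = 0 by rewrite -(mulKmx uM (colt u)) Gu mulmx0.
by move=> /matrixP/(_ i ord0); rewrite !mxE.
Qed.

Lemma tnorm_sqn m (x : m.-tuple R) : tnorm x = Num.sqrt (sqn x).
Proof. by rewrite /tnorm dot_sqn. Qed.

Lemma tnorm_cond m (x : m.-tuple R) :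
  (0 < tnorm x) && (tnorm x <= 1) = (0 < sqn x <= 1).
Proof.
by rewrite tnorm_sqn sqrtr_gt0 -[X in _ <= X]sqrtr1 ler_sqrt.
Qed.

Lemma normalized_last n (x : n.+1.-tuple R) :
  `|tnth (tscale (tnorm x)^-1 x) ord_max| = `|tnth x ord_max| / Num.sqrt (sqn x).
Proof.
by rewrite tnth_mktuple tnorm_sqn normrM mulrC normfV (ger0_norm (sqrtr_ge0 _)).
Qed.

Lemma sqrt_ge1 (x : R) : 1 <= x -> 1 <= Num.sqrt x.
Proof. by move=> x1; rewrite -[X in X <= _]sqrtr1; exact: ler_wsqrtr. Qed.

Lemma acos_anti (a b : R) : -1 <= a <= 1 -> -1 <= b <= 1 -> a <= b -> acos b <= acos a.
Proof.
move=> ha hb ab; rewrite leNgt; apply/negP => h.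
have ia : acos a \in `[0, pi] by rewrite in_itv/= acos_ge0// acos_lepi.
have ib : acos b \in `[0, pi] by rewrite in_itv/= acos_ge0// acos_lepi.
by have := ltr_cos ia ib; rewrite !acosK ?in_itv//= h ltNge ab.
Qed.

Lemma acos_lt_pihalf (c : R) : 0 < c <= 1 -> acos c < pi / 2.
Proof.
move=> /andP[c0 c1]; rewrite ltNge; apply/negP => h.
have hc : -1 <= c <= 1 by lra.
have ic : acos c \in `[0, pi] by rewrite in_itv/= acos_ge0// acos_lepi.
have ip : (pi / 2 : R) \in `[0, pi] by rewrite in_itv/=; have := pi_gt0 R; lra.
have [e|ne] := eqVneq (pi / 2) (acos c).
  have : cos (acos c) = cos (pi / 2) by rewrite -e.
  by rewrite acosK ?in_itv//= cos_pihalf => c00; rewrite c00 ltxx in c0.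
have : pi / 2 < acos c by rewrite lt_neqAle ne h.
by rewrite -(ltr_cos ip ic) acosK ?in_itv//= cos_pihalf ltNge (ltW c0).
Qed.

Lemma dot_npole n (x : n.+1.-tuple R) : dot (npole R n) x = tnth x ord_max.
Proof.
rewrite /dot (bigD1 ord_max)//= tnth_mktuple eqxx mul1r big1 ?addr0// => i i0.
by rewrite tnth_mktuple (negbTE i0) mul0r.
Qed.

Lemma inf_attained (A : set R) (a : R) : A a -> (forall x, A x -> a <= x) -> inf A = a.
Proof.
move=> Aa lA; apply/le_anti/andP; split.
  by apply: ge_inf => //; exists a.
by apply: lb_le_inf; [exists a|].
Qed.

Lemma mxappZ n k (M : k.+1.-tuple (n.+1.-tuple R)) c u :
  mxapp M (tscale c u) = tscale c (mxapp M u).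
Proof.
apply: eq_from_tnth => i; rewrite !tnth_mktuple mulr_sumr.
by apply: eq_bigr => j _; rewrite tnth_mktuple; ring.
Qed.

(** By homogeneity, the minimum [kap] of [|M u|^2] on last coordinate 1 means that unit vectors of
    the column space have last coordinate at most [kap^(-1/2)], with equality attained; [acos]
    reverses the order. Also [kap >= 1], because a vector is at least as long as its last
    coordinate. *)
Lemma dist_pole_acos n k (M : k.+1.-tuple (n.+1.-tuple R)) kap : 0 < kap ->
  (forall u, kap * lform (lastrow M) u ^+ 2 <= qform (gram M) u) ->
  (exists u, lform (lastrow M) u = 1 /\ qform (gram M) u = kap) ->
  1 <= kap /\ dist_pole M = acos (Num.sqrt kap)^-1.
Proof.
move=> k0 lb [u0 [u01 u0k]].
have k1 : 1 <= kap.
  rewrite -u0k qform_gram (le_trans _ (sqr_le_sqn _ ord_max))// -lform_lastrow u01.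
  by rewrite expr1n.
split=> //.
have sk0 : 0 < Num.sqrt kap by rewrite sqrtr_gt0.
have sk1 : 1 <= Num.sqrt kap by exact: sqrt_ge1.
have c1 : (Num.sqrt kap)^-1 <= 1 by rewrite invf_le1.
have c0 : 0 < (Num.sqrt kap)^-1 by rewrite invr_gt0.
apply: inf_attained.
  exists (mxapp M (tscale (Num.sqrt kap)^-1 u0)).
    split; first by exists (tscale (Num.sqrt kap)^-1 u0).
    rewrite tnorm_sqn mxappZ sqn_tscale -qform_gram u0k exprVn sqr_sqrtr ?(ltW k0)//.
    by rewrite mulVf ?sqrtr1// gt_eqF.
  by rewrite /sdist dot_npole mxappZ tnth_mktuple -lform_lastrow u01 mulr1.
move=> _ [x [[u ->] x1] <-]; rewrite /sdist dot_npole -lform_lastrow.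
have q1 : qform (gram M) u = 1.
  rewrite qform_gram; move: x1; rewrite tnorm_sqn => x1.
  by rewrite -(sqr_sqrtr (sqn_ge0 _)) x1 expr1n.
have := lb u; rewrite q1 => lb1.
have lsq : lform (lastrow M) u ^+ 2 <= ((Num.sqrt kap)^-1) ^+ 2.
  by rewrite exprVn sqr_sqrtr ?(ltW k0)// -[X in _ <= X]div1r ler_pdivlMr// mulrC.
have labs : `|lform (lastrow M) u| <= (Num.sqrt kap)^-1.
  by rewrite -(@ler_pXn2r _ 2)// ?nnegrE ?(ltW c0)// real_normK ?num_real.
move: labs; rewrite ler_norml => /andP[l1 l2].
apply: acos_anti => //; lra.
Qed.

Lemma sin_weight (kap g : R) : 1 <= kap ->
  sin (acos (Num.sqrt kap)^-1) `^ g = ((kap - 1) / kap) `^ (g / 2).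
Proof.
move=> k1; have k0 : 0 < kap by lra.
have sk1 : 1 <= Num.sqrt kap by exact: sqrt_ge1.
have sk0 : 0 < Num.sqrt kap by lra.
have c1 : (Num.sqrt kap)^-1 <= 1 by rewrite invf_le1.
have c0 : 0 < (Num.sqrt kap)^-1 by rewrite invr_gt0.
rewrite sin_acos; last by apply/andP; split; lra.
rewrite exprVn sqr_sqrtr ?(ltW k0)//.
have -> : 1 - kap^-1 = (kap - 1) / kap by field; rewrite gt_eqF.
rewrite -powR12_sqrt; last by rewrite divr_ge0//; lra.
by rewrite -powRrM; congr powR; rewrite mulrC.
Qed.

Lemma cos_weight (kap g : R) : 1 <= kap ->
  cos (acos (Num.sqrt kap)^-1) `^ g = kap `^ (- (g / 2)).
Proof.
move=> k1; have k0 : 0 < kap by lra.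
have sk1 : 1 <= Num.sqrt kap by exact: sqrt_ge1.
have sk0 : 0 < Num.sqrt kap by lra.
have c1 : (Num.sqrt kap)^-1 <= 1 by rewrite invf_le1.
have c0 : 0 < (Num.sqrt kap)^-1 by rewrite invr_gt0.
rewrite acosK; last by rewrite in_itv/=; apply/andP; split; lra.
rewrite -powR12_sqrt ?(ltW k0)// -powRN -powRrM; congr powR; by field.
Qed.

(** Generic matrices: the bottom-right entry is the one that [lastsub] divides by. By [tint_last0]
    it vanishes only on a null set. *)
Definition goodM n k (M : k.+1.-tuple (n.+1.-tuple R)) :=
  gram_det M != 0 /\ lastrow M ord_max != 0.

Local Open Scope ereal_scope.

Lemma Rk_coneF n k (F : R -> R) (M : k.+1.-tuple (n.+1.-tuple R)) :
  Rk (even_radial F) M = ((k.+1)%:R * Num.sqrt (gram_det M))%:E *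
    rint (fun u => coneF (EFin \o F) (qform (gram M) u) (lform (lastrow M) u)).
Proof.
rewrite /Rk; congr (_ * _); apply: eq_rint => u /=.
rewrite tnorm_cond /coneF qform_gram; case: ifP => // _.
by rewrite /= /even_radial normalized_last lform_lastrow.
Qed.

Lemma le_abs_Rk n k (F : R -> R) (M : k.+1.-tuple (n.+1.-tuple R)) :
  measurable_fun [set: R] F ->
  `|Rk (even_radial F) M| <= Rk (even_radial (fun t => `|F t|%R)) M.
Proof.
move=> mF; rewrite !Rk_coneF abseM [X in X * _ <= _]gee0_abs; last first.
  by rewrite lee_fin mulr_ge0 ?sqrtr_ge0.
apply: lee_wpmul2l; first by rewrite lee_fin mulr_ge0 ?sqrtr_ge0.
have mc : measurable_fun [set: R * R] (fun z => coneF (EFin \o F) z.1 z.2).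
  by apply: measurable_coneF; exact/measurable_EFinP.
apply: le_trans (le_abse_rint _) _.
  exact: (measurable_comp2 mc (measurable_qform _) (measurable_lform _)).
apply: le_rint => u //.
by rewrite /coneF; case: ifP => // _; rewrite abse0.
Qed.

Lemma Rk_formula n k : (0 < k)%N -> exists2 A : R, (0 < A)%R &
  forall M : k.+1.-tuple (n.+1.-tuple R), goodM M ->
  exists kap : R, [/\ (1 <= kap)%R /\ dist_pole M = acos (Num.sqrt kap)^-1%R, in_Xi M,
    (forall u, kap * lform (lastrow M) u ^+ 2 <= qform (gram M) u)%R,
    (exists u, lform (lastrow M) u = 1%R /\ qform (gram M) u = kap) &
    forall F : R -> R, measurable_fun [set: R] F -> (forall t, 0 <= F t)%R ->
    Rk (even_radial F) M = (A * Num.sqrt kap)%:E * \int[mu]_y (if (kap < y)%R then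
     y `^ (- (k%:R / 2 + 2^-1)) * (y - kap) `^ (k%:R / 2 - 1) * F (Num.sqrt y)^-1 else 0)%R%:E].
Proof.
move=> k0; have [A A0 HA] := @rint_cone_quadratic R k k0.
exists ((k.+1)%:R * A)%R; first by rewrite mulr_gt0.
move=> M [dM lM].
have [kap [kap0 lb ex H]] := HA _ _ (gram_sym M) (gram_posdef dM) lM.
have [k1 dE] := dist_pole_acos kap0 lb ex.
exists kap; split=> //.
  rewrite /in_Xi dM dE /= acos_lt_pihalf// invr_gt0 sqrtr_gt0 kap0/=.
  by rewrite invf_le1 ?sqrtr_gt0// sqrt_ge1.
move=> F mF F0; rewrite Rk_coneF EFinM -muleA.
rewrite (H (EFin \o F)); last 2 first.
- exact/measurable_EFinP.
- by move=> t; rewrite lee_fin.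
rewrite muleA -EFinM mulrA; congr (_ * _); apply: eq_integral => y _.
by case: ifP.
Qed.

Lemma sqn_qform1 m (u : m.-tuple R) : qform 1%:M%R u = sqn u.
Proof.
rewrite /qform /sqn; apply: eq_bigr => i _.
rewrite (bigD1 i)//= mxE eqxx mul1r big1 ?addr0 ?expr2// => j j0.
by rewrite mxE eq_sym (negbTE j0) mul0r.
Qed.

(** The same cone formula, now for the identity form and the last coordinate, where [kap = 1]; the
    weights are absorbed into [psi]. *)
Lemma wLp_formula n (a1 a2 p : R) : (0 < n)%N -> exists2 A : R, (0 < A)%R &
  forall F : R -> R, measurable_fun [set: R] F ->
  wLp_pow a1 a2 p (@even_radial R n F) = A%:E * \int[mu]_y (if (1 < y)%R then
    `|F (Num.sqrt y)^-1| `^ p * wt ((a1 + n%:R) / 2 - 1) ((1 + a2) / 2) y else 0)%R%:E.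
Proof.
move=> n0; have [A A0 HA] := @rint_cone_quadratic R n n0.
exists ((n.+1)%:R * A)%R; first by rewrite mulr_gt0.
pose l : 'I_n.+1 -> R := fun i => (i == ord_max)%:R%R.
have lE u : lform l u = tnth u ord_max.
  rewrite /lform (bigD1 ord_max)//= /l eqxx mul1r big1 ?addr0// => i i0.
  by rewrite (negbTE i0) mul0r.
have p1 : posdef (1%:M%R : 'M[R]_n.+1).
  move=> u [i ui]; rewrite sqn_qform1 (lt_le_trans _ (sqr_le_sqn u i))//.
  by rewrite exprn_even_gt0.
have [kap [kap0 lb [u0 [u01 u0k]] H]] : exists kap : R, [/\ (0 < kap)%R,
    (forall u, kap * lform l u ^+ 2 <= qform 1%:M%R u)%R,
    (exists u, lform l u = 1%R /\ qform 1%:M%R u = kap) &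
    forall psi, measurable_fun [set: R] psi -> (forall t, 0 <= psi t) ->
    (Num.sqrt (\det (1%:M%R : 'M[R]_n.+1)))%:E * rint (fun u => coneF psi (qform 1%:M%R u) (lform l u)) =
    (A * Num.sqrt kap)%:E * \int[mu]_y (if (kap < y)%R then
     (y `^ (- (n%:R / 2 + 2^-1)) * (y - kap) `^ (n%:R / 2 - 1))%:E * psi (Num.sqrt y)^-1%R else 0)].
  by apply: HA => //; [rewrite trmx1|rewrite /l eqxx oner_eq0].
(* The pole itself gives [kap <= 1]; the minimizer [u0] has last coordinate 1 and hence norm at
   least 1. *)
have kap1 : kap = 1%R.
  apply/le_anti/andP; split.
    have := lb [tuple (i == ord_max)%:R%R | i < n.+1].
    rewrite lE sqn_qform1 tnth_mktuple eqxx expr1n mulr1 => /le_trans; apply.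
    rewrite /sqn (bigD1 ord_max)//= tnth_mktuple eqxx expr1n big1 ?addr0// => i i0.
    by rewrite tnth_mktuple (negbTE i0) expr0n.
  rewrite -u0k sqn_qform1 (le_trans _ (sqr_le_sqn _ ord_max))// -lE u01.
  by rewrite expr1n.
move=> F mF.
pose psi (t : R) : \bar R := (`|F t| `^ p * Num.sqrt (1 - t ^+ 2) `^ a1 * `|t| `^ a2)%R%:E.
have mpsi : measurable_fun [set: R] psi by rewrite /psi; mfun.
have psi0 t : 0 <= psi t by rewrite lee_fin !mulr_ge0 ?powR_ge0.
have := H psi mpsi psi0; rewrite det1 sqrtr1 mul1e kap1 sqrtr1 mulr1 => {}H.
rewrite /wLp_pow /sphere_int.
transitivity ((n.+1)%:R%:E * rint (fun u => coneF psi (qform 1%:M%R u) (lform l u))).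
  apply: congr1; apply: eq_rint => x.
  rewrite tnorm_cond /coneF sqn_qform1 lE; case: ifP => // /andP[x0 x1].
  rewrite /sdist dot_npole /even_radial normalized_last /psi.
  set v := tnth (tscale _ _) _.
  have vabs : (`|v| = `|tnth x ord_max| / Num.sqrt (sqn x))%R by rewrite -normalized_last.
  have v1 : (`|v| <= 1)%R.
    rewrite vabs ler_pdivrMr ?sqrtr_gt0// mul1r -[X in (X <= _)%R]sqrtr_sqr ler_sqrt ?sqn_ge0//.
    exact: sqr_le_sqn.
  have v2 : (-1 <= v <= 1)%R by rewrite -ler_norml.
  rewrite sin_acos// acosK ?in_itv//= -vabs real_normK ?num_real// normr_id.
  by [].
rewrite H muleA -EFinM; congr (_ * _); apply: eq_integral => y _.
case: ifPn => // y1; have y0 : (0 < y)%R by lra.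
have sy0 : (0 < Num.sqrt y)%R by rewrite sqrtr_gt0.
rewrite /psi -EFinM; congr EFin.
rewrite exprVn sqr_sqrtr ?(ltW y0)//.
have -> : (1 - y^-1 = (y - 1) / y)%R by field; rewrite gt_eqF.
rewrite [`|(Num.sqrt y)^-1|%R]ger0_norm ?invr_ge0 ?sqrtr_ge0//.
rewrite -!powR12_sqrt ?divr_ge0 ?(ltW y0)//; last by lra.
rewrite -powRN -!powRrM powRM ?invr_ge0 ?(ltW y0)//; last by lra.
rewrite -[y^-1%R]powR_inv1 ?(ltW y0)// -powRrM /wt.
set P := (`|F _| `^ p)%R.
transitivity (P * ((y `^ (- (n%:R / 2 + 2^-1)) * y `^ (- 1 * (2^-1 * a1)) * y `^ (- 2^-1 * a2)) *
  ((y - 1) `^ (n%:R / 2 - 1) * (y - 1) `^ (2^-1 * a1))))%R; first by ring.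
have y10 : (0 < y - 1)%R by lra.
by rewrite -!powRD_gt0//; congr (_ * (_ `^ _ * _ `^ _))%R; field.
Qed.

(** Both conclusions share one induction, since comparing outer integrals needs nonnegative inner
    ones. *)
Lemma le_tint (T : Type) (I : (T -> \bar R) -> \bar R) m (f g : m.-tuple T -> \bar R) :
  (forall f, (forall t, 0 <= f t) -> 0 <= I f) ->
  (forall f g, (forall t, 0 <= f t) -> (forall t, f t <= g t) -> I f <= I g) ->
  (forall x, 0 <= f x) -> (forall x, f x <= g x) -> 0 <= tint I f /\ tint I f <= tint I g.
Proof.
move=> I0 Ile; elim: m f g => [|m IH] f g f0 fg /=; first by split.
split; first by apply: I0 => t; apply: (proj1 (IH _ _ _ (fun=> lexx _))).
apply: Ile => t; first by apply: (proj1 (IH _ _ _ (fun=> lexx _))).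
exact: (proj2 (IH _ _ _ _)).
Qed.

Lemma rint_cst0 m : rint (fun _ : m.-tuple R => 0 : \bar R) = 0.
Proof.
elim: m => [//|m IH]; rewrite rintS; apply: integral0_eq => t _; exact: IH.
Qed.

Lemma rint_last0 m : rint (fun x : m.+1.-tuple R => ((tnth x ord_max == 0)%:R%R : R)%:E) = 0.
Proof.
elim: m => [|m IH]; rewrite rintS.
  apply: (@integral_supp1 _ 0%R) => t t0; rewrite /rint/=.
  by rewrite (_ : tnth _ _ = t) ?(negbTE t0)//.
apply: integral0_eq => t _; rewrite -[RHS]IH; apply: eq_rint => x.
by rewrite ord_maxS tnth_consS.
Qed.

Lemma tint_last0 n k :
  tint (@rint R n.+1) (fun M : k.+1.-tuple (n.+1.-tuple R) => ((lastrow M ord_max == 0)%:R%R : R)%:E) = 0.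
Proof.
elim: k => [|k IH].
  rewrite -[RHS](rint_last0 n); apply: eq_rint => x; by rewrite /lastrow (_ : tnth [tuple x] _ = x).
transitivity (rint (fun x : n.+1.-tuple R => tint (@rint R n.+1)
    (fun M : k.+1.-tuple (n.+1.-tuple R) => ((lastrow [tuple of x :: M] ord_max == 0)%:R%R : R)%:E))) => //.
rewrite -[RHS](rint_cst0 n.+1); apply: eq_rint => x; rewrite -[RHS]IH.
congr tint; apply/funext => M; by rewrite /lastrow ord_maxS tnthS.
Qed.

(** The exceptional set lies in the null set of matrices with zero bottom-right entry; its indicator
    is dominated, so its own measurability does not enter. *)
Lemma esssup_le n k (h : k.+1.-tuple (n.+1.-tuple R) -> \bar R) (B : \bar R) :
  (forall M, lastrow M ord_max != 0%R -> h M <= B) ->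
  esssup (@tint R _ (@rint R n.+1) k.+1) h <= B.
Proof.
move=> hB; apply: ereal_inf_lbound.
pose f (M : k.+1.-tuple (n.+1.-tuple R)) : \bar R := (\1_[set y | (B < h y)%E] M)%:E.
rewrite -[_ _]/(tint (@rint R n.+1) f = 0).
have f0 M : 0 <= f M by rewrite /f lee_fin indicE.
have fle M : f M <= ((lastrow M ord_max == 0)%:R%R : R)%:E.
  rewrite lee_fin indicE ler_nat.
  case: (eqVneq (lastrow M ord_max) 0%R) => [_|l0]; first by case: (_ \in _).
  by rewrite memNset//= => /lt_geF; rewrite hB.
have [h0 h1] := le_tint (@rint_ge0 _ _) (@le_rint _ _) f0 fle.
by apply/le_anti; rewrite h0 andbT -[X in _ <= X](tint_last0 n k).
Qed.

End Geometry.

(** * Boxes of matrices on which [kap] lies in a prescribed interval *)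

Section Box.
Context {R : realType}.

Definition boxM n k (M0 M : k.+1.-tuple (n.+1.-tuple R)) (del : R) :=
  [forall j, [forall i, `|tnth (tnth M j) i - tnth (tnth M0 j) i| <= del]].

(** The box has positive volume, so no [c < L] is an essential upper bound. *)
Lemma esssup_ge n k (h : k.+1.-tuple (n.+1.-tuple R) -> \bar R) (L : \bar R) M0 del :
  0 < del -> (forall M, boxM M0 M del -> L <= h M)%E ->
  (L <= esssup (@tint R _ (@rint R n.+1) k.+1) h)%E.
Proof.
move=> d0 hL; apply: le_ereal_inf_tmp => c /= Ic; rewrite leNgt; apply/negP => cL.
pose f (M : k.+1.-tuple (n.+1.-tuple R)) : \bar R := (if boxM M0 M del then 1 else 0 : R)%:E.
have f0 M : (0 <= f M)%E by rewrite /f lee_fin; case: ifP.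
have fle M : (f M <= (\1_[set y | (c < h y)%E] M)%:E)%E.
  rewrite lee_fin indicE; case: ifPn => // bM.
  by rewrite mem_set//=; exact: lt_le_trans cL (hL _ bM).
have [_] := le_tint (@rint_ge0 _ _) (@le_rint _ _) f0 fle.
have -> : tint (@rint R n.+1) f = ((((2 * del) ^+ n.+1) ^+ k.+1) * 1)%:E.
  apply: (@tint_box R _ (@rint R n.+1) (fun c t => [forall i, `|tnth t i - tnth c i| <= del])) => //.
    by rewrite exprn_ge0// mulr_ge0// ltW.
  by move=> c' a a0; exact: rint_ball.
have {}Ic : tint (@rint R n.+1) (fun M => (\1_[set y | (c < h y)%E] M)%:E) = 0%E by exact: Ic.
rewrite Ic.
by rewrite lee_fin leNgt mulr1 !exprn_gt0// mulr_gt0.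
Qed.

(** Columns [e_0, ..., e_(k-1)] and [s e_k + c e_n]: orthonormal if [s^2 + c^2 = 1] and [k < n],
    with last row [(0, ..., 0, c)], so that its [kap] is [c^-2]. *)
Definition modelM n k (c s : R) : k.+1.-tuple (n.+1.-tuple R) :=
  [tuple [tuple (if (j < k)%N then ((i : nat) == j)%:R
      else if (i : nat) == n then c else if (i : nat) == k then s else 0) | i < n.+1] | j < k.+1].

Lemma modelME n k c s (j : 'I_k.+1) (i : 'I_n.+1) : tnth (tnth (modelM n k c s) j) i =
  if (j < k)%N then ((i : nat) == j)%:R else if (i : nat) == n then c else if (i : nat) == k then s else 0.
Proof. by rewrite !tnth_mktuple. Qed.

Lemma gram_modelM n k c s : (k < n)%N -> s ^+ 2 + c ^+ 2 = 1 -> gram (modelM n k c s) = 1%:M.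
Proof.
move=> kn sc; apply/matrixP => a b; rewrite !mxE /dot.
have kn1 : (k < n.+1)%N by rewrite ltnS ltnW.
have small : forall a b : 'I_k.+1, (a < k)%N ->
    \sum_i tnth (tnth (modelM n k c s) a) i * tnth (tnth (modelM n k c s) b) i = (a == b)%:R.
  move=> {}a {}b ak; have an : (a < n.+1)%N by exact: leq_trans (ltn_ord a) _.
  rewrite (bigD1 (Ordinal an))//= !modelME ak /= eqxx mul1r big1 ?addr0; last first.
    move=> i ia; rewrite modelME ak (_ : ((i : nat) == a) = false) ?mul0r//.
    by apply: contraNF ia => /eqP ia; apply/eqP/val_inj.
  case: ifPn => bk; first by [].
  have bk' : (b : nat) = k by apply/eqP; rewrite eqn_leq -ltnS ltn_ord leqNgt bk.
  rewrite !ltn_eqF ?(ltn_trans ak kn)//=.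
  by rewrite (_ : (a == b) = false)//; apply/negbTE; rewrite -val_eqE /= bk' ltn_eqF.
have [ak|ak] := boolP (a < k)%N; first exact: small.
have [bk|bk] := boolP (b < k)%N.
  rewrite eq_sym -(small b a bk); apply: eq_bigr => i _; exact: mulrC.
have ka : (a : nat) = k by apply/eqP; rewrite eqn_leq -ltnS ltn_ord leqNgt ak.
have kb : (b : nat) = k by apply/eqP; rewrite eqn_leq -ltnS ltn_ord leqNgt bk.
have -> : (a == b) by apply/eqP/val_inj; rewrite /= ka kb.
rewrite (bigD1 ord_max)//= (bigD1 (Ordinal kn1))//=; last first.
  by rewrite -val_eqE /= ltn_eqF.
rewrite !modelME (negbTE ak) (negbTE bk) /= !eqxx (ltn_eqF kn) big1 ?addr0; last first.
  move=> i /andP[i1 i2]; rewrite modelME (negbTE ak).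
  rewrite (_ : ((i : nat) == n) = false); last first.
    by apply: contraNF i1 => /eqP h; apply/eqP/val_inj.
  rewrite (_ : ((i : nat) == k) = false) ?mul0r//.
  by apply: contraNF i2 => /eqP h; apply/eqP/val_inj.
by rewrite -!expr2 addrC sc.
Qed.

Lemma modelM_le1 n k c s (j : 'I_k.+1) (i : 'I_n.+1) : 0 <= c <= 1 -> 0 <= s <= 1 ->
  `|tnth (tnth (modelM n k c s) j) i| <= 1.
Proof.
move=> /andP[c0 c1] /andP[s0 s1]; rewrite modelME.
case: ifP => _; first by case: eqP => _; rewrite ?normr1 ?normr0.
by do 2 (case: ifP => _; first by rewrite ger0_norm); rewrite normr0.
Qed.

Lemma abs_le_sqrt_sqn m (u : m.-tuple R) i : `|tnth u i| <= Num.sqrt (sqn u).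
Proof. by rewrite -sqrtr_sqr ler_wsqrtr// sqr_le_sqn. Qed.

Section Perturbation.
Variables (n k : nat) (c s del : R) (M : k.+1.-tuple (n.+1.-tuple R)).
Hypothesis kn : (k < n)%N.
Hypothesis sc : s ^+ 2 + c ^+ 2 = 1.
Hypothesis c01 : 0 <= c <= 1.
Hypothesis s01 : 0 <= s <= 1.
Hypothesis del1 : 0 <= del <= 1.
Hypothesis bM : boxM (modelM n k c s) M del.

Let ent j i : `|tnth (tnth M j) i - tnth (tnth (modelM n k c s) j) i| <= del.
Proof. by move: bM => /forallP/(_ j)/forallP/(_ i). Qed.

(** The difference of the two products splits into three terms, each at most [del] because the model
    entries and [del] are at most 1; this happens in each of the [n.+1] coordinates. *)
Lemma gram_pert i j : `|gram M i j - (i == j)%:R| <= 3 * n.+1%:R * del.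
Proof.
have -> : (i == j)%:R = gram (modelM n k c s) i j by rewrite gram_modelM// mxE.
rewrite !mxE /dot -sumrB (le_trans (ler_norm_sum _ _ _))//.
have -> : 3 * n.+1%:R * del = \sum_(l < n.+1) 3 * del.
  by rewrite sumr_const card_ord -mulr_natr; ring.
apply: ler_sum => l _.
set a := tnth (tnth M i) l; set b := tnth (tnth M j) l.
set a0 := tnth (tnth (modelM n k c s) i) l; set b0 := tnth (tnth (modelM n k c s) j) l.
have ha : `|a - a0| <= del by exact: ent.
have hb : `|b - b0| <= del by exact: ent.
have ha0 : `|a0| <= 1 by exact: modelM_le1.
have hb0 : `|b0| <= 1 by exact: modelM_le1.
have /andP[d0 d1] := del1.
have -> : a * b - a0 * b0 = (a - a0) * (b - b0) + (a - a0) * b0 + a0 * (b - b0) by ring.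
apply: le_trans (ler_normD _ _) _; apply: le_trans (lerD (ler_normD _ _) (lexx _)) _.
rewrite !normrM.
have := normr_ge0 (a - a0); have := normr_ge0 (b - b0); have := normr_ge0 a0; have := normr_ge0 b0.
nra.
Qed.

Lemma qform_pert u : `|qform (gram M) u - sqn u| <= 3 * n.+1%:R * k.+1%:R ^+ 2 * del * sqn u.
Proof.
rewrite -[in X in `|_ - X|](sqn_qform1 u) /qform -sumrB.
under eq_bigr do rewrite -sumrB.
apply: le_trans (ler_norm_sum _ _ _) _.
have -> : 3 * n.+1%:R * k.+1%:R ^+ 2 * del * sqn u =
  \sum_(i < k.+1) \sum_(j < k.+1) (3 * n.+1%:R * del) * sqn u.
  rewrite !sumr_const !card_ord -[X in _ = X *+ _]mulr_natr -[RHS]mulr_natr.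
  by move: (n.+1%:R : R) (k.+1%:R : R) (sqn u) => a b d; ring.
apply: ler_sum => i _; apply: le_trans (ler_norm_sum _ _ _) _; apply: ler_sum => j _.
rewrite -mulrBl normrM ler_pM// ?[1%:M _ _]mxE ?gram_pert//.
rewrite normrM -[leRHS](sqr_sqrtr (sqn_ge0 u)) expr2.
by rewrite ler_pM// abs_le_sqrt_sqn.
Qed.

Lemma lform_pert u : `|lform (lastrow M) u - c * lastc u| <= k.+1%:R * del * Num.sqrt (sqn u).
Proof.
have -> : c * lastc u = lform (lastrow (modelM n k c s)) u.
  rewrite /lform (bigD1 ord_max)//= /lastrow modelME /= ltnn eqxx big1 ?addr0// => j j0.
  have jk : (j < k)%N.
    by rewrite ltn_neqAle -ltnS ltn_ord andbT; apply: contraNneq j0 => h; apply/eqP/val_inj.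
  by rewrite modelME jk (_ : (_ == _) = false) ?mul0r//= gtn_eqF// (ltn_trans jk kn).
rewrite /lform -sumrB (le_trans (ler_norm_sum _ _ _))//.
have -> : k.+1%:R * del * Num.sqrt (sqn u) = \sum_(j < k.+1) del * Num.sqrt (sqn u).
  by rewrite sumr_const card_ord -mulr_natr; ring.
apply: ler_sum => j _; rewrite -mulrBl normrM ler_pM// ?abs_le_sqrt_sqn//.
exact: ent.
Qed.

End Perturbation.

Lemma sqn_gt0 m (u : m.-tuple R) i : tnth u i != 0 -> 0 < sqn u.
Proof. by move=> ui; rewrite (lt_le_trans _ (sqr_le_sqn u i))// exprn_even_gt0. Qed.

(** [c^-2] is the midpoint of [k1] and [k2], and [x] is a margin for the perturbation. The bounds
    [x1], [x2] come from [(c + x)^2 <= c^2 + 3x] and [(c - x)^2 >= c^2 - 2x]; one more unit in each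
    denominator makes the results strict. *)
Lemma box_radius (k1 k2 : R) : 1 <= k1 -> k1 < k2 -> exists c s x : R,
  [/\ 0 < c < 1, 0 <= s <= 1, s ^+ 2 + c ^+ 2 = 1 & 0 < x <= c / 2] /\
  (k1 * (c + x) ^+ 2 < 1 - x /\ 1 + x < k2 * (c - x) ^+ 2).
Proof.
move=> k11 k12.
have ksum : 0 < k1 + k2 by lra.
pose c2 := 2 / (k1 + k2).
have c20 : 0 < c2 by rewrite divr_gt0.
have c21 : c2 < 1 by rewrite ltr_pdivrMr//; lra.
have kc1 : k1 * c2 < 1 by rewrite mulrA ltr_pdivrMr//; lra.
have kc2 : 1 < k2 * c2 by rewrite mulrA ltr_pdivlMr//; lra.
pose c := Num.sqrt c2.
have cc : c ^+ 2 = c2 by rewrite sqr_sqrtr// ltW.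
have c0 : 0 < c by rewrite sqrtr_gt0.
have c1 : c < 1 by rewrite -(@ltr_pXn2r _ 2)// ?nnegrE ?(ltW c0)// cc expr1n.
pose s := Num.sqrt (1 - c2).
have ss : s ^+ 2 = 1 - c2 by rewrite sqr_sqrtr//; lra.
have s0 : 0 <= s by exact: sqrtr_ge0.
have s1 : s <= 1 by rewrite -(@ler_pXn2r _ 2)// ?nnegrE// ss expr1n; lra.
have sc : s ^+ 2 + c ^+ 2 = 1 by rewrite ss cc; ring.
pose x1 := (1 - k1 * c2) / (3 * k1 + 2).
pose x2 := (k2 * c2 - 1) / (2 * k2 + 2).
have x10 : 0 < x1 by rewrite divr_gt0; lra.
have x20 : 0 < x2 by rewrite divr_gt0; lra.
have [x [x0 xx1 xx2 xc]] : exists x, [/\ 0 < x, x <= x1, x <= x2 & x <= c / 2].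
  exists (Num.min x1 (Num.min x2 (c / 2))); split.
  - by rewrite !lt_min x10 x20 divr_gt0.
  - by rewrite ge_min lexx.
  - by rewrite !ge_min lexx orbT.
  - by rewrite !ge_min lexx !orbT.
have e1 : (c + x) ^+ 2 <= c2 + 3 * x by rewrite -cc; clear -x0 xc c0 c1; nra.
have e2 : c2 - 2 * x <= (c - x) ^+ 2 by rewrite -cc; clear -x0 xc c0 c1; nra.
exists c, s, x; split; first by split=> //; apply/andP; split.
split.
  have h : x * (3 * k1 + 2) <= 1 - k1 * c2 by rewrite -ler_pdivlMr//; clear -k11; lra.
  clear -h e1 k11 x0; nra.
have h : x * (2 * k2 + 2) <= k2 * c2 - 1 by rewrite -ler_pdivlMr//; clear -k11 k12; lra.
clear -h e2 k11 k12 x0; nra.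
Qed.

(** Near [modelM] the Gram form is the squared norm up to the factors [1 - x] and [1 + x], and the
    last row is close to [(0, ..., 0, c)]. The minimum [kap] is then squeezed between the two bounds
    of [box_radius]. *)
Lemma box_exists n k (k1 k2 : R) : (k < n)%N -> 1 <= k1 -> k1 < k2 ->
  exists (M0 : k.+1.-tuple (n.+1.-tuple R)) (del : R), 0 < del /\ forall M, boxM M0 M del ->
  goodM M /\ forall kap, 0 < kap ->
    (forall u, kap * lform (lastrow M) u ^+ 2 <= qform (gram M) u) ->
    (exists u, lform (lastrow M) u = 1 /\ qform (gram M) u = kap) -> k1 < kap < k2.
Proof.
move=> kn k11 k12.
have [c [s [x [[/andP[c0 c1] s01 sc /andP[x0 xc]] [xk1 xk2]]]]] := box_radius k11 k12.
have x1 : x < 1 by lra.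
have cx : 0 < c - x by lra.
have k20 : 0 < k2 by lra.
pose K : R := 3 * n.+1%:R * k.+1%:R ^+ 2.
have n1 : 1 <= n.+1%:R :> R by rewrite ler1n.
have kk1 : 1 <= k.+1%:R :> R by rewrite ler1n.
have kkK : k.+1%:R <= K.
  by rewrite /K; move: (n.+1%:R : R) (k.+1%:R : R) n1 kk1 => a b a1 b1; nra.
have K1 : 1 <= K by exact: le_trans kkK.
have K0 : 0 < K by exact: lt_le_trans K1.
(* Both perturbation bounds are now at most [x], relative to [sqn u] and to its square root. *)
pose del := x / K.
have d0 : 0 < del by rewrite divr_gt0.
have Kd : K * del = x by rewrite /del mulrCA divff ?mulr1// gt_eqF.
have d1 : del <= 1 by rewrite /del ler_pdivrMr// mul1r (le_trans (ltW x1)).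
have kd : k.+1%:R * del <= x by rewrite -Kd ler_wpM2r// ltW.
have dx : del <= x by rewrite /del ler_pdivrMr// ler_peMr// ltW.
have c01 : 0 <= c <= 1 by rewrite !ltW.
have del1 : 0 <= del <= 1 by rewrite ltW.
exists (modelM n k c s), del; split=> // M bM.
have qp u := qform_pert kn sc c01 s01 del1 bM u.
have lp u := lform_pert kn bM u.
have qlow u : (1 - x) * sqn u <= qform (gram M) u.
  by have := qp u; rewrite -/K Kd ler_distl => /andP[h _]; rewrite mulrBl mul1r.
have qup u : qform (gram M) u <= (1 + x) * sqn u.
  by have := qp u; rewrite -/K Kd ler_distl => /andP[_ h]; rewrite mulrDl mul1r.
have labs u : `|lform (lastrow M) u - c * lastc u| <= x * Num.sqrt (sqn u).
  by apply: le_trans (lp u) _; rewrite ler_wpM2r ?sqrtr_ge0.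
pose e := [tuple (i == ord_max)%:R | i < k.+1] : k.+1.-tuple R.
have el : lastc e = 1 by rewrite /lastc tnth_mktuple eqxx.
have es : sqn e = 1.
  rewrite /sqn (bigD1 ord_max)//= tnth_mktuple eqxx expr1n big1 ?addr0// => i i0.
  by rewrite tnth_mktuple (negbTE i0) expr0n.
have le : c - x <= lform (lastrow M) e.
  by have := labs e; rewrite el es sqrtr1 !mulr1 ler_distl => /andP[h _].
split.
  split.
    apply/negP => /det0P[v v0 vG].
    pose u := [tuple v ord0 i | i < k.+1] : k.+1.-tuple R.
    have : qform (gram M) u = 0.
      rewrite qformE (_ : (colt u)^T = v) ?vG ?mul0mx ?mxE//.
      by apply/matrixP => a b; rewrite !mxE tnth_mktuple (ord1 a).
    have [i vi] : exists i, v ord0 i != 0.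
      apply/existsP; apply: contraNT v0 => /existsPn h.
      by apply/eqP/matrixP => a b; rewrite mxE (ord1 a); apply/eqP; have := h b; rewrite negbK.
    have su : 0 < sqn u by apply: (@sqn_gt0 _ _ i); rewrite tnth_mktuple.
    by have := qlow u => h1 h2; move: h1; rewrite h2 leNgt mulr_gt0// subr_gt0.
  have : lform (lastrow M) e = lastrow M ord_max.
    rewrite /lform (bigD1 ord_max)//= tnth_mktuple eqxx mulr1 big1 ?addr0// => i i0.
    by rewrite tnth_mktuple (negbTE i0) mulr0.
  by move=> <-; rewrite gt_eqF// (lt_le_trans cx).
(* Lower bound at the minimizer [u] of norm [r]: [kap >= (1 - x) r^2], while last-row value 1 forces
   [(c + x) r >= 1]. *)
move=> kap kap0 lb [u [ul uq]]; apply/andP; split.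
  pose r := Num.sqrt (sqn u).
  have r0 : 0 <= r by exact: sqrtr_ge0.
  have rr : r ^+ 2 = sqn u by rewrite sqr_sqrtr// sqn_ge0.
  have h1 := qlow u; rewrite uq -rr in h1.
  have h2 : 1 <= (c + x) * r.
    have := labs u; rewrite ul ler_distl -/r => /andP[_ h].
    have lr : lastc u <= r by apply: le_trans (ler_norm _) (abs_le_sqrt_sqn _ _).
    by clear -h lr c0; nra.
  have r00 : 0 < r by clear -h2 r0 c0 x0; nra.
  have h3 : 1 <= (c + x) ^+ 2 * r ^+ 2 by rewrite -exprMn exprn_ege1.
  have h4 : k1 * ((c + x) ^+ 2 * r ^+ 2) < (1 - x) * r ^+ 2.
    by rewrite mulrA ltr_pM2r// exprn_gt0.
  by clear -h1 h3 h4 k11; nra.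
(* Upper bound by testing the minimality of [kap] on the last unit vector. *)
have h := lb e.
have h1 := qup e; rewrite es mulr1 in h1.
have h2 : (c - x) ^+ 2 <= lform (lastrow M) e ^+ 2.
  by rewrite ler_pXn2r// nnegrE ltW// (lt_le_trans cx).
have h3 : kap * (c - x) ^+ 2 < k2 * (c - x) ^+ 2.
  apply: le_lt_trans xk2; apply: le_trans h1; apply: le_trans h.
  by rewrite ler_wpM2l// ltW.
by move: h3; rewrite ltr_pM2r// exprn_gt0.
Qed.

End Box.

(** * Equivalence of the inequality with its one-dimensional form *)

Section Inequality.
Context {R : realType}.
Local Notation mu := (@lebesgue_measure R).
Local Open Scope ereal_scope.

Definition transf (h kap : R) (phi : R -> R) : \bar R :=
  \int[mu]_y (if kap < y then y `^ (- (h + 2^-1)) * (y - kap) `^ (h - 1) * phi y else 0)%R%:E.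
Definition wnorm (b e p : R) (phi : R -> R) : \bar R :=
  \int[mu]_y (if 1 < y then `|phi y| `^ p * wt b e y else 0)%R%:E.
(** The [2^-1] in the exponent of [kap] is the factor [sqrt kap] of [Rk_formula]; [G1] and [G2]
    stand for half of [g1] and [g2]. *)
Definition weight (G1 G2 kap : R) : R :=
  (((kap - 1) / kap) `^ G1 * kap `^ (2^-1 - G2))%R.

Lemma weightE (g1 g2 kap : R) : (1 <= kap)%R ->
  (sin (acos (Num.sqrt kap)^-1) `^ g1 * cos (acos (Num.sqrt kap)^-1) `^ g2 * Num.sqrt kap =
   weight (g1 / 2) (g2 / 2) kap)%R.
Proof.
move=> k1; have k0 : (0 < kap)%R by lra.
rewrite sin_weight// cos_weight// /weight -mulrA -powR12_sqrt ?(ltW k0)// -powRD_gt0//.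
by rewrite [(2^-1 - _)%R]addrC.
Qed.

Lemma weight_mul (g1 g2 kap A : R) (I : \bar R) : (1 <= kap)%R ->
  (sin (acos (Num.sqrt kap)^-1) `^ g1 * cos (acos (Num.sqrt kap)^-1) `^ g2)%:E *
    ((A * Num.sqrt kap)%:E * I) = A%:E * ((weight (g1 / 2) (g2 / 2) kap)%:E * I).
Proof.
by move=> k1; rewrite -weightE// !muleA -!EFinM; congr (_%:E * _); ring.
Qed.

Lemma weight_ge0 G1 G2 kap : (0 <= weight G1 G2 kap)%R.
Proof. by rewrite mulr_ge0 ?powR_ge0. Qed.

Lemma transf_ge0 h kap phi : (forall y, 0 <= phi y)%R -> 0 <= transf h kap phi.
Proof.
by move=> phi0; apply: integral_ge0 => y _; rewrite lee_fin; case: ifP => // _; rewrite !mulr_ge0 ?powR_ge0.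
Qed.

Lemma ineq_star_of_1D n k (a1 a2 g1 g2 p : R) : (0 < k)%N -> (0 < n)%N -> (0 < p)%R ->
  (exists2 C : R, (0 <= C)%R & forall kap (phi : R -> R) (N : R), (1 <= kap)%R -> measurable_fun [set: R] phi ->
     wnorm ((a1 + n%:R) / 2 - 1) ((1 + a2) / 2) p phi = N%:E ->
     (weight (g1 / 2) (g2 / 2) kap)%:E * transf (k%:R / 2) kap (fun y => `|phi y|%R) <= (C * N `^ p^-1)%:E) ->
  ineq_star n k a1 a2 g1 g2 p.
Proof.
move=> k0 n0 p0 [C C0 HC].
have [A A0 HA] := @Rk_formula R n k k0.
have [B B0 HB] := @wLp_formula R n a1 a2 p n0.
exists (A * C / B `^ p^-1)%R => F mF Ffin.
pose phi y := F (Num.sqrt y)^-1%R.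
have mphi : measurable_fun [set: R] phi.
  by apply: (@measurableT_comp _ _ _ _ _ _ F) => //; mfun.
pose I := wnorm ((a1 + n%:R) / 2 - 1) ((1 + a2) / 2) p phi.
have FE : wLp_pow a1 a2 p (@even_radial R n F) = B%:E * I by exact: HB.
have I0 : 0 <= I.
  by apply: integral_ge0 => y _; rewrite lee_fin; case: ifP => // _; rewrite mulr_ge0 ?powR_ge0 ?wt_ge0.
have Ifin : I \is a fin_num.
  rewrite ge0_fin_numE// ltNge leye_eq; apply/negP => /eqP Ioo.
  by move: Ffin; rewrite FE Ioo gt0_muley ?lte_fin.
pose N := fine I.
have NE : I = N%:E by rewrite /N fineK.
have N0 : (0 <= N)%R by rewrite fine_ge0.
have Bp : (0 < B `^ p^-1)%R by rewrite powR_gt0.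
have normE : wLp_norm a1 a2 p (@even_radial R n F) = (B `^ p^-1 * N `^ p^-1)%R.
  by rewrite /wLp_norm FE NE -EFinM /= powRM// ltW.
rewrite normE (_ : (A * C / B `^ p^-1 * (B `^ p^-1 * N `^ p^-1) = A * (C * N `^ p^-1))%R); last first.
  by field; rewrite gt_eqF.
apply: esssup_le => M lM.
have rhs0 : (0 <= A * (C * N `^ p^-1))%R by rewrite !mulr_ge0 ?powR_ge0// ltW.
case: ifPn => [MXi|_]; last by rewrite lee_fin.
have gM : goodM M by split=> //; move: MXi => /andP[].
have [kap [[k1 dE] _ _ _ HRk]] := HA M gM.
rewrite abseM gee0_abs; last by rewrite lee_fin mulr_ge0 ?powR_ge0.
apply: (@le_trans _ _ ((sin (dist_pole M) `^ g1 * cos (dist_pole M) `^ g2)%:E *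
   Rk (even_radial (fun t => `|F t|%R)) M)).
  by apply: lee_wpmul2l; [rewrite lee_fin mulr_ge0 ?powR_ge0|exact: le_abs_Rk].
rewrite HRk//; last by mfun.
rewrite dE weight_mul// [leRHS]EFinM.
apply: lee_wpmul2l; first by rewrite lee_fin ltW.
exact: (HC kap phi N k1 mphi NE).
Qed.

(** The lower bound is asked on an open interval of [kap], because the essential supremum does not
    see a single value. [L] and [N] are mere estimates, so a test function never has to be
    integrated exactly. *)
Definition bound1D (h b e G1 G2 p C : R) :=
  forall k1 k2 (phi : R -> R) (N L : R), (1 <= k1)%R -> (k1 < k2)%R ->
    measurable_fun [set: R] phi -> (forall y, 0 <= phi y)%R -> (0 <= N)%R ->
    wnorm b e p phi <= N%:E ->
    (forall kap, (k1 < kap < k2)%R -> L%:E <= (weight G1 G2 kap)%:E * transf h kap phi) ->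
    (L <= C * N `^ p^-1)%R.

(* The test function is [F t = phi (t^-2)], so that [F (y^(-1/2)) = phi y]. *)
Lemma ineq_star_1D n k (a1 a2 g1 g2 p : R) : (0 < k)%N -> (k < n)%N -> (0 < p)%R ->
  ineq_star n k a1 a2 g1 g2 p ->
  exists C : R, bound1D (k%:R / 2) ((a1 + n%:R) / 2 - 1) ((1 + a2) / 2) (g1 / 2) (g2 / 2) p C.
Proof.
move=> k0 kn p0 [C HC].
have n0 : (0 < n)%N by exact: leq_trans k0 (ltnW kn).
have [A A0 HA] := @Rk_formula R n k k0.
have [B B0 HB] := @wLp_formula R n a1 a2 p n0.
have pV0 : (0 <= p^-1)%R by rewrite invr_ge0 ltW.
(* The constant of [ineq_star] has no prescribed sign; [|C| + 1] is positive, so the norm may be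
   replaced by its upper bound. *)
exists ((`|C| + 1) * B `^ p^-1 / A)%R.
move=> k1 k2 phi N L k11 k12 mphi phi0 N0 HN HL.
pose F t := phi ((t^-1) ^+ 2)%R.
have mF : measurable_fun [set: R] F by rewrite /F; mfun.
have FE y : (0 < y)%R -> F (Num.sqrt y)^-1%R = phi y.
  by move=> y0; rewrite /F invrK sqr_sqrtr// ltW.
have wE : wLp_pow a1 a2 p (@even_radial R n F) = B%:E * wnorm ((a1 + n%:R) / 2 - 1) ((1 + a2) / 2) p phi.
  rewrite (HB F mF) /wnorm; apply: congr1; apply: eq_integral => y _.
  by case: ifPn => // y1; rewrite FE//; lra.
have w0 : 0 <= wnorm ((a1 + n%:R) / 2 - 1) ((1 + a2) / 2) p phi.
  by apply: integral_ge0 => y _; rewrite lee_fin; case: ifP => // _; rewrite mulr_ge0 ?powR_ge0 ?wt_ge0.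
have wfin : wLp_pow a1 a2 p (@even_radial R n F) < +oo.
  by rewrite wE (@le_lt_trans _ _ (B%:E * N%:E)) ?ltry// lee_wpmul2l// lee_fin ltW.
have normle : (wLp_norm a1 a2 p (@even_radial R n F) <= B `^ p^-1 * N `^ p^-1)%R.
  rewrite /wLp_norm wE -powRM ?(ltW B0)//.
  have wf : wnorm ((a1 + n%:R) / 2 - 1) ((1 + a2) / 2) p phi \is a fin_num.
    by rewrite ge0_fin_numE// (le_lt_trans HN)// ltry.
  rewrite fineM// ge0_ler_powR ?nnegrE ?mulr_ge0 ?(ltW B0) ?fine_ge0//.
  by rewrite ler_wpM2l ?(ltW B0)// -lee_fin fineK.
have [M0 [del [d0 box]]] := box_exists kn k11 k12.
have key : (A * L)%:E <= weighted_Rk_sup k g1 g2 (@even_radial R n F).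
  apply: (esssup_ge d0) => M bM; have [gM kM] := box M bM.
  have [kap [[kap1 dE] MXi lb ex HRk]] := HA M gM.
  have kap0 : (0 < kap)%R by lra.
  have kk := kM kap kap0 lb ex.
  rewrite MXi HRk//; last by move=> t; exact: phi0.
  rewrite dE weight_mul//.
  rewrite gee0_abs; last first.
    rewrite mule_ge0 ?mule_ge0 ?lee_fin ?(ltW A0) ?weight_ge0//.
    by apply: transf_ge0 => y; exact: phi0.
  rewrite EFinM; apply: lee_wpmul2l; first by rewrite lee_fin ltW.
  apply: le_trans (HL kap kk) _; apply: lee_wpmul2l; first by rewrite lee_fin weight_ge0.
  rewrite /transf le_eqVlt; apply/orP; left; apply/eqP.
  apply: eq_integral => y _; case: ifP => // ky.
  by rewrite FE//; lra.
have := le_trans key (HC F mF wfin); rewrite lee_fin => AL.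
have nn0 : (0 <= wLp_norm a1 a2 p (@even_radial R n F))%R by exact: powR_ge0.
have h1 : (C * wLp_norm a1 a2 p (@even_radial R n F) <= (`|C| + 1) * (B `^ p^-1 * N `^ p^-1))%R.
  apply: (@le_trans _ _ (`|C| * wLp_norm a1 a2 p (@even_radial R n F))%R).
    by rewrite ler_wpM2r// ler_norm.
  by apply: ler_pM => //; lra.
rewrite [leRHS]mulrAC ler_pdivlMr// mulrC (le_trans AL)// (le_trans h1)// mulrA.
by [].
Qed.

(** * Necessity: test functions and blow-up *)

Lemma powR2_norm_ge1 (z : R) : (1 <= 2 `^ `|z|)%R.
Proof. by rewrite -[X in (X <= _)%R](powRr0 2) ler_powR// ler1n. Qed.

Lemma powR_norm_ge (a x : R) : (4^-1 <= x <= 4)%R -> (4 `^ (- `|a|) <= x `^ a)%R.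
Proof.
by move=> /andP[x1 x2]; have := @powR_comparable_ge R 4 1 x a; rewrite powR1 !mulr1; apply; lra.
Qed.

Lemma powR_norm_le (a x : R) : (4^-1 <= x <= 4)%R -> (x `^ a <= 4 `^ `|a|)%R.
Proof.
by move=> /andP[x1 x2]; have := @powR_comparable R 4 1 x a; rewrite powR1 !mulr1; apply; lra.
Qed.

Lemma powR_big_neg (x K : R) : (x < 0)%R -> (1 < K)%R -> exists2 eps, (0 < eps < 1)%R & (eps `^ x = K)%R.
Proof.
move=> x0 K1; have K0 : (0 < K)%R by lra.
have xV : (x^-1 < 0)%R by rewrite invr_lt0.
exists (K `^ x^-1)%R; last by rewrite -powRrM mulVf ?powRr1 ?(ltW K0)// lt_eqF.
rewrite powR_gt0//=.
rewrite -[X in (X < _)%R](invrK) -powRN invf_lt1 ?powR_gt0//.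
by rewrite /powR gt_eqF// -[X in (X < _)%R]expR0 ltr_expR mulr_gt0 ?oppr_gt0// ln_gt0.
Qed.

Lemma powR_big_pos (x K : R) : (0 < x)%R -> (1 < K)%R -> exists2 eps, (1 <= eps)%R & (eps `^ x = K)%R.
Proof.
move=> x0 K1; have K0 : (0 < K)%R by lra.
exists (K `^ x^-1)%R; last by rewrite -powRrM mulVf ?powRr1 ?(ltW K0)// gt_eqF.
by rewrite -[X in (X <= _)%R](powRr0 K) ler_powR ?invr_ge0 ?ltW.
Qed.

Lemma integral_cst_itv (a b K : R) : (a < b)%R -> (0 <= K)%R ->
  \int[mu]_y (if (a <= y <= b)%R then K else 0%R)%:E = (K * (b - a))%:E.
Proof.
move=> ab K0.
have := @leb_int_ball R ((b - a) / 2) ((a + b) / 2) K; rewrite /leb_int => h.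
transitivity ((2 * ((b - a) / 2) * K)%:E); last by congr EFin; field.
rewrite -h//; last by lra.
apply: eq_integral => y _; congr EFin; congr (if _ then _ else _).
by rewrite ler_distl; congr (_ && _); apply/idP/idP; lra.
Qed.

Lemma transf_ge_itv (h kap a b K : R) : (kap < a)%R -> (a < b)%R -> (0 <= K)%R ->
  (forall y, (a <= y <= b)%R -> K <= y `^ (- (h + 2^-1)) * (y - kap) `^ (h - 1))%R ->
  (K * (b - a))%:E <= transf h kap (fun y => if a <= y <= b then 1 else 0)%R.
Proof.
move=> ka ab K0 H; rewrite -integral_cst_itv//; apply: le_integral_ge0 => y.
  by rewrite lee_fin; case: ifP.
rewrite lee_fin; case: ifPn => [hy|_]; last by rewrite mulr0; case: ifP.
have /andP[y1 y2] := hy; rewrite ifT; last by lra.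
by rewrite mulr1; exact: H.
Qed.

Lemma wnorm_le_itv (b' e p a b K : R) : (1 < a)%R -> (a < b)%R -> (0 < p)%R -> (0 <= K)%R ->
  (forall y, (a <= y <= b)%R -> wt b' e y <= K)%R ->
  wnorm b' e p (fun y => if a <= y <= b then 1 else 0)%R <= (K * (b - a))%:E.
Proof.
move=> a1 ab p0 K0 H; rewrite -integral_cst_itv//; apply: le_integral_ge0 => y.
  by rewrite lee_fin; case: ifP => // _; rewrite mulr_ge0 ?powR_ge0 ?wt_ge0.
rewrite lee_fin; case: (boolP (a <= y <= b)%R) => hy.
  by case: ifP => // _; rewrite normr1 powR1 mul1r; exact: H.
by rewrite normr0 powR0 ?gt_eqF// mul0r; case: ifP.
Qed.

Lemma measurable_itv_ind (a b : R) :
  measurable_fun [set: R] (fun y => if a <= y <= b then 1 else 0 : R)%R.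
Proof. by mfun. Qed.

(* At scale [eps], all of [kap - 1], [y - 1], [y - kap] are comparable to [eps]
   and [kap], [y] to [1 + eps]. *)
Lemma bound1D_scale (h b e G1 G2 p C : R) : (0 < p)%R -> bound1D h b e G1 G2 p C ->
  exists K : R, forall eps, (0 < eps)%R ->
  (eps `^ (G1 + h - (b + 1) / p) * (1 + eps) `^ (- (G1 + h - (b + 1) / p) - (G2 - e / p)) <= K)%R.
Proof.
move=> p0 HC.
pose q (a : R) : R := (4 `^ (- `|a|))%R.
have q0 a : (0 < q a)%R by rewrite powR_gt0.
pose c1 : R := (q G1 * q (2^-1 - G2) * (q (- (h + 2^-1)) * q (h - 1)))%R.
pose c2 : R := (4 `^ `|- (e + b + 1)| * 4 `^ `|b|)%R.
have c10 : (0 < c1)%R by rewrite !mulr_gt0.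
have c20 : (0 <= c2)%R by rewrite mulr_ge0 ?powR_ge0.
exists (C * c2 `^ p^-1 / c1)%R => eps e0.
pose E := (1 + eps)%R; have E0 : (0 < E)%R by rewrite /E; lra.
pose phi (y : R) : R := (if 1 + 3 * eps <= y <= 1 + 4 * eps then 1 else 0)%R.
(* [N] and [L] are the predicted sizes at scale [eps]: [wt] times the interval length, and weight
   times kernel times the interval length. *)
pose N := (c2 * (E `^ (- (e + b + 1)) * eps `^ b) * eps)%R.
pose L := (c1 * ((eps / E) `^ G1 * E `^ (2^-1 - G2)) * (E `^ (- (h + 2^-1)) * eps `^ (h - 1)) * eps)%R.
have N0 : (0 <= N)%R by rewrite !mulr_ge0 ?powR_ge0// ltW.
have four : (1 <= 4 :> R)%R by lra.
have LN : (L <= C * N `^ p^-1)%R.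
  apply: (HC (1 + eps) (1 + 2 * eps) phi)%R => //; [lra|lra|exact: measurable_itv_ind| | |].
  - by move=> y; rewrite /phi; case: ifP.
  - have -> : N = (c2 * (E `^ (- (e + b + 1)) * eps `^ b) * ((1 + 4 * eps) - (1 + 3 * eps)))%R.
      by rewrite /N; ring.
    apply: wnorm_le_itv => //; [lra|lra|by rewrite !mulr_ge0 ?powR_ge0|].
    move=> y /andP[y1 y2]; rewrite /wt /c2.
    rewrite [leRHS](_ : _ = (4 `^ `|- (e + b + 1)| * E `^ (- (e + b + 1))) * (4 `^ `|b| * eps `^ b))%R; last by ring.
    apply: ler_pM; rewrite ?powR_ge0//.
      by apply: powR_comparable => //; rewrite /E; lra.
    by apply: powR_comparable => //; lra.
  move=> kap /andP[kp1 kp2].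
  have kap0 : (0 < kap)%R by lra.
  have X0 : (0 < eps / E)%R by rewrite divr_gt0.
  pose Kt := (q (- (h + 2^-1)) * q (h - 1) * (E `^ (- (h + 2^-1)) * eps `^ (h - 1)))%R.
  have Kt0 : (0 <= Kt)%R by rewrite !mulr_ge0 ?powR_ge0// ltW.
  have T : (Kt * ((1 + 4 * eps) - (1 + 3 * eps)))%:E <= transf h kap phi.
    apply: transf_ge_itv => //; [lra|lra|].
    move=> y /andP[y1 y2]; rewrite /Kt mulrACA; apply: ler_pM; rewrite ?mulr_ge0 ?powR_ge0 ?(ltW (q0 _))//.
      by apply: powR_comparable_ge => //; rewrite /E; lra.
    by apply: powR_comparable_ge => //; lra.
  have W : (q G1 * q (2^-1 - G2) * ((eps / E) `^ G1 * E `^ (2^-1 - G2)) <= weight G1 G2 kap)%R.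
    rewrite /weight mulrACA; apply: ler_pM; rewrite ?mulr_ge0 ?powR_ge0 ?(ltW (q0 _))//.
      apply: powR_comparable_ge => //.
        rewrite mulrA ler_pdivrMr// mulrAC ler_pdivlMr// /E; nra.
      rewrite mulrA ler_pdivrMr// mulrAC ler_pdivlMr// /E; nra.
    by apply: powR_comparable_ge => //; rewrite /E; lra.
  rewrite (_ : L = (q G1 * q (2^-1 - G2) * ((eps / E) `^ G1 * E `^ (2^-1 - G2))) *
     (Kt * ((1 + 4 * eps) - (1 + 3 * eps))))%R; last by rewrite /L /Kt /c1; ring.
  rewrite EFinM; apply: lee_pmul => //; rewrite lee_fin ?mulr_ge0 ?powR_ge0 ?(ltW (q0 _))//; lra.
have LE : L = (c1 * (eps `^ (G1 + h) * E `^ (- G1 - G2 - h)))%R.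
  rewrite /L powRM ?invr_ge0 ?(ltW e0) ?(ltW E0)// -[E^-1%R]powR_inv1 ?(ltW E0)// -powRrM.
  transitivity (c1 * ((eps `^ G1 * eps `^ (h - 1) * eps) *
     (E `^ (- 1 * G1) * E `^ (2^-1 - G2) * E `^ (- (h + 2^-1)))))%R; first by ring.
  rewrite -{3}[eps]powRr1 ?(ltW e0)// -!powRD_gt0//.
  by congr (_ * (_ `^ _ * _ `^ _))%R; field.
have NE : (N `^ p^-1 = c2 `^ p^-1 * (E `^ (- (e + b + 1) / p) * eps `^ ((b + 1) / p)))%R.
  rewrite /N -mulrA powRM ?mulr_ge0 ?powR_ge0 ?(ltW e0)//; congr (_ * _)%R.
  rewrite -mulrA -{2}[eps]powRr1 ?(ltW e0)// -powRD_gt0//.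
  by rewrite powRM ?powR_ge0// -!powRrM.
rewrite ler_pdivlMr// mulrC.
rewrite -(@ler_pM2r _ (E `^ (- (e + b + 1) / p) * eps `^ ((b + 1) / p))%R); last by rewrite mulr_gt0 ?powR_gt0.
apply: (@le_trans _ _ L); last by rewrite (le_trans LN)// NE mulrA.
rewrite LE -[leLHS]mulrA ler_pM2l// le_eqVlt; apply/orP; left; apply/eqP.
transitivity ((eps `^ (G1 + h - (b + 1) / p) * eps `^ ((b + 1) / p)) *
  (E `^ (- (G1 + h - (b + 1) / p) - (G2 - e / p)) * E `^ (- (e + b + 1) / p)))%R; first by rewrite /E; ring.
rewrite -!powRD_gt0//; congr (_ `^ _ * _ `^ _)%R; by field; rewrite gt_eqF.
Qed.

(** As [eps] tends to 0, the power of [1 + eps] stays between positive constants, so the exponent of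
    [eps] cannot be negative. *)
Lemma bound1D_G1_ge (h b e G1 G2 p C : R) : (0 < p)%R -> bound1D h b e G1 G2 p C ->
  ((b + 1) / p - h <= G1)%R.
Proof.
move=> p0 HC; have [K HK] := bound1D_scale p0 HC.
rewrite leNgt; apply/negP => hG.
set x := (G1 + h - (b + 1) / p)%R in HK; set z := (- x - (G2 - e / p))%R in HK.
have x0 : (x < 0)%R by rewrite /x; lra.
(* The factor [2^|z|] makes up for the lower bound [2^(-|z|)] of [(1 + eps)^z], so the product still
   exceeds [K]. *)
have K1 : (1 < (`|K| + 2) * 2 `^ `|z|)%R.
  by rewrite (@lt_le_trans _ _ (`|K| + 2)%R) ?ler_peMr ?powR2_norm_ge1 ?addr_ge0// ltr_wpDl// ltr1n.
have [eps /andP[e0 e1] epsx] := @powR_big_neg x ((`|K| + 2) * 2 `^ `|z|)%R x0 K1.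
have := HK eps e0; rewrite epsx => h1.
have h2 : (2 `^ (- `|z|) * 1 `^ z <= (1 + eps) `^ z)%R by apply: powR_comparable_ge; lra.
rewrite powR1 mulr1 in h2.
have h3 : ((`|K| + 2) * 2 `^ `|z| * 2 `^ (- `|z|) <= K)%R.
  apply: le_trans h1; rewrite ler_wpM2l// mulr_ge0 ?powR_ge0//; have := normr_ge0 K; lra.
rewrite -mulrA -powRD_gt0// subrr powRr0 mulr1 in h3.
by have := ler_norm K; lra.
Qed.

(** As [eps] tends to infinity, [1 + eps] is comparable to [eps]. The exponents add up to
    [x + z = e/p - G2], which cannot be positive. *)
Lemma bound1D_G2_ge (h b e G1 G2 p C : R) : (0 < p)%R -> bound1D h b e G1 G2 p C -> (e / p <= G2)%R.
Proof.
move=> p0 HC; have [K HK] := bound1D_scale p0 HC.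
rewrite leNgt; apply/negP => hG.
set x := (G1 + h - (b + 1) / p)%R in HK; set z := (- x - (G2 - e / p))%R in HK.
have x0 : (0 < x + z)%R by rewrite /z; lra.
have K1 : (1 < (`|K| + 2) * 2 `^ `|z|)%R.
  by rewrite (@lt_le_trans _ _ (`|K| + 2)%R) ?ler_peMr ?powR2_norm_ge1 ?addr_ge0// ltr_wpDl// ltr1n.
have [eps e1 epsx] := @powR_big_pos (x + z) ((`|K| + 2) * 2 `^ `|z|)%R x0 K1.
have e0 : (0 < eps)%R by lra.
have h1 := HK eps e0.
have h2 : (2 `^ (- `|z|) * eps `^ z <= (1 + eps) `^ z)%R by apply: powR_comparable_ge; lra.
have h3 : ((`|K| + 2) * 2 `^ `|z| * 2 `^ (- `|z|) <= K)%R.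
  apply: le_trans h1; rewrite -epsx powRD_gt0// -mulrA ler_wpM2l ?powR_ge0// mulrC; exact: h2.
rewrite -mulrA -powRD_gt0// subrr powRr0 mulr1 in h3.
by have := ler_norm K; lra.
Qed.

(** The support [[3, 4]] stays away from [kap], so transform and norm are comparable to constants
    and only [((kap - 1)/kap)^G1] is left to blow up. *)
Lemma bound1D_G1_ge0 (h b e G1 G2 p C : R) : (0 < p)%R -> bound1D h b e G1 G2 p C -> (0 <= G1)%R.
Proof.
move=> p0 HC; rewrite leNgt; apply/negP => hG.
have four : (1 <= 4 :> R)%R by lra.
pose q (a : R) : R := (4 `^ (- `|a|))%R.
have q0 a : (0 < q a)%R by rewrite powR_gt0.
pose c1 : R := (q G1 * q (2^-1 - G2) * (q (- (h + 2^-1)) * q (h - 1)))%R.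
pose c2 : R := (4 `^ `|- (e + b + 1)| * 4 `^ `|b|)%R.
have c10 : (0 < c1)%R by rewrite !mulr_gt0.
have c20 : (0 <= c2)%R by rewrite mulr_ge0 ?powR_ge0.
have key eps : (0 < eps)%R -> (eps <= 1 / 2)%R -> (c1 * eps `^ G1 <= C * c2 `^ p^-1)%R.
  move=> e0 e1.
  pose phi (y : R) : R := (if 3 <= y <= 4 then 1 else 0)%R.
  apply: (HC (1 + eps) (1 + 2 * eps) phi)%R => //; [lra|lra|exact: measurable_itv_ind| | |].
  - by move=> y; rewrite /phi; case: ifP.
  - have -> : c2 = (c2 * (4 - 3))%R by ring.
    apply: wnorm_le_itv => //; [lra|lra|].
    move=> y /andP[y1 y2]; rewrite /wt /c2.
    apply: ler_pM; rewrite ?powR_ge0//.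
      by apply: powR_norm_le; lra.
    by apply: powR_norm_le; lra.
  move=> kap /andP[kp1 kp2].
  have kap0 : (0 < kap)%R by lra.
  pose Kt := (q (- (h + 2^-1)) * q (h - 1))%R.
  have Kt0 : (0 <= Kt)%R by rewrite !mulr_ge0 ?powR_ge0// ltW.
  have T : (Kt * (4 - 3))%:E <= transf h kap phi.
    apply: transf_ge_itv => //; [lra|lra|].
    move=> y /andP[y1 y2]; rewrite /Kt; apply: ler_pM; rewrite ?powR_ge0 ?(ltW (q0 _))//.
      by apply: powR_norm_ge; lra.
    by apply: powR_norm_ge; lra.
  have W : ((q G1 * eps `^ G1) * q (2^-1 - G2) <= weight G1 G2 kap)%R.
    rewrite /weight; apply: ler_pM; rewrite ?mulr_ge0 ?powR_ge0 ?(ltW (q0 _))//.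
      apply: powR_comparable_ge => //.
        rewrite mulrA ler_pdivlMr//; nra.
      rewrite ler_pdivrMr//; nra.
    by apply: powR_norm_ge; lra.
  rewrite (_ : c1 * eps `^ G1 = ((q G1 * eps `^ G1) * q (2^-1 - G2)) * (Kt * (4 - 3)))%R; last first.
    by rewrite /Kt /c1; ring.
  rewrite EFinM; apply: lee_pmul => //; rewrite lee_fin ?mulr_ge0 ?powR_ge0 ?(ltW (q0 _))//; lra.
pose K := (`|C * c2 `^ p^-1 / c1| + 2)%R.
have K1 : (1 < K * 2 `^ `|G1|)%R.
  by rewrite (@lt_le_trans _ _ K) ?ler_peMr ?powR2_norm_ge1 ?addr_ge0// ltr_wpDl// ltr1n.
have [eps /andP[e0 e1] epsx] := @powR_big_neg G1 (K * 2 `^ `|G1|)%R hG K1.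
(* [key] needs [eps <= 1/2], whence the halving; the factor [2^|G1|] in the choice of [eps] pays for
   it. *)
have e2 : (0 < eps / 2)%R by rewrite divr_gt0.
have e3 : (eps / 2 <= 1 / 2)%R by lra.
have := key _ e2 e3.
have h2 : (2 `^ (- `|G1|) * eps `^ G1 <= (eps / 2) `^ G1)%R by apply: powR_comparable_ge; lra.
rewrite epsx mulrCA -powRD_gt0// addNr powRr0 mulr1 in h2.
rewrite mulrC -ler_pdivlMr// => h3.
by have := ler_norm (C * c2 `^ p^-1 / c1)%R; rewrite /K in h2; lra.
Qed.

(* For [k = 1] the kernel has the singularity [(y - kap)^(-1/2)]; test it against
   [(y - 2)^(-1/2)] cut off at distance [eps] from [2]. *)
Lemma bound1D_p_gt2 (b e G1 G2 p C : R) : (1 <= p)%R -> bound1D 2^-1 b e G1 G2 p C -> (2 < p)%R.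
Proof.
move=> p1 HC; rewrite ltNge; apply/negP => p2.
have p0 : (0 < p)%R by lra.
have four : (1 <= 4 :> R)%R by lra.
pose q (a : R) : R := (4 `^ (- `|a|))%R.
have q0 a : (0 < q a)%R by rewrite powR_gt0.
pose c1 : R := (q G1 * q (2^-1 - G2) * q (- (2^-1 + 2^-1)))%R.
pose c2 : R := (4 `^ `|- (e + b + 1)| * 4 `^ `|b|)%R.
have c10 : (0 < c1)%R by rewrite !mulr_gt0.
have c20 : (0 <= c2)%R by rewrite mulr_ge0 ?powR_ge0.
(* The transform is at least a multiple of the integral of [ds / s] over [[eps, 1]], while the
   [p]-th power of the norm is at most a multiple of the integral of [s^(-p/2)] there. *)
have key eps J : (0 < eps)%R -> (eps < 1)%R -> (0 <= J)%R ->
   \int[mu]_s (if (eps <= s <= 1)%R then s `^ (- (p / 2)) else 0%R)%:E <= J%:E ->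
   (c1 * - ln eps <= C * (c2 * J) `^ p^-1)%R.
  move=> e0 e1 J0 HJ.
  pose phi (y : R) : R := (if 2 + eps <= y <= 3 then (y - 2) `^ (- 2^-1) else 0)%R.
  apply: (HC 2 (2 + eps / 2) phi)%R => //; [lra|lra|by rewrite /phi; mfun| | | |].
  - by move=> y; rewrite /phi; case: ifP => // _; exact: powR_ge0.
  - exact: mulr_ge0.
  - apply: (@le_trans _ _ (c2%:E * \int[mu]_s (if (eps <= s <= 1)%R then s `^ (- (p / 2)) else 0%R)%:E)); last first.
      by rewrite [leRHS]EFinM; apply: lee_wpmul2l; rewrite ?lee_fin.
    rewrite /wnorm (@integral_affine _ 1%R 2%R) ?oner_eq0//; last 2 first.
    - by rewrite /phi /wt; mfun.
    - by move=> y; rewrite lee_fin; case: ifP => // _; rewrite mulr_ge0 ?powR_ge0 ?wt_ge0.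
    rewrite normr1 mul1e -ge0_integralZl//; sides.
    apply: le_integral_ge0 => s.
      by rewrite lee_fin; case: ifP => // _; rewrite mulr_ge0 ?powR_ge0 ?wt_ge0.
    rewrite -EFinM lee_fin mul1r /phi addrK.
    have -> : (2 + eps <= s + 2 <= 3)%R = (eps <= s <= 1)%R by apply/idP/idP; lra.
    case: (boolP (eps <= s <= 1)%R) => hs; last first.
      rewrite normr0 powR0 ?gt_eqF// mul0r mulr0; by case: ifP.
    have /andP[s0 s1] := hs.
    rewrite ifT; last by lra.
    rewrite ger0_norm ?powR_ge0// -powRrM mulrC.
    have -> : (- 2^-1 * p = - (p / 2))%R by field.
    rewrite ler_wpM2r ?powR_ge0// /wt /c2; apply: ler_pM; rewrite ?powR_ge0//.
      by apply: powR_norm_le; lra.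
    by apply: powR_norm_le; lra.
  move=> kap /andP[kp1 kp2].
  have kap0 : (0 < kap)%R by lra.
  have W : (q G1 * q (2^-1 - G2) <= weight G1 G2 kap)%R.
    rewrite /weight; apply: ler_pM; rewrite ?powR_ge0 ?(ltW (q0 _))//.
      apply: powR_norm_ge; apply/andP; split.
        by rewrite ler_pdivlMr//; lra.
      by rewrite ler_pdivrMr//; lra.
    by apply: powR_norm_ge; lra.
  have T : (q (- (2^-1 + 2^-1)) * - ln eps)%:E <= transf 2^-1 kap phi.
    have -> : (- ln eps = ln 1 - ln eps)%R by rewrite ln1 sub0r.
    rewrite EFinM -inv_int// /transf [leRHS](@integral_affine _ 1%R 2%R) ?oner_eq0//; last 2 first.
    - by rewrite /phi; mfun.
    - by move=> y; rewrite lee_fin /phi; case: ifP => // _; rewrite !mulr_ge0 ?powR_ge0//; case: ifP => // _; exact: powR_ge0.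
    rewrite normr1 mul1e -ge0_integralZl//; last 3 first.
    - by mfun.
    - by move=> s _; rewrite lee_fin; case: ifPn => // /andP[h1 h2]; rewrite invr_ge0; lra.
    - by rewrite lee_fin ltW.
    apply: le_integral_ge0 => s.
      rewrite -EFinM lee_fin mulr_ge0 ?(ltW (q0 _))//; case: ifPn => // /andP[h1 h2]; rewrite invr_ge0; lra.
    rewrite -EFinM lee_fin mul1r /phi addrK.
    have -> : (2 + eps <= s + 2 <= 3)%R = (eps <= s <= 1)%R by apply/idP/idP; lra.
    case: (boolP (eps <= s <= 1)%R) => hs; last by rewrite !mulr0; case: ifP.
    have /andP[s0 s1] := hs.
    have sp : (0 < s)%R by lra.
    rewrite ifT; last by lra.
    have -> : (s^-1 = s `^ (- 2^-1) * s `^ (- 2^-1))%R.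
      by rewrite -powRD_gt0// -powR_inv1 ?(ltW sp)//; congr powR; field.
    rewrite mulrA; apply: ler_pM; rewrite ?mulr_ge0 ?powR_ge0 ?(ltW (q0 _))//.
    apply: ler_pM; rewrite ?powR_ge0 ?(ltW (q0 _))//.
      by apply: powR_norm_ge; lra.
    have -> : (2^-1 - 1 = - 2^-1 :> R)%R by field.
    (* Since [kap > 2], [y - kap] is smaller than [s = y - 2], and the exponent is negative. *)
    by apply: powR_antitone; lra.
  have le0 : (0 <= - ln eps)%R by rewrite oppr_ge0 ln_le0// ltW.
  rewrite /c1 -mulrA EFinM; apply: lee_pmul => //; rewrite lee_fin ?mulr_ge0 ?(ltW (q0 _))//.
(* For [p < 2] the norms stay bounded while the logarithm diverges. *)
have [p2'|p2'] := ltP p 2%R.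
  pose J := ((1 - p / 2)^-1)%R.
  have p22 : (0 < 1 - p / 2)%R by lra.
  have J0 : (0 <= J)%R by rewrite invr_ge0 ltW.
  pose Lam := (`|C * (c2 * J) `^ p^-1 / c1| + 1)%R.
  have Lam0 : (0 < Lam)%R by rewrite ltr_wpDl.
  have e0 : (0 < expR (- Lam))%R by exact: expR_gt0.
  have e1 : (expR (- Lam) < 1)%R by rewrite -[X in (_ < X)%R]expR0 ltr_expR oppr_lt0.
  have := key (expR (- Lam)) J e0 e1 J0.
  rewrite powR_int//; last by apply/eqP; lra.
  rewrite expRK opprK => h.
  have {}h : (c1 * Lam <= C * (c2 * J) `^ p^-1)%R.
    apply: h; rewrite lee_fin powR1 (_ : - (p / 2) + 1 = 1 - p / 2)%R; last by ring.
    by rewrite ler_pdivrMr// mulVf ?gt_eqF// gerBl powR_ge0.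
  move: h; rewrite mulrC -ler_pdivlMr// => h.
  by have := ler_norm (C * (c2 * J) `^ p^-1 / c1)%R; rewrite /Lam in h; lra.
(* For [p = 2] the squared norm is itself logarithmic, so the logarithm would be bounded by a
   constant times its own square root. [Lam = K^2 + 1] is large enough to contradict this. *)
have pE : p = 2%R by apply/le_anti; rewrite p2 p2'.
pose K := (C * c2 `^ 2^-1 / c1)%R.
pose Lam := (K ^+ 2 + 1)%R.
have Lam0 : (0 < Lam)%R by rewrite ltr_wpDl// sqr_ge0.
have e0 : (0 < expR (- Lam))%R by exact: expR_gt0.
have e1 : (expR (- Lam) < 1)%R by rewrite -[X in (_ < X)%R]expR0 ltr_expR oppr_lt0.
have := key (expR (- Lam)) Lam e0 e1 (ltW Lam0).
have -> : \int[mu]_s (if expR (- Lam) <= s <= 1 then s `^ (- (p / 2)) else 0)%R%:E = Lam%:E.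
  transitivity (\int[mu]_s (if expR (- Lam) <= s <= 1 then s^-1 else 0)%R%:E).
    apply: eq_integral => s _; congr EFin; case: ifPn => // /andP[s0 s1].
    rewrite -[RHS]powR_inv1; last by rewrite (le_trans _ s0)// ltW.
    by congr powR; rewrite pE; field.
  by rewrite inv_int// ln1 expRK sub0r opprK.
move=> /(_ (lexx _)); rewrite expRK opprK pE powRM ?(ltW Lam0)// [(Lam `^ _)%R]powR12_sqrt ?(ltW Lam0)// mulrA => h.
have sL : (0 < Num.sqrt Lam)%R by rewrite sqrtr_gt0.
have sL2 : (Num.sqrt Lam ^+ 2 = Lam)%R by rewrite sqr_sqrtr// ltW.
have h2 : (Num.sqrt Lam <= K)%R.
  by rewrite /K ler_pdivlMr// -(ler_pM2r sL) [leLHS]mulrAC -expr2 sL2 [leLHS]mulrC.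
have h3 : (Num.sqrt Lam ^+ 2 <= K ^+ 2)%R by rewrite ler_pXn2r ?nnegrE//; lra.
by rewrite sL2 /Lam in h3; lra.
Qed.

End Inequality.

Unset Implicit Arguments.

Theorem theorem4p10 (R : realType) (n k : nat) (a1 a2 g1 g2 p : R)
  (hn : (2 <= n)%N) (hk1 : (1 <= k)%N) (hk2 : (k <= n - 1)%N)
  (hp1 : 1 <= p) (hp2 : 1 + a2 <= p) (hp3 : 0 < a2 -> 1 + a2 < p)
  (hg1 : p = (a1 + n%:R) / k%:R -> 0 < g1) :
  ((2 <= k)%N ->
    (ineq_star n k a1 a2 g1 g2 p <->
     (Num.max 0 ((a1 + n%:R) / p - k%:R) <= g1 /\ (1 + a2) / p <= g2))) /\
  (k = 1%N ->
    (ineq_star n k a1 a2 g1 g2 p <->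
     (Num.max 0 ((a1 + n%:R) / p - k%:R) <= g1 /\ (1 + a2) / p <= g2 /\ 2 < p))).
Proof.
have p0 : 0 < p by lra.
have n0 : (0 < n)%N by exact: leq_trans hn.
have kn : (k < n)%N by apply: leq_ltn_trans hk2 _; rewrite subn1 prednK.
have kR : 0 < k%:R :> R by rewrite ltr0n.
have bE : ((a1 + n%:R) / 2 - 1 + 1) / p - k%:R / 2 = ((a1 + n%:R) / p - k%:R) / 2.
  by field; rewrite gt_eqF.
have eE : (1 + a2) / 2 / p = (1 + a2) / p / 2 by field; rewrite gt_eqF.
have necessity : ineq_star n k a1 a2 g1 g2 p ->
    (Num.max 0 ((a1 + n%:R) / p - k%:R) <= g1 /\ (1 + a2) / p <= g2) /\ (k = 1%N -> 2 < p).
  move=> /(ineq_star_1D hk1 kn p0)[C HC].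
  have := bound1D_G1_ge p0 HC; have := bound1D_G2_ge p0 HC; have := bound1D_G1_ge0 p0 HC.
  rewrite bE eE => h1 h2 h3; split; first by split; [rewrite ge_max; apply/andP; split|]; lra.
  move=> k1; have h12 : k%:R / 2 = 2^-1 :> R by rewrite k1 mul1r.
  by rewrite h12 in HC; exact: bound1D_p_gt2 hp1 HC.
have sufficiency : (k = 1%N -> 2 < p) ->
    Num.max 0 ((a1 + n%:R) / p - k%:R) <= g1 -> (1 + a2) / p <= g2 ->
    ineq_star n k a1 a2 g1 g2 p.
  rewrite ge_max => k1p /andP[G1 G1'] G2; apply: ineq_star_of_1D => //.
  have k2 : k <> 1%N -> 1 <= k%:R / 2 :> R.
    move=> k1; rewrite ler_pdivlMr// mul1r ler_nat ltn_neqAle hk1 andbT eq_sym; exact/eqP.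
  (* At [p = 1] the case [k = 1] is excluded by [2 < p], so [k / 2 >= 1] and the pointwise bound is
     available. *)
  have [p1|p1] := eqVneq p 1.
    exists 1 => // kap phi N kap1 mphi NE.
    have h1 : 1 <= k%:R / 2 :> R by apply: k2 => k1; have := k1p k1; lra.
    have a20 : a2 <= 0 by lra.
    rewrite mul1r p1 invr1.
    have N0 : 0 <= N.
      rewrite -lee_fin -NE; apply: integral_ge0 => y _; rewrite lee_fin.
      by case: ifP => // _; rewrite mulr_ge0 ?powR_ge0 ?wt_ge0.
    rewrite powRr1// -NE p1 invr1 in bE eE G1' G2 *.
    have c1 : (1 + a2) / 2 <= 2^-1 by lra.
    have c2 : 0 <= g1 / 2 by lra.
    have c3 : (a1 + n%:R) / 2 - 1 + 1 - k%:R / 2 <= g1 / 2 by lra.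
    have c4 : (1 + a2) / 2 <= g2 / 2 by lra.
    apply: le_trans (transform_le_L1 h1 c1 c2 c3 c4 kap1 mphi) _.
    rewrite /wnorm le_eqVlt; apply/orP; left; apply/eqP; apply: eq_integral => y _.
    by rewrite powRr1.
  have p1' : 1 < p by rewrite lt_neqAle eq_sym p1.
  apply: (@transform_le_Lp R) => //; rewrite ?bE ?eE; try lra.
  - move=> h1; have k1 : k = 1%N.
      by apply: contrapT => /k2; lra.
    by split; [rewrite k1 mul1r|exact: k1p].
  (* Integrability at infinity: for [a2 > 0] this is the strict inequality assumed in the theorem,
     and for [a2 <= 0] it follows from [p > 1]. *)
  - suff : (1 + a2) / p < 1 by lra.
    rewrite ltr_pdivrMr// mul1r.
    by have [a0|a0] := ltP 0 a2; [exact: hp3|lra].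
split=> hk.
  split=> [/necessity[]//|[G1 G2]].
  by apply: sufficiency => // k1; rewrite k1 in hk.
split=> [/necessity[[G1 G2] /(_ hk)]//|[G1 [G2 p2]]].
exact: sufficiency.
Qed.
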